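(* For every positive integer $d$ there is a constant $C_d$ such that for every simplicial $d$-sphere $\mathsf{K}$ on $n\ge 1$ vertices, $\chi(\mathcal{F}(\mathsf{K}))\leq C_d\, n^{\frac{\lceil d/2\rceil-1}{d}}$; i.e. $\chi(\mathcal{F}(\mathsf{K}))\in O(n^{\frac{\lceil d/2\rceil-1}{d}})$.
   Context: A simplicial $d$-sphere is a simplicial complex whose geometric realization is homeomorphic to the $d$-dimensional sphere. For a simplicial complex $\mathsf{K}$, $\mathcal{F}(\mathsf{K})$ is the hypergraph on the vertex set of $\mathsf{K}$ whose hyperedges are the facets (inclusion-maximal faces) of $\mathsf{K}$. A (weak) coloring of a hypergraph $\mathcal{H}$ with $m$ colors is a map $c:V(\mathcal{H})\to[m]$ such that no hyperedge is contained in a single color class; $\chi(\mathcal{H})$ is the minimum number of colors of such a coloring. *)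

(* Defs.v *)
From HB Require Import structures.
From mathcomp Require Import all_boot all_order all_algebra.
From mathcomp Require Import all_classical all_reals all_analysis.
Set Implicit Arguments. Unset Strict Implicit. Unset Printing Implicit Defensive.
Import Order.TTheory GRing.Theory Num.Theory.
Import numFieldNormedType.Exports.
Local Open Scope classical_set_scope.
Local Open Scope ring_scope.

Definition simplicial_complex (n : nat) (K : {set {set 'I_n}}) : Prop :=
  (forall F, F \in K -> F != finset.set0)
  /\ (forall F G : {set 'I_n}, F \in K -> G \subset F -> G != finset.set0 -> G \in K)
  /\ (forall i : 'I_n, [set i]%SET \in K).

(* Geometric realization of K inside R^n (row vectors), using the standard
   simplex: points with nonnegative barycentric coordinates summing to 1
   whose support is a face of K. *)
Definition geom_realization (R : realType) (n : nat) (K : {set {set 'I_n}})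
  : set 'rV[R]_n :=
  fun x => (forall i, 0 <= x ord0 i) /\ \sum_i x ord0 i = 1
           /\ exists2 F, F \in K & forall i, x ord0 i != 0 -> i \in F.
Arguments geom_realization R {n} K _.

Definition unit_sphere (R : realType) (d : nat) : set 'rV[R]_d.+1 :=
  fun y => \sum_i (y ord0 i) ^+ 2 = 1.
Arguments unit_sphere : clear implicits.

Definition homeomorphic (T U : topologicalType) (A : set T) (B : set U) : Prop :=
  exists (f : T -> U) (g : U -> T),
    [/\ (forall x, A x -> B (f x)), (forall y, B y -> A (g y)),
        (forall x, A x -> g (f x) = x) & (forall y, B y -> f (g y) = y)]
    /\ {within A, continuous f} /\ {within B, continuous g}.

Definition simplicial_sphere (R : realType) (d n : nat) (K : {set {set 'I_n}})
  : Prop :=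
  simplicial_complex K /\ homeomorphic (geom_realization R K) (unit_sphere R d).
Arguments simplicial_sphere R d {n} K.

Definition facet (n : nat) (K : {set {set 'I_n}}) (F : {set 'I_n}) : bool :=
  (F \in K) && [forall G in K, (F \subset G) ==> (G == F)].

Definition facet_coloring (n m : nat) (K : {set {set 'I_n}}) (c : 'I_n -> 'I_m)
  : bool :=
  [forall F, facet K F ==> ~~ [exists k : 'I_m, F \subset [set v | c v == k]]].

Definition facet_colorable (n : nat) (K : {set {set 'I_n}}) (m : nat) : bool :=
  [exists c : {ffun 'I_n -> 'I_m}, facet_coloring K c].

(* Chromatic number chi(F(K)): least m admitting a weak coloring with m colors
   (searched in 0..n, which always suffices when a coloring exists since the
   identity coloring uses n colors; returns n.+1 if no coloring exists). *)
Definition facet_chi (n : nat) (K : {set {set 'I_n}}) : nat :=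
  find (facet_colorable K) (iota 0 n.+1).

(* Main.v *)
(* Homology of K over a field F of characteristic 2: deleting the open star of a
   nonempty face G from |K| leaves a retract of a punctured sphere, so the faces not
   containing G carry an acyclic complex.  Hence K is pure, and it has a fundamental
   cycle z which is nonzero on every facet; an invariance-of-dimension argument shows
   that facets have d + 1 vertices.

   Let i = ceil(d/2), b = d - i, and place the vertices on the moment curve in F^d.
   On each face of size at most d the vertices are linearly independent, whereas a
   facet carries one linear relation c.  For a function f on the facets inside W, the
   d-cochains f(A) c^(tensor i) that are orthogonal to z are coboundaries, and a zig-zag
   through the double complex of cochains with coefficients in the tensor powers
   of F^V -> F^d recovers f from a function on b-subsets of W with values in
   (F^d)^(tensor i).  Counting over a finite field, W spans at most
   |W|^i + C(|W|, b) d^i facets.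

   A hypergraph with edges of size d + 1 in which every W spans O(|W|^i) edges is
   O(n^((i-1)/d))-colorable: for i = 1 it is degenerate, and for i > 1 a random coloring
   of W with O(|W|^((i-1)/d)) colors leaves at most |W|/2 monochromatic edges; one vertex
   of each is recolored recursively with fresh colors. *)
Require Import Defs.
From mathcomp Require Import all_boot all_order all_algebra ssrAC boolp.
Set Implicit Arguments. Unset Strict Implicit. Unset Printing Implicit Defensive.
Import GRing.Theory.
Local Open Scope ring_scope.

(** * Chains modulo 2 *)

Section FaceSums.

(** The random coloring recurses on vertex subsets, so the edge bound is needed for every [W],
    although the complex induced on [W] is in general no sphere. The double complex helps because it
    is local: weights are put only on facets inside [W], and the reconstruction of a weight at a
    facet reads only data on [b]-subsets of that facet. The lifts in the zig-zag are arbitrary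
    choices, so the reconstruction need not be linear; over a finite field injectivity is enough, as
    cardinalities replace dimensions. Characteristic 2 removes all signs and orientations, and the
    field must contain [n] distinct parameters for the moment curve. The exponent [i] is the least
    one with [b <= i], which keeps ['C(|W|, b)] of order at most [|W| ^ i]. Links are never studied:
    acyclic deletions already give exactness on the stars of faces, which is what the double complex
    requires. Homotopies and homeomorphisms act on chains through vertex labels of fine
    subdivisions, so simplicial chains suffice throughout. *)

Fixpoint faces (T : Type) (s : seq T) : seq (seq T) :=
  if s is x :: s' then s' :: map (cons x) (faces s') else [::].

Lemma faces_size (T : eqType) (s f : seq T) : f \in faces s -> (size f).+1 = size s.
Proof.
elim: s f => //= x s IH f; rewrite inE => /orP[/eqP->//|/mapP[g /IH h ->]] /=.
by rewrite h.
Qed.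

Lemma faces_sub (T : eqType) (s f : seq T) : f \in faces s -> {subset f <= s}.
Proof.
elim: s f => //= x s IH f; rewrite inE => /orP[/eqP->|/mapP[g /IH h ->]] y.
  by rewrite inE orbC => ->.
by rewrite !inE => /orP[->//|/h->]; rewrite orbT.
Qed.

Lemma faces_map (T U : Type) (g : T -> U) (s : seq T) :
  faces (map g s) = map (map g) (faces s).
Proof. by elim: s => //= x s ->; rewrite -!map_comp. Qed.

(** Two positions can be deleted in either order, so each term occurs twice. The values are in an
    arbitrary group of exponent 2, because the identity also serves for homotopies and
    subdivisions. *)
Lemma big_faces_faces (V : zmodType) (T : Type) (G : seq T -> V) (s : seq T) :
  (forall x : V, x + x = 0) ->
  \sum_(f <- faces s) \sum_(f' <- faces f) G f' = 0.
Proof.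
move=> ch2; elim: s G => [|x s IH] G /=; first by rewrite big_nil.
rewrite big_cons big_map /=.
under [X in _ + X]eq_bigr => f _ do rewrite big_cons big_map.
by rewrite big_split /= IH addr0 ch2.
Qed.

Lemma big_faces_rem (V : nmodType) (T : eqType) (G : seq T -> V) (s : seq T) :
  uniq s -> \sum_(f <- faces s) G f = \sum_(x <- s) G (rem x s).
Proof.
elim: s G => [|x s IH] G /=; first by rewrite !big_nil.
case/andP=> xs us; rewrite !big_cons big_map eqxx IH //; congr (_ + _).
apply: eq_big_seq => y ys; case: eqP => // e; by rewrite e ys in xs.
Qed.

End FaceSums.

Section Chains.
Context (F : fieldType) (ch2 : forall x : F, x + x = 0) (n : nat).

Notation chain := {ffun {set 'I_n} -> F}.
Implicit Types (c : chain) (A B : {set 'I_n}) (v : 'I_n).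

Lemma chain_ch2 (c : chain) : c + c = 0.
Proof. by apply/ffunP=> A; rewrite !ffunE ch2. Qed.

(* The empty face is a face: this is the augmented complex. *)
Definition bd (c : chain) : chain := [ffun A : {set 'I_n} => \sum_(v | v \notin A) c (v |: A)].

Definition cone (v : 'I_n) (c : chain) : chain :=
  [ffun A : {set 'I_n} => if v \in A then c (A :\ v) else 0].

Definition ind (A : {set 'I_n}) : chain := [ffun B => (B == A)%:R].

Lemma bdD c c' : bd (c + c') = bd c + bd c'.
Proof. by apply/ffunP=> A; rewrite !ffunE -big_split; apply: eq_bigr => v _; rewrite ffunE. Qed.

Lemma bd0 : bd 0 = 0.
Proof. by apply/ffunP=> A; rewrite !ffunE big1 // => v _; rewrite ffunE. Qed.

Lemma bd_sum (I : Type) (r : seq I) (P : pred I) (G : I -> chain) :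
  bd (\sum_(i <- r | P i) G i) = \sum_(i <- r | P i) bd (G i).
Proof. exact: (big_morph bd bdD bd0). Qed.

Lemma coneD v c c' : cone v (c + c') = cone v c + cone v c'.
Proof. by apply/ffunP=> A; rewrite !ffunE; case: ifP; rewrite ?ffunE ?addr0. Qed.

Lemma cone0 v : cone v 0 = 0.
Proof. by apply/ffunP=> A; rewrite !ffunE; case: ifP; rewrite ?ffunE. Qed.

Lemma cone_sum v (I : Type) (r : seq I) (P : pred I) (G : I -> chain) :
  cone v (\sum_(i <- r | P i) G i) = \sum_(i <- r | P i) cone v (G i).
Proof. exact: (big_morph (cone v) (coneD v) (cone0 v)). Qed.

(** Faces of [c] that already contain [v] have zero cone, and the formula survives: for these
    [cone v (bd c)] returns the face itself, which cancels against [c]. *)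
Lemma bd_cone v c : bd (cone v c) = c + cone v (bd c).
Proof.
apply/ffunP=> A; rewrite !ffunE; case: ifP => vA; last first.
  rewrite (bigD1 v) ?vA //= ffunE setU11 setU1K ?vA // big1 ?addr0 //.
  move=> u /andP[uA uv]; rewrite ffunE in_setU1 eq_sym (negPf uv) vA //.
rewrite [in RHS](bigD1 v) ?inE ?eqxx //= addrA setD1K // ch2 add0r.
apply: eq_big => [u|u uA].
  by rewrite !inE; case: eqP => [->|]; rewrite ?vA ?andbT.
rewrite ffunE in_setU1 vA orbT; congr (c _); apply/setP=> x.
rewrite !inE; case: (x =P u) => [->|] //=; rewrite ?andbT ?orbT.
by apply/eqP => e; rewrite e vA in uA.
Qed.

Lemma coneC u v c : cone u (cone v c) = cone v (cone u c).
Proof.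
apply/ffunP=> A; rewrite !ffunE; case: (u =P v) => [->//|/eqP uv].
rewrite !inE uv eq_sym uv /=; case: ifP => // uA; case: ifP => // vA.
by congr (c _); apply/setP=> x; rewrite !inE andbCA.
Qed.

(** The chain of an ordered, possibly degenerate simplex. A repeated vertex makes it 0, so images
    under simplicial maps need no case distinction. *)
Definition smp (s : seq 'I_n) : chain := foldr cone (ind set0) s.

Lemma bd_ind0 : bd (ind set0) = 0.
Proof.
apply/ffunP=> A; rewrite !ffunE big1 // => v _; rewrite ffunE.
by case: eqP => // e; have := setU11 v A; rewrite e inE.
Qed.

Lemma bd_smp s : bd (smp s) = \sum_(f <- faces s) smp f.
Proof.
elim: s => [|x s IH] /=; first by rewrite big_nil bd_ind0.
by rewrite bd_cone IH big_cons big_map cone_sum.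
Qed.

Lemma cone_ind v (A : {set 'I_n}) : v \notin A -> cone v (ind A) = ind (v |: A).
Proof.
move=> vA; apply/ffunP=> B; rewrite !ffunE; case: ifP => vB; last first.
  by case: eqP => // e; rewrite e setU11 in vB.
congr (_ %:R); congr nat_of_bool; apply/eqP/eqP => [<-|->].
  by rewrite setD1K.
by rewrite setU1K.
Qed.

Lemma cone_cone v c : cone v (cone v c) = 0.
Proof. by apply/ffunP=> A; rewrite !ffunE !inE eqxx /= if_same. Qed.

Lemma smp_uniq s : smp s = if uniq s then ind [set x in s] else 0.
Proof.
elim: s => [|x s IH] /=.
  by congr ind; apply/setP=> x; rewrite !inE.
case xs: (x \in s) => /=; last first.
  rewrite IH; case: ifP => us; last by rewrite cone0.
  rewrite cone_ind ?inE ?xs //; congr ind; apply/setP=> y; by rewrite !inE.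
elim: s xs {IH} => //= y s IH; rewrite inE => /orP[/eqP->|xs].
  exact: cone_cone.
by rewrite coneC IH // cone0.
Qed.

Lemma smp_enum (A : {set 'I_n}) : smp (enum A) = ind A.
Proof. by rewrite smp_uniq enum_uniq; congr ind; apply/setP=> x; rewrite inE mem_enum. Qed.

(** The linear map on chains that takes the value [g A] on the basis chain [ind A]. *)
Definition ext (g : {set 'I_n} -> chain) (c : chain) : chain :=
  \sum_A [ffun B => c A * g A B].

Lemma extE g c B : ext g c B = \sum_A c A * g A B.
Proof. by rewrite sum_ffunE; apply: eq_bigr => A _; rewrite ffunE. Qed.

Lemma ext_ind c : ext ind c = c.
Proof.
apply/ffunP=> B; rewrite extE (bigD1 B) //= ffunE eqxx mulr1 big1 ?addr0 //.
by move=> A AB; rewrite ffunE eq_sym (negPf AB) mulr0.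
Qed.

Lemma eq_ext g g' c : (forall A, c A != 0 -> g A = g' A) -> ext g c = ext g' c.
Proof.
move=> h; apply/ffunP=> B; rewrite !extE; apply: eq_bigr => A _.
by have [->|/h->//] := eqVneq (c A) 0; rewrite !mul0r.
Qed.

Lemma extDl g g' c : ext (fun A => g A + g' A) c = ext g c + ext g' c.
Proof.
apply/ffunP=> B; rewrite ffunE !extE -big_split /=.
by apply: eq_bigr => A _; rewrite ffunE mulrDr.
Qed.

Lemma bd_ext g c : bd (ext g c) = ext (fun A => bd (g A)) c.
Proof.
apply/ffunP=> B; rewrite extE ffunE.
under eq_bigr => v _ do rewrite extE.
rewrite exchange_big; apply: eq_bigr => A _.
by rewrite ffunE mulr_sumr.
Qed.

Lemma ext_bd g c :
  ext g (bd c) = ext (fun A => \sum_(v in A) g (A :\ v)) c.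
Proof.
apply/ffunP=> B; rewrite !extE.
under eq_bigr => A _ do rewrite ffunE mulr_suml.
under [RHS]eq_bigr => A _ do rewrite sum_ffunE mulr_sumr.
rewrite (exchange_big_dep xpredT) //= [RHS](exchange_big_dep xpredT) //=.
apply: eq_bigr => v _.
rewrite (reindex_onto (fun A => A :\ v) (fun A => v |: A)) /=; last first.
  by move=> A vA; rewrite setU1K.
apply: eq_big => [A|A].
  by rewrite !inE eqxx /=; apply/eqP/idP => [<-|vA]; rewrite ?setU11 ?setD1K.
by case/andP=> _ /eqP->.
Qed.

Lemma bd_indE (A : {set 'I_n}) : bd (ind A) = \sum_(v in A) ind (A :\ v).
Proof.
rewrite -smp_enum bd_smp big_faces_rem ?enum_uniq // big_enum /=.
apply: eq_bigr => v vA; rewrite smp_uniq rem_uniq ?enum_uniq //.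
congr ind; apply/setP=> x; rewrite inE mem_rem_uniq ?enum_uniq //.
by rewrite !inE mem_enum.
Qed.

Lemma bdbd c : bd (bd c) = 0.
Proof.
rewrite -(ext_ind c) !bd_ext; apply/ffunP=> B; rewrite extE ffunE big1 // => A _.
rewrite -smp_enum bd_smp bd_sum.
under eq_bigr => f _ do rewrite bd_smp.
rewrite big_faces_faces ?ffunE ?mulr0 //; exact: chain_ch2.
Qed.

Definition inside (A : {set 'I_n}) (c : chain) := forall B, c B != 0 -> B \subset A.

Lemma insideD A c c' : inside A c -> inside A c' -> inside A (c + c').
Proof.
move=> h h' B; rewrite ffunE; have [->|/h//] := eqVneq (c B) 0.
by rewrite add0r => /h'.
Qed.

Lemma inside_sumP A (I : eqType) (r : seq I) (G : I -> chain) :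
  (forall i, i \in r -> inside A (G i)) -> inside A (\sum_(i <- r) G i).
Proof.
move=> h; rewrite big_seq.
by elim/big_ind: _ => [B|c c'|i /h//]; [rewrite ffunE eqxx | apply: insideD].
Qed.

Lemma inside_cone A v c : v \in A -> inside A c -> inside A (cone v c).
Proof.
move=> vA h B; rewrite ffunE; case: ifP => [vB /h sub|_]; last by rewrite eqxx.
by rewrite -(setD1K vB) subUset sub1set vA.
Qed.

Lemma inside_ind A B : B \subset A -> inside A (ind B).
Proof. by move=> BA C; rewrite ffunE; case: (C =P B) => [->//|_]; rewrite eqxx. Qed.

Lemma inside_smp A s : {subset s <= A} -> inside A (smp s).
Proof.
elim: s => [|x s IH] h /=; first by apply: inside_ind; apply: sub0set.
apply: inside_cone; first by apply: h; rewrite inE eqxx.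
by apply: IH => y ys; apply: h; rewrite inE ys orbT.
Qed.

Section Prism.
Context (T : eqType) (l m : T -> 'I_n).

(* The prism between the simplicial maps l and m. *)
Fixpoint prism (s : seq T) : chain :=
  if s is x :: s' then cone (l x) (cone (m x) (smp (map m s'))) + cone (l x) (prism s')
  else 0.

(** The cone formula, applied at [l x] and [m x], replaces the usual bookkeeping with faces; the
    interior terms cancel in pairs. *)
Lemma bd_prism s :
  bd (prism s) + \sum_(f <- faces s) prism f = smp (map l s) + smp (map m s).
Proof.
elim: s => [|x s IH] /=; first by rewrite bd0 big_nil addr0 chain_ch2.
rewrite bdD !bd_cone big_cons big_map /= big_split /=.
rewrite -!cone_sum -[\sum_(i <- faces s) smp (map m i)]/_.
have -> : \sum_(i <- faces s) smp (map m i) = bd (smp (map m s)).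
  by rewrite bd_smp faces_map big_map.
move/(congr1 (cone (l x))): IH; rewrite !coneD.
set a := cone (m x) (smp (map m s)).
set b := cone (l x) (smp (map m s)).
set c' := cone (l x) (cone _ (bd _)).
set p := prism s; set q := cone _ (bd p); set r := cone _ (\sum_(_ <- _) _).
set w := cone _ (smp _) => E.
rewrite (_ : _ + (p + (c' + r)) = a + (b + (q + r)) + (c' + c') + (p + p)).
  by rewrite E !chain_ch2 !addr0 (addrC w) [b + _]addrA chain_ch2 add0r addrC.
by rewrite !addrA [LHS](ACl (1*2*5*8*3*7*4*6)).
Qed.

Lemma inside_prism A s :
  {in s, forall x, l x \in A /\ m x \in A} -> inside A (prism s).
Proof.
elim: s => [|x s IH] h /=; first by move=> B; rewrite ffunE eqxx.
have [lx mx] := h x (mem_head _ _).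
have {}h : {in s, forall x, l x \in A /\ m x \in A}.
  by move=> y ys; apply: h; rewrite inE ys orbT.
apply: insideD; apply: inside_cone => //; last exact: IH.
apply: inside_cone => //; apply: inside_smp => _ /mapP[y /h[_ my] ->] //.
Qed.

End Prism.

End Chains.

(** * Acyclic deletions and the fundamental cycle *)

Section Cochains.
Context (F : fieldType) (ch2 : forall x : F, x + x = 0) (n : nat).

Notation chain := {ffun {set 'I_n} -> F}.
Implicit Types (b c z : chain) (A B G : {set 'I_n}) (K L : {set {set 'I_n}}).
Implicit Types u y w : {set 'I_n} -> F.

Definition downset L := forall A B, A \in L -> B \subset A -> B \in L.

(* S is a homotopy from the identity to zero on the augmented chains of L. *)
Definition contracts L := exists S : {set 'I_n} -> chain, forall A, A \in L ->
  (forall B, S A B != 0 -> B \in L) /\ bd (S A) + \sum_(v in A) S (A :\ v) = ind F A.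

Definition cobd u A := \sum_(v in A) u (A :\ v).

Lemma bd_cobd c u : \sum_B bd c B * u B = \sum_A c A * cobd u A.
Proof.
have E A : \sum_B bd (ind F A) B * u B = cobd u A.
  rewrite (bd_indE ch2) /cobd.
  under eq_bigr => B _ do rewrite sum_ffunE mulr_suml.
  rewrite exchange_big; apply: eq_bigr => v _ /=.
  rewrite (bigD1 (A :\ v)) //= ffunE eqxx mul1r big1 ?addr0 // => B.
  by rewrite ffunE => /negPf->; rewrite mul0r.
rewrite -[c in bd c]ext_ind bd_ext.
under eq_bigr => B _ do rewrite extE mulr_suml.
rewrite exchange_big; apply: eq_bigr => A _ /=.
under eq_bigr => B _ do rewrite -mulrA.
by rewrite -mulr_sumr E.
Qed.

Lemma cobd_cobd u A : cobd (cobd u) A = 0.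
Proof.
have: \sum_B bd (bd (ind F A)) B * u B = cobd (cobd u) A.
  rewrite !bd_cobd (bigD1 A) //= ffunE eqxx mul1r big1 ?addr0 // => B BA.
  by rewrite ffunE (negPf BA) mul0r.
by move<-; rewrite big1 // => B _; rewrite bdbd // ffunE mul0r.
Qed.

Lemma eq_cobd u w A : (forall v, v \in A -> u (A :\ v) = w (A :\ v)) ->
  cobd u A = cobd w A.
Proof. by move=> h; apply: eq_bigr. Qed.

Lemma cobdD u w A : cobd (fun B => u B + w B) A = cobd u A + cobd w A.
Proof. exact: big_split. Qed.

Lemma cobd0 u A : (forall v, v \in A -> u (A :\ v) = 0) -> cobd u A = 0.
Proof. by move=> h; apply: big1. Qed.

Lemma card_setD1 A v : v \in A -> #|A :\ v|.+1 = #|A|.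
Proof. by move=> vA; rewrite (cardsD1 v A) vA. Qed.

(** Composing [u] with the homotopy [S] gives the solution [y]. As [S] need not respect sizes, [u]
    is first cut down to the faces of [L] of size [r]. *)
Lemma cocycle_exact L r u : downset L -> contracts L ->
  (forall A, A \in L -> #|A| = r.+1 -> cobd u A = 0) ->
  exists2 y, (forall A, y A != 0 -> A \in L /\ #|A|.+1 = r) &
    forall A, A \in L -> #|A| = r -> cobd y A = u A.
Proof.
move=> dL [S hS] hu.
pose u' A := if (A \in L) && (#|A| == r) then u A else 0.
pose y0 A := \sum_B S A B * u' B.
exists (fun A => if (A \in L) && (#|A|.+1 == r) then y0 A else 0).
  by move=> A; case: andP => [[? /eqP]|]; rewrite ?eqxx.
move=> A AL Ar; have [supp eqS] := hS A AL.
transitivity (cobd y0 A).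
  apply: eq_cobd => v vA; rewrite (dL A) ?subD1set //= card_setD1 // Ar eqxx //.
transitivity (\sum_B ind F A B * u' B); last first.
  rewrite (bigD1 A) //= ffunE eqxx mul1r /u' AL Ar eqxx big1 ?addr0 //.
  by move=> B; rewrite ffunE => /negPf->; rewrite mul0r.
rewrite -eqS.
under [RHS]eq_bigr => B _ do rewrite ffunE mulrDl.
rewrite big_split /= bd_cobd [X in X + _]big1 ?add0r; last first.
  move=> B _; have [->|/supp BL] := eqVneq (S A B) 0; first by rewrite mul0r.
  have [Br|Br] := eqVneq #|B| r.+1.
    rewrite -[RHS](mulr0 (S A B)) -(hu _ BL Br); congr (_ * _).
    apply: eq_cobd => v vB; rewrite /u' (dL B) ?subD1set //=.
    by rewrite -eqSS card_setD1 // Br eqxx.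
  rewrite cobd0 ?mulr0 // => v vB; rewrite /u' -eqSS card_setD1 // (negPf Br) andbF //.
rewrite /cobd exchange_big; apply: eq_bigr => B _ /=.
by rewrite sum_ffunE mulr_suml.
Qed.

End Cochains.

Section AcyclicDeletions.
Context (F : fieldType) (ch2 : forall x : F, x + x = 0) (n : nat).
Notation chain := {ffun {set 'I_n} -> F}.
Implicit Types (b c z : chain) (A B G : {set 'I_n}).
Implicit Types u y w : {set 'I_n} -> F.

Definition deletion (K : {set {set 'I_n}}) G := [set A in K | ~~ (G \subset A)].

Definition maxface (K : {set {set 'I_n}}) A :=
  (A \in K) && [forall B in K, (A \subset B) ==> (B == A)].

Context (K : {set {set 'I_n}}) (downK : downset K).
Context (conK : forall G, G \in K -> G != set0 -> contracts F (deletion K G)).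

Lemma deletion_down G : downset (deletion K G).
Proof.
move=> A B; rewrite !inE => /andP[AK GA] BA; rewrite (downK AK) //=.
by apply: contra GA => /subset_trans; apply.
Qed.

Lemma maxfaceP A B : maxface K A -> B \in K -> A \subset B -> B = A.
Proof. by case/andP=> _ /forall_inP h BK AB; apply/eqP; exact: (implyP (h _ BK)). Qed.

(** The homogeneous part of size [k]; a contraction may mix faces of different sizes. *)
Definition homog (k : nat) c : chain := [ffun A : {set 'I_n} => if #|A| == k then c A else 0].

Lemma bd_homog k c : bd (homog k.+1 c) = homog k (bd c).
Proof.
apply/ffunP=> A; rewrite !ffunE; case: eqP => Ak; last first.
  apply: big1 => v vA; rewrite ffunE cardsU1 vA /= add1n eqSS.
  by case: eqP.
by apply: eq_bigr => v vA; rewrite ffunE cardsU1 vA add1n Ak eqxx.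
Qed.

Lemma cycle_deletion L c : downset L -> contracts F L ->
  (forall A, c A != 0 -> A \in L) -> bd c = 0 ->
  exists2 b : chain, (forall A, b A != 0 -> A \in L) & bd b = c.
Proof.
move=> dL [S hS] cL bc.
exists (ext S c).
  move=> A; rewrite extE; apply: contraNT => AL; apply/eqP; apply: big1 => B _.
  have [->|/cL BL] := eqVneq (c B) 0; first by rewrite mul0r.
  have [supp _] := hS B BL.
  by have [->|/supp] := eqVneq (S B A) 0; rewrite ?mulr0 // (negPf AL).
have E : ext (fun A => bd (S A) + \sum_(v in A) S (A :\ v)) c = ext (@ind F n) c.
  by apply: eq_ext => A /cL /hS [].
rewrite extDl ext_ind -ext_bd -bd_ext bc in E; rewrite -[RHS]E -[LHS]addr0; congr (_ + _).
by apply/ffunP=> B; rewrite extE ffunE big1 // => A _; rewrite ffunE mul0r.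
Qed.

(** The boundary of [s] is a cycle of the deletion of [s], which is acyclic, so it bounds some [b]
    there; then [ind F s + b] is a cycle of [K] through [s]. *)
Lemma facet_cycle s : maxface K s -> s != set0 ->
  exists z : chain, [/\ forall A, z A != 0 -> A \in K /\ #|A| = #|s|, bd z = 0 & z s = 1].
Proof.
move=> ms s0; have sK : s \in K by case/andP: ms.
pose L := deletion K s.
have inL A : A \subset s -> A != s -> A \in L.
  move=> As An; rewrite inE (downK sK) //=; apply: contra An => sA.
  by rewrite eqEsubset As.
have bL A : bd (ind F s) A != 0 -> A \in L.
  rewrite (bd_indE ch2) sum_ffunE => h.
  have [v vs|] := pickP [pred v in s | A == s :\ v].
    case/andP: vs => vs /eqP->; apply: inL; first exact: subD1set.
    by apply/eqP => e; move: vs; rewrite -e !inE eqxx.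
  move=> none; case/eqP: h; apply: big1 => v vs; rewrite ffunE.
  by move: (none v); rewrite /= vs /= => ->.
have [b bsupp bb] := cycle_deletion (@deletion_down s) (conK sK s0) bL (bdbd ch2 _).
have zK A : (ind F s + b) A != 0 -> A \in K.
  rewrite !ffunE; case: (A =P s) => [->//|_]; rewrite add0r => /bsupp.
  by rewrite inE => /andP[].
exists (homog #|s| (ind F s + b)); split.
- by move=> A; rewrite {1}ffunE; case: ifP => [/eqP As /zK //|_]; rewrite eqxx.
- have [k ks] : exists k, #|s| = k.+1.
    by exists #|s|.-1; rewrite prednK // card_gt0.
  rewrite ks bd_homog bdD bb chain_ch2 //.
  by apply/ffunP=> A; rewrite !ffunE if_same.
- rewrite !ffunE !eqxx; suff -> : b s = 0 by rewrite addr0.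
  by apply/eqP/negPn/negP => /bsupp; rewrite inE subxx andbF.
Qed.

(** If the sizes differ, the cycle through [s] misses [t], lies in the deletion of [t] and is a
    boundary there; but a maximal face such as [s] has coefficient 0 in every boundary of [K]. *)
Lemma maxface_pure s t : maxface K s -> maxface K t -> s != set0 -> t != set0 ->
  #|s| = #|t|.
Proof.
move=> ms mt s0 t0; apply/eqP/negPn/negP => st.
have [z [zK zc zs]] := facet_cycle ms s0.
have tK : t \in K by case/andP: mt.
have zL A : z A != 0 -> A \in deletion K t.
  move=> /zK[AK As]; rewrite inE AK /=; apply/negP => tA.
  by rewrite (maxfaceP mt AK tA) in As; rewrite As eqxx in st.
have [b bL bz] := cycle_deletion (@deletion_down t) (conK tK t0) zL zc.
suff : bd b s = 0 by rewrite bz zs => /eqP; rewrite oner_eq0.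
rewrite ffunE; apply: big1 => v vs; apply/eqP/negPn/negP => /bL.
rewrite inE => /andP[vK _]; have := maxfaceP ms vK (subsetUr _ _).
by move=> e; rewrite -e setU11 in vs.
Qed.

Context (e : nat) (e_gt0 : (0 < e)%N).
Context (pureK : forall A, maxface K A -> #|A| = e).

Lemma maxfaceE A : A \in K -> #|A| = e -> maxface K A.
Proof.
move=> AK Ae; rewrite /maxface AK; apply/forall_inP => B BK; apply/implyP => AB.
case: (@arg_maxnP _ B (fun C => (C \in K) && (B \subset C)) (fun C => #|C|)).
  by rewrite BK subxx.
move=> C /andP[CK BC] Cmax.
have mC : maxface K C.
  rewrite /maxface CK; apply/forall_inP => C' C'K; apply/implyP => CC'.
  rewrite eq_sym eqEcard CC' /=; apply: Cmax; rewrite C'K /=; exact: subset_trans BC CC'.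
rewrite eq_sym eqEcard AB Ae -(pureK mC) subset_leq_card //.
Qed.

Lemma exists_maxface A : A \in K -> exists2 C : {set 'I_n}, A \subset C & maxface K C.
Proof.
move=> AK.
case: (@arg_maxnP _ A (fun C => (C \in K) && (A \subset C)) (fun C => #|C|)).
  by rewrite AK subxx.
move=> C /andP[CK AC] Cmax; exists C => //.
rewrite /maxface CK; apply/forall_inP => C' C'K; apply/implyP => CC'.
rewrite eq_sym eqEcard CC' /=; apply: Cmax; rewrite C'K /=; exact: subset_trans AC CC'.
Qed.

Lemma card_face A : A \in K -> (#|A| <= e)%N.
Proof. by case/exists_maxface=> C AC mC; rewrite -(pureK mC) subset_leq_card. Qed.

(** If a cycle through one facet vanished on a facet [A], it would be a boundary in the deletion of
    [A]; but no face has more than [e] vertices, so nothing can bound it. *)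
Lemma fundamental_cycle : set0 \in K ->
  exists z : chain, [/\ forall A, z A != 0 -> A \in K /\ #|A| = e, bd z = 0 &
                forall A, A \in K -> #|A| = e -> z A != 0].
Proof.
case/exists_maxface => s _ ms.
have s0 : s != set0 by rewrite -card_gt0 (pureK ms).
have [z [zK zc zs]] := facet_cycle ms s0; rewrite (pureK ms) in zK.
exists z; split => // A AK Ae; apply/negP => /eqP zA.
have A0 : A != set0 by rewrite -card_gt0 Ae.
have zL B : z B != 0 -> B \in deletion K A.
  move=> zB; have [BK Be] := zK _ zB; rewrite inE BK /=; apply/negP => AB.
  by rewrite (maxfaceP (maxfaceE AK Ae) BK AB) zA eqxx in zB.
have [b bL bz] := cycle_deletion (@deletion_down A) (conK AK A0) zL zc.
suff : bd b s = 0 by rewrite bz zs => /eqP; rewrite oner_eq0.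
rewrite ffunE; apply: big1 => v vs; apply/eqP/negPn/negP => /bL.
rewrite inE => /andP[/card_face]; rewrite cardsU1 vs (pureK ms) ltnn //.
Qed.

Context (z : chain) (zK : forall A, z A != 0 -> A \in K /\ #|A| = e).
Context (bdz : bd z = 0) (zN0 : forall A, A \in K -> #|A| = e -> z A != 0).

(** Acyclicity of the deletion of one facet [s] solves the equation on every face except [s]. On
    [s], which matters only in the top size, pairing with the cycle [z] forces it, since [z s] is
    nonzero. *)
Lemma sphere_exact r u : set0 \in K -> (r <= e)%N ->
  (forall A, A \in K -> #|A| = r.+1 -> cobd u A = 0) ->
  (r = e -> \sum_A z A * u A = 0) ->
  exists2 y, (forall A, y A != 0 -> A \in K /\ #|A|.+1 = r) &
    forall A, A \in K -> #|A| = r -> cobd y A = u A.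
Proof.
case/exists_maxface => s _ ms re hu hz.
have sK : s \in K by case/andP: ms.
have s0 : s != set0 by rewrite -card_gt0 (pureK ms).
have [|y yL hy] := cocycle_exact (r := r) (u := u) ch2 (@deletion_down s) (conK sK s0).
  by move=> A; rewrite inE => /andP[AK _] /(hu A AK).
have inL A : A \in K -> A != s -> A \in deletion K s.
  move=> AK As; rewrite inE AK /=; apply: contra As => sA.
  by rewrite (maxfaceP ms AK sA).
exists y; first by move=> A /yL[]; rewrite inE => /andP[].
move=> A AK Ar; have [As|As] := eqVneq A s; last by apply: hy => //; exact: inL.
have re' : r = e by rewrite -Ar As (pureK ms).
have : \sum_A z A * (u A - cobd y A) = 0.
  under eq_bigr => B _ do rewrite mulrBr.
  rewrite sumrB hz // -bd_cobd // bdz big1 ?subr0 // => B _.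
  by rewrite ffunE mul0r.
rewrite (bigD1 s) //= big1 ?addr0 => [/eqP|B Bs].
  rewrite mulf_eq0 (negPf (zN0 sK (pureK ms))) /= subr_eq0 As => /eqP//.
have [->|/zK[BK Be]] := eqVneq (z B) 0; first by rewrite mul0r.
by rewrite hy ?subrr ?mulr0 ?inL // Be.
Qed.

(** The long exact sequence of [K] relative to the deletion of [G], by hand: off the star [u]
    vanishes, so a solution [y] is a cocycle there, equal to some [cobd w]; adding [cobd w] makes it
    vanish off the star. *)
Lemma star_exact G r u : G \in K -> (r <= e)%N ->
  (forall A, u A != 0 -> G \subset A) ->
  (forall A, A \in K -> #|A| = r.+1 -> cobd u A = 0) ->
  (r = e -> \sum_A z A * u A = 0) ->
  exists2 y, (forall A, y A != 0 -> [/\ A \in K, #|A|.+1 = r & G \subset A]) &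
    forall A, A \in K -> #|A| = r -> cobd y A = u A.
Proof.
move=> GK re Gu hu hz.
have K0 : set0 \in K by exact: downK GK (sub0set _).
have [y yK hy] := sphere_exact K0 re hu hz.
have [G0|G0] := eqVneq G set0.
  by exists y => // A /yK[AK Ar]; rewrite G0 sub0set.
case: r => [|r] in re hu hz yK hy *.
  by exists y => // A /yK[].
have [|w wL hw] := cocycle_exact (r := r) (u := y) ch2 (@deletion_down G) (conK GK G0).
  move=> A; rewrite inE => /andP[AK GA] Ar; rewrite hy //.
  by apply/eqP/negPn/negP => /Gu; rewrite (negPf GA).
exists (fun A => if [&& A \in K, #|A| == r & G \subset A] then y A + cobd w A else 0).
  by move=> A; case: and3P => [[? /eqP-> ?]|]; rewrite ?eqxx.
move=> A AK Ar; have -> : u A = cobd (fun B => y B + cobd w B) A.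
  by rewrite cobdD cobd_cobd // addr0 hy.
apply: eq_cobd => v vA; have vK : A :\ v \in K by apply: downK AK (subD1set _ _).
have vr : #|A :\ v| = r by apply/eqP; rewrite -eqSS card_setD1 // Ar.
rewrite vK vr eqxx /=; case: ifP => // Gv.
by rewrite hw ?inE ?vK ?Gv // ch2.
Qed.

End AcyclicDeletions.

(** * The double complex *)

Section Koszul.
Context (F : fieldType) (ch2 : forall x : F, x + x = 0) (n m : nat).
Context (th : 'I_m -> 'I_n -> F).

(* A tensor in the i-th power of F^n + F^m is given by its coefficients: a function of
   the sequences of i slots, where inl v and inr q stand for the basis vectors of F^n
   and F^m; forms are the slots in F^m. *)
Definition slot := ('I_n + 'I_m)%type.
Definition slot_in (A : {set 'I_n}) (x : slot) := if x is inl v then v \in A else true.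
Definition is_form (x : slot) := if x is inr _ then true else false.
Notation degree s := (count is_form s).
Implicit Types (g : seq slot -> F) (s : seq slot) (A B G : {set 'I_n}).

(* The differential of the tensor power of the two-term complex th : F^n -> F^m. *)
Fixpoint kd g s : F :=
  if s is x :: s' then
    (if x is inr q then \sum_v th q v * g (inl v :: s') else 0) + kd (fun s1 => g (x :: s1)) s'
  else 0.

Lemma eq_kd g g' s : (forall s', g s' = g' s') -> kd g s = kd g' s.
Proof.
elim: s g g' => //= x s IH g g' h; congr (_ + _); last by apply: IH => s'; exact: h.
by case: x => // q; apply: eq_bigr => v _; rewrite h.
Qed.

Lemma kd_lin (I : finType) (a : I -> F) (g : I -> seq slot -> F) s :
  kd (fun s' => \sum_i a i * g i s') s = \sum_i a i * kd (g i) s.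
Proof.
elim: s g => [|x s IH] g /=; first by rewrite big1 // => i _; rewrite mulr0.
rewrite IH; under [RHS]eq_bigr => i _ do rewrite mulrDr.
rewrite big_split /=; congr (_ + _); case: x => [_|q].
  by rewrite big1 // => i _; rewrite mulr0.
under [RHS]eq_bigr => i _ do rewrite mulr_sumr.
rewrite [RHS]exchange_big; apply: eq_bigr => v _.
by rewrite mulr_sumr; apply: eq_bigr => i _; rewrite mulrCA.
Qed.

Lemma kdD g g' s : kd (fun s' => g s' + g' s') s = kd g s + kd g' s.
Proof.
have := kd_lin (fun=> 1) (fun b : bool => if b then g else g') s.
rewrite [RHS]big_bool /= !mul1r => <-; apply: eq_kd => s'.
by rewrite big_bool /= !mul1r.
Qed.

Lemma kd0 s : kd (fun=> 0) s = 0.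
Proof.
elim: s => //= x s ->; case: x => [_|q]; rewrite addr0 // big1 // => v _.
by rewrite mulr0.
Qed.

(** Two different slots are hit in both orders, and the differential of a single slot squares to
    0. *)
Lemma kdkd g s : kd (kd g) s = 0.
Proof.
elim: s g => //= x s IH g; case: x => [v|q] /=.
  rewrite add0r (eq_kd (g' := kd (fun s1 => g (inl v :: s1)))) ?IH // => s'.
  by rewrite add0r.
rewrite kdD kd_lin IH addr0 -[RHS](ch2 (\sum_v th q v * kd (fun s1 => g (inl v :: s1)) s)).
by congr (_ + _); apply: eq_bigr => v _; rewrite add0r.
Qed.

Definition supported i p A g := forall s, g s != 0 ->
  [/\ size s = i, all (slot_in A) s & degree s = p].

Lemma supported_kd i p A g : supported i p A g -> (forall s, kd g s != 0 ->
  [/\ size s = i & degree s = p.+1]).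
Proof.
elim: i p g => [|i IH] p g sg [|x s] /=; rewrite ?eqxx //.
  have g0 y s' : g (y :: s') = 0.
    apply/eqP; apply: contraT => h; by have [] := sg _ h.
  rewrite (eq_kd (g' := fun=> 0)) // kd0 addr0; case: x => [v|q]; rewrite ?eqxx //.
  by rewrite big1 ?eqxx // => v _; rewrite g0 mulr0.
have [E|h] := eqVneq (kd (fun s1 => g (x :: s1)) s) 0.
  rewrite E addr0; case: x {E} => [v|q]; rewrite ?eqxx // => h.
  have [v] : exists v, g (inl v :: s) != 0.
    apply/existsP; apply: contraNT h; rewrite negb_exists => /forallP h.
    by rewrite big1 // => v _; have := h v; rewrite negbK => /eqP->; rewrite mulr0.
  by case/sg => [[<-]] _ /= <-.
have [|-> dp] := IH (p - is_form x)%N (fun s1 => g (x :: s1)) _ s h.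
  move=> s1 /sg [[->]] /= /andP[_ ->] <-; split => //.
  by rewrite addKn.
move=> _; split => //; rewrite dp.
suff : (is_form x <= p)%N by move=> xp; rewrite addnS subnKC.
have [s1] : exists s1, g (x :: s1) != 0.
  apply: contrapT => none; case/eqP: h.
  rewrite (eq_kd (g' := fun=> 0)) ?kd0 // => s1.
  by apply/eqP/negPn/negP => gs; apply: none; exists s1.
by case/sg => _ _ /= <-; apply: leq_addr.
Qed.

Lemma kd_all A g s : (forall s', g s' != 0 -> all (slot_in A) s') ->
  kd g s != 0 -> all (slot_in A) s.
Proof.
elim: s g => //= x s IH g sg h.
have [E|hn] := eqVneq (kd (fun s1 => g (x :: s1)) s) 0.
  move: h; rewrite E addr0; case: x {E} => [v|q] /= => [|h]; first by rewrite eqxx.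
  have [v] : exists v, g (inl v :: s) != 0.
    apply/existsP; apply: contraNT h; rewrite negb_exists => /forallP h.
    by rewrite big1 // => v _; have := h v; rewrite negbK => /eqP->; rewrite mulr0.
  by move/sg => /= /andP[].
have xA : slot_in A x.
  have [s1 /sg/andP[]//] : exists s1, g (x :: s1) != 0.
  apply: contrapT => none; case/eqP: hn.
  rewrite (eq_kd (g' := fun=> 0)) ?kd0 // => s1.
  by apply/eqP/negPn/negP => gs; apply: none; exists s1.
rewrite xA; apply: (IH (fun s1 => g (x :: s1))) => // s' /sg /andP[] //.
Qed.

Lemma supported_kdS i p A g : supported i p A g -> supported i p.+1 A (kd g).
Proof.
move=> sg s gs; have [-> ->] := supported_kd sg gs; split => //.
by apply: kd_all gs => s' /sg[].
Qed.

Definition left_inv A (pi : 'I_n -> 'I_m -> F) := forall v w, v \in A -> w \in A ->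
  \sum_q pi w q * th q v = (v == w)%:R.

(* Slot by slot this is the two-term complex th : F^A -> F^m, which is injective; so
   the tensor power is exact except where every slot is a form. *)
Lemma kd_exact A pi i p g : left_inv A pi -> supported i p A g -> (p < i)%N ->
  (forall s, kd g s = 0) ->
  exists2 h, (forall s, h s != 0 ->
      [/\ size s = i, all (slot_in A) s & (degree s).+1 = p]) &
    forall s, kd h s = g s.
Proof.
move=> piA; elim: i p g => // i IH p g sg pi' g0.
(* Contraction of the first tensor factor: [pi] pulls a form in the first slot back to a vertex of
   [A]. *)
pose h0 s : F := if s is inl w :: s' then
    if w \in A then \sum_q pi w q * g (inr q :: s') else 0 else 0.
have h0s s : h0 s != 0 -> [/\ size s = i.+1, all (slot_in A) s & (degree s).+1 = p].
  case: s => [|[w|q] s] /=; rewrite ?eqxx //; case: ifP => [wA|_]; rewrite ?eqxx // => h.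
  have [q] : exists q, g (inr q :: s) != 0.
    apply/existsP; apply: contraNT h; rewrite negb_exists => /forallP h.
    by rewrite big1 // => q _; have := h q; rewrite negbK => /eqP->; rewrite mulr0.
  by case/sg => /= [[->]] -> <-; rewrite add1n add0n.
have gl w s : w \notin A -> g (inl w :: s) = 0.
  by move=> wA; apply/eqP/negPn/negP => /sg[_ /=]; rewrite (negPf wA).
have kgl v s : kd (fun s1 => g (inl v :: s1)) s = 0.
  by have := g0 (inl v :: s); rewrite /= add0r.
have kgr q s : kd (fun s1 => g (inr q :: s1)) s = \sum_v th q v * g (inl v :: s).
  have /eqP := g0 (inr q :: s); rewrite /= addrC addr_eq0 => /eqP->.
  by apply/eqP; rewrite eq_sym -addr_eq0 ch2.
have kh0l w s : kd h0 (inl w :: s) = g (inl w :: s).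
  rewrite /= add0r; case wA: (w \in A); last by rewrite kd0 gl ?wA.
  rewrite kd_lin; under eq_bigr => q _ do rewrite kgr mulr_sumr.
  rewrite exchange_big /= (bigD1 w) //= [X in _ + X]big1 ?addr0 => [|v vw].
    under eq_bigr => q _ do rewrite mulrA.
    by rewrite -mulr_suml piA // eqxx mul1r.
  have [vA|/gl->] := boolP (v \in A); last by rewrite big1 // => q _; rewrite !mulr0.
  under eq_bigr => q _ do rewrite mulrA.
  by rewrite -mulr_suml piA // (negPf vw) mul0r.
have kh0r q s : kd h0 (inr q :: s) = \sum_v th q v * h0 (inl v :: s).
  by rewrite /= kd0 addr0.
(* The corrected [g + kd h0] lives only where the first slot is a form, so the induction hypothesis
   applies to the remaining slots, separately for each [q]. *)
pose g' q s := g (inr q :: s) + kd h0 (inr q :: s).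
have g'0 q s : kd (g' q) s = 0.
  have: kd (fun s => g s + kd h0 s) (inr q :: s) = 0 by rewrite kdD g0 kdkd addr0.
  rewrite /= big1 ?add0r // => v _.
  by rewrite -[X in _ + (X + _)]/0 add0r -[kd _ _](add0r) -/(kd h0 (inl v :: s)) kh0l ch2 mulr0.
case: p => [|p] in sg pi' h0s *.
  have h00 s : h0 s = 0 by apply/eqP/negPn/negP => /h0s[].
  exists (fun=> 0) => [s|s]; rewrite ?eqxx // kd0.
  case: s => [|[w|q] s].
  - by apply/esym/eqP/negPn/negP => /sg[].
  - by rewrite -kh0l (eq_kd (g' := fun=> 0)) ?kd0.
  - by apply/esym/eqP/negPn/negP => /sg[].
have g's q : supported i p A (g' q).
  move=> s; rewrite /g' kh0r => h.
  have [E|/sg] := eqVneq (g (inr q :: s)) 0; last first.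
    by case=> /= [[->]] ->; rewrite add1n => -[->].
  move: h; rewrite E add0r => h.
  have [v] : exists v, h0 (inl v :: s) != 0.
    apply/existsP; apply: contraNT h; rewrite negb_exists => /forallP h.
    by rewrite big1 // => v _; have := h v; rewrite negbK => /eqP->; rewrite mulr0.
  by case/h0s => /= [[->]] /andP[_ ->]; rewrite add0n => -[->].
have /choice [h1 h1P] : forall q, exists h, (forall s, h s != 0 ->
      [/\ size s = i, all (slot_in A) s & (degree s).+1 = p]) /\
    forall s, kd h s = g' q s.
  move=> q; have [//|h h1 h2] := IH p (g' q) (g's q) _ (g'0 q).
  by exists h.
exists (fun s => h0 s + if s is inr q :: s' then h1 q s' else 0).
  move=> s; have [->|/h0s//] := eqVneq (h0 s) 0; rewrite add0r.
  case: s => [|[w|q] s]; rewrite ?eqxx //= => /(proj1 (h1P q)) [-> -> <-].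
  by rewrite add1n.
move=> s; rewrite kdD; case: s => [|[w|q] s].
- by rewrite /= addr0; apply/esym/eqP/negPn/negP => /sg[].
- by rewrite kh0l /= kd0 !addr0.
- rewrite [X in _ + X]/= big1 ?add0r; last by move=> v _; rewrite mulr0.
  by rewrite (proj2 (h1P q)) /g' addrCA ch2 addr0.
Qed.

End Koszul.

Section DoubleComplex.
Context (F : fieldType) (ch2 : forall x : F, x + x = 0) (n m : nat).
Context (th : 'I_m -> 'I_n -> F) (K : {set {set 'I_n}}) (downK : downset K).
Context (z : {ffun {set 'I_n} -> F}).
Context (starK : forall G r (u : {set 'I_n} -> F), G \in K -> (r <= m.+1)%N ->
  (forall A, u A != 0 -> G \subset A) ->
  (forall A, A \in K -> #|A| = r.+1 -> cobd u A = 0) ->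
  (r = m.+1 -> \sum_A z A * u A = 0) ->
  exists2 y, (forall A, y A != 0 -> [/\ A \in K, #|A|.+1 = r & G \subset A]) &
    forall A, A \in K -> #|A| = r -> cobd y A = u A).
Context (linvK : forall A, A \in K -> (#|A| <= m)%N -> exists pi, left_inv th A pi).

Notation slot := (slot n m).
Notation degree s := (count (@is_form n m) s).
Implicit Types (g : seq slot -> F) (s : seq slot) (A B G : {set 'I_n}).
Implicit Types x y w : {set 'I_n} -> seq slot -> F.

Definition delta y A s := if A \in K then cobd (fun B => y B s) A else 0.
Definition kdc y A := kd th (y A).
(** Vertex slots must lie in [A] itself: over each face the coefficients are tensors on [F^A] and
    [F^m], a space that grows with the face. *)
Definition bigraded i r p y := forall A s, y A s != 0 ->
  [/\ A \in K, #|A| = r & [/\ size s = i, all (@slot_in n m A) s & degree s = p]].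

Lemma delta_delta y A s : delta (delta y) A s = 0.
Proof.
rewrite /delta; case: ifP => // AK.
rewrite -[RHS](cobd_cobd ch2 (fun B => y B s) A); apply: eq_cobd => v vA.
by rewrite (downK AK) ?subD1set.
Qed.

Lemma eq_delta y y' A s : (forall B t, y B t = y' B t) -> delta y A s = delta y' A s.
Proof. by move=> h; rewrite /delta; case: ifP => // _; apply: eq_cobd => v _; rewrite h. Qed.

Lemma deltaD y y' A s :
  delta (fun B t => y B t + y' B t) A s = delta y A s + delta y' A s.
Proof. by rewrite /delta; case: ifP => _; rewrite ?addr0 // cobdD. Qed.

Lemma delta_kdc y A s : delta (kdc y) A s = kdc (delta y) A s.
Proof.
rewrite /delta /kdc; case: ifP => AK; last by rewrite -[LHS](kd0 th s); exact: eq_kd.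
rewrite /cobd big_mkcond /=.
have := kd_lin th (fun v => (v \in A)%:R) (fun v => y (A :\ v)) s.
rewrite (eq_kd th (g' := fun s' => cobd (fun B => y B s') A)) => [->|s'].
  by apply: eq_bigr => v _; case: (v \in A); rewrite ?mul1r ?mul0r.
rewrite /cobd [RHS]big_mkcond /=; apply: eq_bigr => v _.
by case: (v \in A); rewrite ?mul1r ?mul0r.
Qed.

Definition vset s : {set 'I_n} := [set v | inl v \in s].

Lemma slot_in_vset A s : all (@slot_in n m A) s = (vset s \subset A).
Proof.
apply/allP/subsetP => [h v|h [v|q] xs //=]; first by rewrite inE => /h.
by apply: h; rewrite inE.
Qed.

(** For a fixed index [s] the cochain is supported on faces containing the vertices of [s], so this
    is exactness on the star of [vset s]. If [vset s] is no face, the cochain is 0. *)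
Lemma delta_exact i r p y : bigraded i r p y -> (r <= m.+1)%N ->
  (forall A s, delta y A s = 0) -> (r = m.+1 -> forall s, \sum_A z A * y A s = 0) ->
  exists2 x, (forall A s, x A s != 0 -> [/\ A \in K, #|A|.+1 = r &
      [/\ size s = i, all (@slot_in n m A) s & degree s = p]]) &
    forall A s, delta x A s = y A s.
Proof.
move=> gy rm dy hz.
have /choice [x xP] : forall s, exists x : {set 'I_n} -> F,
    (forall A, x A != 0 -> [/\ A \in K, #|A|.+1 = r &
      [/\ size s = i, all (@slot_in n m A) s & degree s = p]]) /\
    forall A, A \in K -> #|A| = r -> cobd x A = y A s.
  move=> s.
  have [Q|Q] := boolP [&& size s == i, degree s == p & vset s \in K]; last first.
    exists (fun=> 0); split => [A|A AK Ar]; first by rewrite eqxx.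
    rewrite cobd0 //; apply/esym; apply: contraNeq Q => /gy[_ _ [-> sA ->]].
    by rewrite !eqxx (downK AK) // -slot_in_vset.
  case/and3P: Q => /eqP si /eqP sp sK.
  have [|||x xK xE] := starK (u := fun A => y A s) sK rm.
  - by move=> A /gy[_ _ [_ + _]]; rewrite slot_in_vset.
  - by move=> A AK _; have := dy A s; rewrite /delta AK.
  - by move=> /hz.
  exists x; split => // A /xK[AK Ar sA]; split => //; split => //.
  by rewrite slot_in_vset.
exists (fun A s => x s A) => [A s /(proj1 (xP s))//|A s].
rewrite /delta; case: ifP => AK; last first.
  by apply/esym/eqP/negPn/negP => /gy[]; rewrite AK.
have [Ar|Ar] := eqVneq #|A| r; first exact: (proj2 (xP s)).
rewrite cobd0 => [|v vA].
  by apply/esym/eqP/negPn/negP => /gy[_ /eqP]; rewrite (negPf Ar).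
apply/eqP/negPn/negP => /(proj1 (xP s))[_ + _].
by rewrite card_setD1 // => /eqP; rewrite (negPf Ar).
Qed.

Context (b i : nat) (bi : (b + i)%N = m).

Definition lift_spec p A g (h : seq slot -> F) :=
  (forall s, h s != 0 -> [/\ size s = i, all (@slot_in n m A) s & degree s = p]) /\
  forall s, kd th h s = g s.

(** An arbitrary preimage, or 0 if there is none. It is determined by [p], [A] and [g], which is
    what makes [local] local. *)
Definition koszul_lift p A g : seq slot -> F :=
  if pselect (exists h, lift_spec p A g h) is left ex then projT1 (cid ex) else fun=> 0.

Lemma koszul_liftP p A g : (exists h, lift_spec p A g h) -> lift_spec p A g (koszul_lift p A g).
Proof. by rewrite /koszul_lift; case: pselect => // ex _; case: cid. Qed.

(* The zig-zag through the double complex.  [local k v] sits over the faces of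
   size [b + k] and on each face depends only on the values of [v] below it. *)
Fixpoint local k (v : {set 'I_n} -> seq slot -> F) : {set 'I_n} -> seq slot -> F :=
  if k is k'.+1 then
    fun A => if (A \in K) && (#|A| == b + k)%N
             then koszul_lift (i - k) A (delta (local k' v) A) else fun=> 0
  else v.

Lemma local_local k v v' A : (forall B, B \subset A -> v B = v' B) ->
  local k v A = local k v' A.
Proof.
elim: k A => [|k IH] A h /=; first exact: h.
case: ifP => // _; congr (koszul_lift _ _ _); apply: funext => s.
rewrite /delta; case: ifP => // _; apply: eq_cobd => x xA.
rewrite (IH (A :\ x)) // => B BA; apply: h.
exact: subset_trans BA (subD1set _ _).
Qed.

(** One step: [kdc y] is closed under [delta], so it equals [delta y'] with [y'] over faces one
    smaller and with one more form. In the decomposition of [y'] the part [delta psi] dies under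
    [delta], the part [kdc eta] is absorbed into [y], and a lifting problem for [delta (local k v)]
    remains. *)
Lemma zigzag k y : (k <= i)%N -> bigraded i (b + k) (i - k) y ->
  (forall A s, delta (kdc y) A s = 0) ->
  exists v psi eta, [/\ bigraded i b i v,
    forall A s, eta A s != 0 -> [/\ A \in K, #|A| = (b + k)%N & [/\ size s = i,
      all (@slot_in n m A) s & (degree s).+1 = (i - k)%N]] &
    forall A s, y A s = local k v A s + delta psi A s + kdc eta A s].
Proof.
elim: k y => [|k IH] y ki gy dky.
  exists y, (fun _ _ => 0), (fun _ _ => 0); rewrite addn0 subn0 in gy *; split => //.
    by move=> A s; rewrite eqxx.
  move=> A s; rewrite /= /kdc kd0 addr0 /delta.
  by case: ifP => _; rewrite ?cobd0 ?addr0.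
set p := (i - k.+1)%N in gy *.
have pk : (i - k)%N = p.+1 by rewrite /p subnSK.
have rm : (b + k.+1 <= m)%N by rewrite -bi leq_add2l.
(* The size [b + k.+1] is at most [m], below the top size [m.+1], so no orthogonality to [z] is
   required. *)
have [||y' gy' dy'] := @delta_exact i (b + k.+1) p.+1 (kdc y) _ (leqW rm) dky.
- move=> A s h; have [s' ys'] : exists s', y A s' != 0.
    apply: contrapT => none; case/eqP: h; rewrite /kdc.
    rewrite (eq_kd th (g' := fun=> 0)) ?kd0 // => s'.
    by apply/eqP/negPn/negP => ys; apply: none; exists s'.
  have [AK Ar _] := gy _ _ ys'; split => //.
  apply: (@supported_kdS _ _ _ th i p A) h => s1 /gy[]//.
- by move=> E; rewrite E ltnn in rm.
have gy1 : bigraded i (b + k) (i - k) y'.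
  by move=> A s /gy'[AK /eqP]; rewrite addnS eqSS pk => /eqP.
have [|v [psi [eta [gv geta hy']]]] := IH y' (ltnW ki) gy1.
  move=> A s; rewrite delta_kdc /kdc (eq_kd th (g' := kd th (y A))) ?kdkd //.
have Keta A s : delta (kdc eta) A s = kdc (delta eta) A s := delta_kdc eta A s.
(* Thus [y + delta eta] is one lift of [delta (local k v)]. It differs from the chosen lift by an
   element of the kernel of [kd], hence by the image of some [eta']. *)
have Ey A s : kd th (fun s' => y A s' + delta eta A s') s = delta (local k v) A s.
  rewrite kdD -[kd th (y A) s]/(kdc y A s) -dy'.
  rewrite (eq_delta (y' := fun A s => local k v A s + delta psi A s + kdc eta A s)) //.
  by rewrite !deltaD delta_delta addr0 delta_kdc -addrA ch2 addr0.
have geta' A s : delta eta A s != 0 ->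
   [/\ A \in K, #|A| = (b + k.+1)%N & [/\ size s = i, all (@slot_in n m A) s & degree s = p]].
  rewrite /delta; case: ifP => AK; rewrite ?eqxx // => h.
  have [x xA] : exists2 x, x \in A & eta (A :\ x) s != 0.
    apply: contrapT => none; case/eqP: h; apply: cobd0 => x xA.
    by apply/eqP/negPn/negP => e; apply: none; exists x.
  case/geta => _ Ar [si sA sd]; split => //; first by rewrite -(card_setD1 xA) Ar addnS.
  split => //; last by move: sd; rewrite pk => -[].
  move: sA; rewrite !slot_in_vset => /subset_trans; apply; exact: subD1set.
have suppL A s : A \in K -> #|A| = (b + k.+1)%N -> y A s + delta eta A s != 0 ->
    [/\ size s = i, all (@slot_in n m A) s & degree s = p].
  move=> AK Ar; have [->|/gy[]//] := eqVneq (y A s) 0.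
  by rewrite add0r => /geta'[].
have ex A : A \in K -> #|A| = (b + k.+1)%N ->
  exists eta', (forall s, eta' s != 0 ->
      [/\ size s = i, all (@slot_in n m A) s & (degree s).+1 = p]) /\
    forall s, kd th eta' s = y A s + delta eta A s + local k.+1 v A s.
  move=> AK Ar.
  have [|pi piA] := linvK AK; first by rewrite Ar.
  have [L1 L2] : lift_spec p A (delta (local k v) A) (local k.+1 v A).
    rewrite /= AK Ar eqxx /=; apply: koszul_liftP.
    exists (fun s => y A s + delta eta A s); split => [s|s]; first exact: suppL.
    exact: Ey.
  have [|||h h1 h2] := @kd_exact _ ch2 _ _ th A pi i p
     (fun s => y A s + delta eta A s + local k.+1 v A s) piA.
  - move=> s; have [->|h _] := eqVneq (y A s + delta eta A s) 0; last exact: suppL.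
    by rewrite add0r => /L1.
  - by rewrite /p -subSn // subSS leq_subr.
  - by move=> s; rewrite kdD Ey L2 ch2.
  by exists h.
have /choice [eta' etaP] : forall A, exists eta', (forall s, eta' s != 0 ->
      [/\ A \in K, #|A| = (b + k.+1)%N &
      [/\ size s = i, all (@slot_in n m A) s & (degree s).+1 = p]]) /\
    (A \in K -> #|A| = (b + k.+1)%N ->
     forall s, kd th eta' s = y A s + delta eta A s + local k.+1 v A s).
  move=> A; have [/andP[AK /eqP Ar]|N] := boolP ((A \in K) && (#|A| == b + k.+1)%N).
    have [h [h1 h2]] := ex A AK Ar.
    by exists h; split => // s /h1.
  exists (fun=> 0); split => [s|AK Ar]; first by rewrite eqxx.
  by rewrite AK Ar eqxx in N.
exists v, eta, eta'; split => // [A s /(proj1 (etaP A))//|A s].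
have [/andP[AK /eqP Ar]|N] := boolP ((A \in K) && (#|A| == b + k.+1)%N).
  by rewrite /kdc (proj2 (etaP A)) // !addrA [RHS](ACl (3*(1*5)*(2*4))) /= !ch2 !addr0.
have y0 : y A s = 0.
  by apply/eqP; apply: contraNT N => /gy[-> -> _]; rewrite eqxx.
have d0 : delta eta A s = 0.
  by apply/eqP; apply: contraNT N => /geta'[-> -> _]; rewrite eqxx.
rewrite y0 d0 [local _ _ _]/= (negPf N) !add0r /kdc (eq_kd th (g' := fun=> 0)) ?kd0 // => s'.
by apply/eqP; apply: contraNT N => /(proj1 (etaP A))[-> -> _]; rewrite eqxx.
Qed.

End DoubleComplex.

(** * The moment curve and powers of linear relations *)

Section MomentCurve.
Context (F : fieldType) (n m : nat) (t : 'I_n -> F) (inj_t : injective t).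

Definition moment (q : 'I_m) (v : 'I_n) : F := t v ^+ q.

(** The vector [pi w] lists the coefficients of the Lagrange polynomial of [A] at [w], whose size is
    at most [#|A|]. *)
Lemma moment_left_inv (A : {set 'I_n}) : (#|A| <= m)%N ->
  exists pi, left_inv moment A pi.
Proof.
move=> Am.
pose lag (w : 'I_n) : {poly F} :=
  \prod_(u in A :\ w) ((t w - t u)^-1 *: ('X - (t u)%:P)).
exists (fun w q => (lag w)`_q) => v w vA wA.
have szl : (size (lag w) <= m)%N.
  rewrite /lag scaler_prod; apply: leq_trans (size_scale_leq _ _) _.
  rewrite -big_enum size_prod_XsubC -cardE.
  by rewrite (cardsD1 w A) wA in Am.
transitivity (lag w).[t v].
  by rewrite (horner_coef_wide _ szl).
rewrite horner_prod; have [->|vw] := eqVneq v w.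
  apply: big1 => u; rewrite !inE => /andP[uw _].
  rewrite hornerZ hornerXsubC mulVf // subr_eq0 inj_eq // eq_sym //.
rewrite (bigD1 v) ?inE ?vw //= hornerZ hornerXsubC subrr mulr0 mul0r //.
Qed.

Lemma moment_kernel (A : {set 'I_n}) : #|A| = m.+1 ->
  exists c : 'I_n -> F, [/\ forall v, c v != 0 -> v \in A, exists v, c v != 0 &
    forall q, \sum_v moment q v * c v = 0].
Proof.
move=> Am.
pose M : 'M[F]_(#|A|, m) := \matrix_(j, q) moment q (enum_val j).
have : kermx M != 0.
  by rewrite kermx_eq0 /row_free neq_ltn [X in (_ < X)%N]Am ltnS rank_leq_col.
case/rowV0Pn => x /sub_kermxP xM x0.
exists (fun v => \sum_j x 0 j * (enum_val j == v)%:R); split.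
- move=> v; apply: contraNT => vA; apply/eqP/big1 => j _.
  case: eqP => [e|_]; last by rewrite mulr0.
  by rewrite -e enum_valP in vA.
- have [j xj] : exists j, x 0 j != 0.
    apply/existsP; apply: contraNT x0; rewrite negb_exists => /forallP h.
    by apply/eqP/rowP => j; have := h j; rewrite negbK mxE => /eqP.
  exists (enum_val j); rewrite (bigD1 j) //= eqxx mulr1 big1 ?addr0 // => k kj.
  by rewrite (inj_eq enum_val_inj) (negPf kj) mulr0.
- move=> q; under eq_bigr => v _ do rewrite mulr_sumr.
  rewrite exchange_big /=; transitivity ((x *m M) 0 q); last by rewrite xM mxE.
  rewrite mxE; apply: eq_bigr => j _.
  rewrite (bigD1 (enum_val j)) //= eqxx mulr1 big1 ?addr0 => [|v vj].
    by rewrite mxE mulrC.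
  by rewrite eq_sym (negPf vj) !mulr0.
Qed.

End MomentCurve.

Section PureTensor.
Context (F : fieldType) (n m : nat) (th : 'I_m -> 'I_n -> F).
Notation slot := (slot n m).

(** The coefficients of the [i]-th tensor power of [c]: sequences of another length, or with a form,
    get 0. *)
Definition pure_tensor i (c : 'I_n -> F) (s : seq slot) : F :=
  (size s == i)%:R * \prod_(x <- s) (if x is inl v then c v else 0).

Lemma kd_pure_tensor i c s : (forall q, \sum_v th q v * c v = 0) ->
  kd th (pure_tensor i c) s = 0.
Proof.
move=> hc; elim: s i => //= x s IH i.
rewrite [X in X + _](_ : _ = 0) ?add0r; last first.
  case: x => // q; rewrite /pure_tensor.
  pose a := ((size s).+1 == i)%:R * \prod_(y <- s) (if y is inl v then c v else 0).
  transitivity ((\sum_v th q v * c v) * a); last by rewrite hc mul0r.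
  rewrite mulr_suml; apply: eq_bigr => v _.
  by rewrite /a big_cons -mulrA; congr (_ * _); rewrite mulrCA.
case: i => [|i].
  rewrite (eq_kd th (g' := fun=> 0)) ?kd0 // => s'.
  by rewrite /pure_tensor mul0r.
pose a := if x is inl v then c v else 0.
have := kd_lin th (fun _ : 'I_1 => a) (fun=> pure_tensor i c) s.
rewrite [RHS]big_ord1 IH mulr0 => <-; apply: eq_kd => s'.
by rewrite big_ord1 /pure_tensor big_cons eqSS mulrCA.
Qed.

Lemma pure_tensor_in i (A : {set 'I_n}) c s : (forall v, c v != 0 -> v \in A) ->
  pure_tensor i c s != 0 ->
  [/\ size s = i, all (@slot_in n m A) s & count (@is_form n m) s = 0%N].
Proof.
move=> cA; rewrite /pure_tensor mulf_eq0 negb_or.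
case: (size s =P i) => [<-|_] /andP[]; last by rewrite eqxx.
move=> _.
elim: s => //= x s IH; rewrite big_cons mulf_eq0 negb_or => /andP[h /IH[_ -> ->]].
by case: x h => [v /cA /= ->|q]; rewrite ?eqxx.
Qed.

End PureTensor.

(** A counting substitute for rank-nullity: subtracting a representative of its fiber sends [f] into
    [P], and [f] is recovered from [a f] and the difference. *)
Lemma card_kernel_fibers (F : finFieldType) (I U : finType)
    (a : {ffun I -> F} -> U) (P : pred {ffun I -> F}) :
  (forall f g, a f = a g -> P (f - g)) -> (#|{ffun I -> F}| <= #|U| * #|P|)%N.
Proof.
move=> h; pose rep u := odflt 0 [pick g | a g == u].
have repP f : a (rep (a f)) = a f.
  by rewrite /rep; case: pickP => [g /eqP|/(_ f)]; rewrite ?eqxx.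
pose G f := (a f, f - rep (a f)).
have injG : injective G by move=> f g [e]; rewrite e => /addIr.
rewrite -[leqLHS]cardsT -[#|U|]cardsT -(card_imset _ injG) -(cardsE P) -cardsX.
apply: subset_leq_card; apply/subsetP => _ /imsetP[f _ ->].
by rewrite !inE /=; apply: h; rewrite repP.
Qed.

(** * Counting the facets inside a vertex set *)

Section Count.
Context (F : finFieldType) (ch2 : forall x : F, x + x = 0) (n m : nat).
Context (t : 'I_n -> F) (inj_t : injective t).
Context (K : {set {set 'I_n}}) (downK : downset K) (K0 : set0 \in K).
Context (conK : forall G, G \in K -> G != set0 -> contracts F (deletion K G)).
Context (pureK : forall A, maxface K A -> #|A| = m.+1).
Context (b i : nat) (bi : (b + i)%N = m) (W : {set 'I_n}).

Notation slot := (slot n m).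
Notation th := (moment (m := m) t).
Notation facets_in := [set A in K | (#|A| == m.+1) && (A \subset W)].

(* The weights f with [al f = 0] are determined by [vf f] on the b-subsets of W with all
   slots forms, and they number at least q^#|facets_in| / q^(#|W|^i). *)
Lemma card_facets_in : (#|facets_in| <= #|W| ^ i + 'C(#|W|, b) * m ^ i)%N.
Proof.
have [z [zK bdz zN0]] := fundamental_cycle ch2 downK conK (ltn0Sn m) pureK K0.
have faceK := card_face (e := m.+1) pureK.
have starK := star_exact ch2 downK conK (ltn0Sn m) pureK zK bdz zN0.
have linvK A : A \in K -> (#|A| <= m)%N -> exists pi, left_inv th A pi.
  by move=> _; exact: moment_left_inv.
have /choice [cs csP] : forall A : {set 'I_n}, exists c : 'I_n -> F,
    #|A| = m.+1 -> [/\ forall v, c v != 0 -> v \in A, exists v, c v != 0 &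
    forall q, \sum_v th q v * c v = 0].
  move=> A; have [/(moment_kernel t)[c ?]|h] := eqVneq #|A| m.+1; first by exists c.
  by exists (fun=> 0) => e; rewrite e eqxx in h.
pose ev (f : {ffun {A | A \in facets_in} -> F}) A : F :=
  if insub A is Some s then f s else 0.
have evN0 f A : ev f A != 0 -> [/\ A \in K, #|A| = m.+1 & A \subset W].
  rewrite /ev; case: insubP => [s + _ _|]; last by rewrite eqxx.
  by rewrite inE => /and3P[? /eqP ? ?].
pose x f A (s : seq slot) := ev f A * pure_tensor i (cs A) s.
have xin f A s : x f A s != 0 -> [/\ A \in K, #|A| = m.+1, A \subset W &
    [/\ size s = i, all (@slot_in n m A) s & count (@is_form n m) s = 0%N]].
  rewrite mulf_eq0 negb_or => /andP[/evN0[AK Am AW]].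
  have [cA _ _] := csP A Am; move=> /(pure_tensor_in cA) ?; by split.
(* These are [#|W| ^ i] conditions. Sequences with a form or with a vertex outside [W] pair to 0
   anyway, as [alx] records. *)
pose al f : {ffun i.-tuple {v | v \in W} -> F} :=
  [ffun s : i.-tuple {v | v \in W} => \sum_A z A * x f A [seq inl (val v) | v <- s]].
have alx f s : al f = 0 -> \sum_A z A * x f A s = 0.
  move=> af.
  have [|N] := boolP [&& size s == i, count (@is_form n m) s == 0%N & all (@slot_in n m W) s].
    case/and3P=> /eqP si s0 sW.
    suff [u us] : exists u : seq {v | v \in W}, s = [seq inl (val v) | v <- u].
      have ui : size u == i by rewrite -si us size_map.
      by move/ffunP/(_ (Tuple ui)): af; rewrite !ffunE /= -us.
    elim: s s0 sW {si} => [|[v|q] s IH] //=; first by exists [::].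
    rewrite add0n => /IH {}IH /andP[vW /IH[u ->]].
    by exists (exist _ v vW :: u).
  apply: big1 => A _; have [->|/xin[_ _ AW [si sA s0]]] := eqVneq (x f A s) 0.
    by rewrite mulr0.
  case/negP: N; rewrite si s0 !eqxx /=; apply: sub_all sA => -[v|q] //=.
  exact: (subsetP AW).
pose lc := local th K b i.
have /choice [vf vfP] : forall f, exists v, al f = 0 ->
    bigraded K i b i v /\ forall A s, x f A s = delta K (lc i v) A s.
  move=> f; have [af|naf] := eqVneq (al f) 0; last first.
    by exists (fun _ _ => 0) => e; rewrite e eqxx in naf.
  have gx : bigraded K i m.+1 0 (x f) by move=> A s /xin[].
  have [||phi phiP dphi] := delta_exact downK starK gx (leqnn _).
  - move=> A s; rewrite /delta; case: ifP => // AK; apply: cobd0 => v vA.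
    apply/eqP/negPn/negP => /xin[_ h _ _].
    by have := faceK A AK; rewrite -(card_setD1 vA) h ltnn.
  - by move=> _ s; exact: alx.
  (* The coboundary of [kdc phi] is [kd] of [x f], which vanishes because [th] kills the relation
     [cs A]. *)
  have [||v [psi [eta [gv geta E]]]] := zigzag ch2 downK starK linvK bi (leqnn i) (y := phi).
  - by rewrite subnn bi => A s /phiP[AK [Am] ?].
  - move=> A s; rewrite delta_kdc /kdc (eq_kd th _ (dphi A)) /x.
    have [->|/evN0[_ Am _]] := eqVneq (ev f A) 0.
      by rewrite (eq_kd th (g' := fun=> 0)) ?kd0 // => s'; rewrite mul0r.
    have [_ _ cA] := csP A Am.
    have := kd_lin th (fun _ : 'I_1 => ev f A) (fun=> pure_tensor i (cs A)) s.
    rewrite [RHS]big_ord1 kd_pure_tensor // mulr0 => <-; apply: eq_kd => s'.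
    by rewrite big_ord1.
  exists v => _; split => // A s.
  (* The term [delta psi] dies under [delta]. The term with [eta] is 0: for [k = i] its tensors
     would have degree plus one equal to 0. *)
  rewrite -dphi (eq_delta K (y' := fun A s => lc i v A s + delta K psi A s)).
    by rewrite deltaD delta_delta // addr0.
  move=> B s'; rewrite E /kdc (eq_kd th (g' := fun=> 0)) ?kd0 ?addr0 // => s1.
  by apply/eqP/negPn/negP => /geta[_ _ []]; rewrite subnn.
pose V := {B : {set 'I_n} | B \in [set B : {set 'I_n} | B \subset W & #|B| == b]}.
pose be f : {ffun V * i.-tuple 'I_m -> F} :=
  [ffun p : V * i.-tuple 'I_m => vf f (val p.1) [seq inr q | q <- p.2]].
have inj_be : {in [pred f | al f == 0] &, injective be}.
  move=> f g; rewrite !inE => /eqP /vfP[gf hf] /eqP /vfP[gg hg] fg.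
  apply/ffunP => -[A AF].
  have evA (h : {ffun {A | A \in facets_in} -> F}) : h (exist _ A AF) = ev h A.
    rewrite /ev; case: insubP => [s _ sA|]; last by rewrite AF.
    by congr (h _); apply: val_inj.
  rewrite !evA; move: (AF); rewrite inE => /and3P[AK /eqP Am AW].
  have [_ [v cv] _] := csP A Am.
  have vv (B : {set 'I_n}) : B \subset A -> vf f B = vf g B.
    move=> BA; apply: funext => s.
    have [|N] := boolP [&& #|B| == b, size s == i & count (@is_form n m) s == i].
      case/and3P=> Bb /eqP si /eqP si'.
      have BV : B \in [set B : {set 'I_n} | B \subset W & #|B| == b].
        by rewrite inE Bb (subset_trans BA AW).
      suff [u us] : exists u : seq 'I_m, s = [seq inr q | q <- u].
        have ui : size u == i by rewrite -si us size_map.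
        by move/ffunP/(_ (exist _ B BV, Tuple ui)): fg; rewrite !ffunE /= -us.
      have: all (@is_form n m) s by rewrite all_count si si'.
      elim: s {si si'} => [|[w|q] s IH] //=; first by exists [::].
      by case/IH => u ->; exists (q :: u).
    rewrite (_ : vf f B s = 0); last first.
      by apply/eqP; apply: contraNT N => /gf[_ -> [-> _ ->]]; rewrite !eqxx.
    by apply/esym/eqP; apply: contraNT N => /gg[_ -> [-> _ ->]]; rewrite !eqxx.
  (* The coefficient at the constant sequence [v] is [f A] times the [i]-th power of [cs A v], which
     is nonzero. By locality it depends only on [vf] at the [b]-subsets of [A], and these lie in
     [W]. *)
  have: x f A (nseq i (inl v)) = x g A (nseq i (inl v)).
    rewrite hf hg /delta; case: ifP => // _; apply: eq_cobd => w wA.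
    rewrite /lc (@local_local _ _ _ _ _ _ _ _ (vf f) (vf g)) // => B BA.
    by apply: vv; apply: subset_trans BA (subD1set _ _).
  have pN0 : pure_tensor i (cs A) (nseq i (inl v) : seq slot) != 0.
    rewrite /pure_tensor size_nseq eqxx mul1r.
    by elim: (i) => [|j IH] /=; rewrite ?big_nil ?oner_eq0 // big_cons mulf_neq0.
  by move/(mulIf pN0).
(* Both bounds are powers of [#|F|], so the inequality of cardinalities passes to the exponents. *)
have q1 : (1 < #|F|)%N by apply/card_gt1P; exists 0, 1; rewrite !inE eq_sym oner_neq0.
have := @card_kernel_fibers _ _ _ al [pred f | al f == 0].
rewrite !card_ffun card_tuple !card_sig => H.
rewrite -(leq_exp2l _ _ q1) expnD; apply: leq_trans (H _) _.
  move=> f g fg /=; apply/eqP/ffunP => s; rewrite !ffunE.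
  have evB A : ev (f - g) A = ev f A - ev g A.
    rewrite /ev; case: insubP => [u _ _|_]; last by rewrite subr0.
    by rewrite !ffunE.
  move/ffunP/(_ s): fg; rewrite !ffunE => /eqP; rewrite -subr_eq0 -sumrB => /eqP h; rewrite -[RHS]h.
  by apply: eq_bigr => A _; rewrite /x evB mulrBl mulrBr.
rewrite leq_mul2l; apply/orP; right.
have := @leq_card_in _ _ be [pred f | al f == 0] inj_be.
rewrite card_ffun card_prod card_sig card_tuple card_ord.
by rewrite (cards_draws W b).
Qed.

End Count.

(** * Coloring *)

Local Close Scope ring_scope.

Section Coloring.
Context (T : finType) (E : {set {set T}}).
Implicit Types (W U A : {set T}) (c : T -> nat).

Definition edges_in W := [set A in E | A \subset W].

Definition mono c A := [forall x in A, forall y in A, c x == c y].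

Definition colorable_in W m := exists c,
  {in W, forall v, c v < m} /\ forall A, A \in E -> A \subset W -> ~~ mono c A.

Lemma notmonoP c A x y : x \in A -> y \in A -> c x != c y -> ~~ mono c A.
Proof.
by move=> xA yA; apply: contra => /forall_inP/(_ x xA)/forall_inP/(_ y yA).
Qed.

(** Each edge through [v] excludes a single color, that of one fixed other vertex of the edge, so
    [D.+1] colors leave one free for [v]. *)
Lemma greedy_colorable D W : {in E, forall A, 1 < #|A|} ->
  (forall U, U \subset W -> U != set0 ->
     exists2 v, v \in U & #|[set A in edges_in U | v \in A]| <= D) ->
  colorable_in W D.+1.
Proof.
move=> E2; have [m] := ubnP #|W|; elim: m W => // m IH W Wm degen.
have [->|W0] := eqVneq W set0.
  exists (fun=> 0); split => [v|A AE]; first by rewrite inE.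
  by rewrite subset0 => /eqP A0; have := E2 A AE; rewrite A0 cards0.
have [v vW dv] := degen W (subxx _) W0.
have [||c [cW cE]] := IH (W :\ v).
- by move: Wm; rewrite (cardsD1 v W) vW ltnS.
- by move=> U UW; apply: degen; apply: subset_trans UW (subD1set _ _).
pose other A := odflt v [pick x in A :\ v].
have otherP A : A \in E -> (other A \in A) && (other A != v).
  move=> AE; rewrite /other; case: pickP => [x|none].
    by rewrite !inE => /andP[-> ->].
  have := E2 A AE; rewrite (cardsD1 v A) (eq_card0 none).
  by case: (v \in A).
pose bad := [set (inord (c (other A)) : 'I_D.+1) | A in [set B in edges_in W | v \in B]].
have [k kbad] : exists k, k \notin bad.
  apply/existsP; rewrite -negb_forall; apply/negP => /forallP h.
  have : #|'I_D.+1| <= #|bad| by apply: subset_leq_card; apply/subsetP => k _; exact: h.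
  by rewrite card_ord ltnNge (leq_trans (leq_imset_card _ _)).
exists (fun x => if x == v then val k else c x); split => [x xW|A AE AW].
  by case: (eqVneq x v) => [_|xv]; [exact: ltn_ord | apply: cW; rewrite !inE xv].
have [vA|vA] := boolP (v \in A); last first.
  have AWv : A \subset W :\ v by rewrite subsetD1 AW.
  apply: contra (cE A AE AWv) => /forall_inP h; apply/forall_inP => x xA.
  apply/forall_inP => y yA; have := forall_inP (h x xA) y yA.
  have nv u : u \in A -> (u == v) = false by case: eqP => // ->; rewrite (negPf vA).
  by rewrite !nv.
have /andP[oA ov] := otherP A AE.
apply: (notmonoP vA oA); rewrite eqxx (negPf ov); apply: contra kbad => /eqP e.
apply/imsetP; exists A; first by rewrite !inE AE AW.
by rewrite -e inord_val.
Qed.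

Lemma sum_degrees W e : {in E, forall A, #|A| = e} ->
  \sum_(v in W) #|[set A in edges_in W | v \in A]| = #|edges_in W| * e.
Proof.
move=> Ee; under eq_bigr => v _ do rewrite -sum1dep_card.
rewrite (exchange_big_dep (mem (edges_in W))) /=; last by move=> v A _ /andP[].
rewrite -sum_nat_const; apply: eq_bigr => A AE; rewrite sum1dep_card.
move: (AE); rewrite inE => /andP[AE' AW].
rewrite -(Ee A AE') -[RHS]cardsE; apply: eq_card => v; rewrite !inE AE' AW /=.
by apply/andP/idP => [[]//|vA]; split => //; exact: (subsetP AW).
Qed.

(** If every degree in a nonempty [U] exceeded [C * e], the degree sum would exceed [e] times the
    number of edges. *)
Lemma linear_colorable C e : 1 < e -> {in E, forall A, #|A| = e} ->
  (forall W, #|edges_in W| <= C * #|W|) -> forall W, colorable_in W (C * e).+1.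
Proof.
move=> e1 Ee h W; apply: greedy_colorable => [A /Ee->//|U _ U0].
apply/exists_inP; apply: contraT; rewrite negb_exists_in => /forall_inP all.
have: \sum_(v in U) (C * e).+1 <= \sum_(v in U) #|[set A in edges_in U | v \in A]|.
  by apply: leq_sum => v /all; rewrite -ltnNge.
rewrite (sum_degrees _ Ee) sum_nat_const leqNgt => /negP[].
apply: leq_ltn_trans (leq_mul (h U) (leqnn e)) _.
by rewrite mulnAC mulnC mulnS -addn1 addnC leq_add2r card_gt0.
Qed.

Lemma card_mono_colorings r A e : #|A| = e.+1 ->
  #|[set c : {ffun T -> 'I_r} | mono (fun x => c x) A]| * r ^ e <= #|{ffun T -> 'I_r}|.
Proof.
move=> Ae; have [x xA] : exists x, x \in A by apply/card_gt0P; rewrite Ae.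
pose fam (a : 'I_r) := family (fun x => if x \in A then pred1 a else predT).
have -> : #|{ffun T -> 'I_r}| = r ^ e.+1 * r ^ #|~: A|.
  by rewrite card_ffun card_ord -expnD -Ae cardsC.
have fama a : #|fam a| = r ^ #|~: A|.
  rewrite card_family foldrE big_map big_enum /= (bigID (mem A)) /=.
  rewrite big1 ?mul1n => [|y yA]; last by rewrite yA card1.
  rewrite (eq_bigr (fun=> r)) => [|y /negPf->]; last by rewrite card_ord.
  by rewrite prod_nat_const; congr (_ ^ _); apply: eq_card => y; rewrite !inE.
rewrite expnS -mulnA [r ^ e * _]mulnC mulnA leq_mul2r; apply/orP; right.
have -> : r * r ^ #|~: A| = \sum_(a < r) #|fam a|.
  by rewrite (eq_bigr _ (fun a _ => fama a)) sum_nat_const card_ord.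
have : [set c : {ffun T -> 'I_r} | mono (fun x => c x) A] \subset
  \bigcup_(a < r) [set c in fam a].
  apply/subsetP => c; rewrite inE => /forall_inP h; apply/bigcupP.
  exists (c x) => //; rewrite inE; apply/familyP => y; case: ifP => // yA.
  by have := forall_inP (h y yA) x xA; rewrite inE.
move/subset_leq_card/leq_trans; apply.
elim/big_ind2: _ => [|n1 A1 n2 A2 h1 h2|a _]; last by rewrite cardsE.
  by rewrite cards0.
by apply: leq_trans (leq_add h1 h2); rewrite cardsU leq_subr.
Qed.

(** First moment method with denominators cleared: an edge on [e.+1] vertices is monochromatic in a
    fraction of at most [1 / r ^ e] of all colorings. *)
Lemma few_mono W r e : {in E, forall A, #|A| = e.+1} -> 0 < r ->
  exists c : {ffun T -> 'I_r},
    #|[set A in edges_in W | mono (fun x => c x) A]| * r ^ e <= #|edges_in W|.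
Proof.
move=> Ee r0; apply/existsP; apply: contraT; rewrite negb_exists => /forallP h.
have : \sum_(c : {ffun T -> 'I_r}) #|edges_in W|.+1 <=
  \sum_(c : {ffun T -> 'I_r}) #|[set A in edges_in W | mono (fun x => c x) A]| * r ^ e.
  by apply: leq_sum => c _; rewrite ltnNge h.
rewrite sum_nat_const -big_distrl /= leqNgt => /negP[].
under eq_bigr => c _ do rewrite -sum1dep_card.
rewrite (exchange_big_dep (mem (edges_in W))) /=; last by move=> v A _ /andP[].
apply: (@leq_ltn_trans (\sum_(A in edges_in W) #|{ffun T -> 'I_r}|)).
  rewrite big_distrl /=; apply: leq_sum => A AE; rewrite sum1dep_card.
  have := AE; rewrite inE => /andP[/Ee AE' _].
  apply: leq_trans (card_mono_colorings r AE'); rewrite leq_mul2r; apply/orP; right.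
  by apply: subset_leq_card; apply/subsetP => c; rewrite !inE => /andP[].
rewrite sum_nat_const mulnC ltn_mul2l ltnSn andbT.
by rewrite card_ffun card_ord expn_gt0 r0.
Qed.

(* W' consists of one vertex of each monochromatic edge of a good r-coloring; on W' the
   colors are replaced by m fresh ones. *)
Lemma halving_colorable W r e : {in E, forall A, #|A| = e.+1} -> 0 < r ->
  #|edges_in W| * 2 <= r ^ e * #|W| ->
  exists2 W' : {set T}, #|W'| * 2 <= #|W| & forall m, colorable_in W' m -> colorable_in W (r + m).
Proof.
move=> Ee r0 hr; have [c hc] := few_mono W Ee r0.
set M := [set _ in _ | _] in hc.
have [W0|W0] := eqVneq W set0.
  exists set0; rewrite ?cards0 // => m _; exists (fun=> 0); split => [v|A AE].
    by rewrite W0 inE.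
  by rewrite W0 subset0 => /eqP A0; have := Ee A AE; rewrite A0 cards0.
have [w0 w0W] : exists x, x \in W by apply/set0Pn.
pose pt A := odflt w0 [pick x in A].
exists [set pt A | A in M].
  have re : 0 < r ^ e by rewrite expn_gt0 r0.
  rewrite -(leq_pmul2l re) mulnA; apply: leq_trans hr.
  rewrite leq_mul2r /=; apply: leq_trans hc; rewrite mulnC leq_mul2r.
  by rewrite leq_imset_card orbT.
move=> m [c' [c'W c'E]].
exists (fun x => if x \in [set pt A | A in M] then r + c' x else c x).
split => [x xW|A AE AW].
  case: ifP => [/c'W|_]; first by rewrite ltn_add2l.
  by apply: leq_trans (ltn_ord _) (leq_addr _ _).
set W' := [set pt _ | _ in _] in c'W c'E *.
have [AW'|] := boolP (A \subset W').
  apply: contra (c'E A AE AW') => /forall_inP h; apply/forall_inP => x xA.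
  apply/forall_inP => y yA; have := forall_inP (h x xA) y yA.
  by rewrite !(subsetP AW') // eqn_add2l.
case/subsetPn => y yA yW'.
have [x /andP[xA xW']|none] := pickP (fun x => (x \in A) && (x \in W')).
  apply: (notmonoP xA yA); rewrite xW' (negPf yW') neq_ltn; apply/orP; right.
  by apply: leq_trans (ltn_ord _) (leq_addr _ _).
have nW' x : x \in A -> (x \in W') = false by move=> xA; have := none x; rewrite xA.
apply/negP => mA; have : A \in M.
  rewrite !inE AE AW /=; apply/forall_inP => x xA; apply/forall_inP => u uA.
  by have := forall_inP (forall_inP mA x xA) u uA; rewrite !nW'.
have ptA : pt A \in A by rewrite /pt; case: pickP => // /(_ y); rewrite yA.
by move=> AM; have := none (pt A); rewrite ptA imset_f.
Qed.

End Coloring.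

From mathcomp Require Import all_field reals exp lra zify.
Import Order.TTheory Num.Theory.
Local Open Scope ring_scope.

(** * The number of colors used by the recursion *)

Lemma powR_lt1 (R : realType) (a x : R) : 0 <= a -> a < 1 -> 0 < x -> a `^ x < 1.
Proof.
move=> a0 a1 x0; have <- : 1 `^ x = 1 :> R by rewrite powR1.
apply: gt0_ltr_powR; rewrite ?nnegrE ?ler01 //.
Qed.

(** Each round spends [O(x ^ be)] colors on [x] vertices and at least halves the set, so the total
    is a geometric series of ratio [q = 2 ^ (- be)]. For [k = 1] the exponent is 0 and all rounds
    would cost the same, a logarithmic loss; that case uses degeneracy instead. *)
Lemma hereditary_colorable (R : realType) (d k C : nat) : (0 < d)%N -> (0 < k)%N ->
  exists B : R, forall (T : finType) (E : {set {set T}}),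
    {in E, forall A : {set T}, #|A| = d.+1} ->
    (forall W, #|edges_in E W| <= C * #|W| ^ k)%N ->
    forall W : {set T}, (0 < #|W|)%N -> exists2 m, colorable_in E W m &
      m%:R <= B * #|W|%:R `^ ((k%:R - 1) / d%:R).
Proof.
move=> d0; case: k => [//|[|k]] _.
  exists (C * d.+1).+1%:R => T E Ed h W _; exists (C * d.+1).+1.
    by apply: linear_colorable => // U; have := h U; rewrite expn1.
  by rewrite subrr mul0r powRr0 mulr1.
have d0' : 0 < d%:R :> R by rewrite ltr0n.
rewrite -natr1 addrK; set be := _ / _; have be0 : 0 < be :> R.
  by rewrite divr_gt0 // ltr0n.
pose q : R := 2^-1 `^ be.
have q1 : q < 1 by apply: powR_lt1; rewrite ?invr_ge0 ?ler0n // invf_lt1 ?ltr1n.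
(* One round uses at most [B0 * x ^ be] colors, the summand 1 paying for rounding [y] up; [A] is the
   solution of [B0 + A * q = A]. *)
pose B0 : R := (2 * C)%:R `^ d%:R^-1 + 1.
have B00 : 0 <= B0 by rewrite addr_ge0 ?powR_ge0.
pose A : R := B0 / (1 - q).
have A0 : 0 <= A by rewrite divr_ge0 // subr_ge0 ltW.
exists A => T E Ed h W _.
have [N] := ubnP #|W|; elim: N W => // N IH W WN.
have [W0|W0] := posnP #|W|.
  exists 0%N; last by rewrite mulr_ge0 // powR_ge0.
  move/cards0_eq: W0 => ->; exists (fun=> 0%N); split => [v|e eE].
    by rewrite inE.
  by rewrite subset0 => /eqP e0; have := Ed e eE; rewrite e0 cards0.
set x := #|W| in W0 WN *.
(* Chosen to make [r ^ d] at least [2 * C * x ^ k.+1], which is what halving needs when there are at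
   most [C * x ^ k.+2] edges. *)
pose y : R := (2 * C * x ^ k.+1)%:R `^ d%:R^-1.
have y0 : 0 <= y by exact: powR_ge0.
pose r := (Num.truncn y).+1.
have yr : y <= r%:R by rewrite ltW // real_truncnS_gt // num_real.
have ry : r%:R <= y + 1.
  by rewrite -natr1 lerD2r truncn_le.
have rd : (2 * C * x ^ k.+1 <= r ^ d)%N.
  rewrite -(ler_nat R) natrX; apply: le_trans (_ : y ^+ d <= _); last first.
    by rewrite lerXn2r ?nnegrE.
  by rewrite -powR_mulrn // -powRrM mulVf ?lt0r_neq0 // powRr1.
have [|W' W'x col] := halving_colorable (W := W) (r := r) Ed isT.
  rewrite -/x; apply: leq_trans (_ : 2 * C * x ^ k.+1 * x <= _)%N; last first.
    by rewrite leq_mul2r rd orbT.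
  by rewrite -mulnA -expnSr mulnC -mulnA leq_mul2l /= h.
rewrite -/x in W'x.
have W'N : (#|W'| < N)%N.
  rewrite -ltnS; apply: leq_trans WN; rewrite ltnS.
  have [->//|p] := posnP #|W'|.
  by apply: leq_trans W'x; rewrite muln2 -addnn -addn1 leq_add2l.
have [m cm mb] := IH W' W'N.
exists (r + m)%N; first exact: col.
have xb1 : 1 <= x%:R `^ be.
  apply: (@le_trans _ _ (1 `^ be)); first by rewrite powR1.
  by apply: ge0_ler_powR; rewrite ?nnegrE ?ler1n // ltW.
have rb : r%:R <= B0 * x%:R `^ be.
  apply: le_trans ry _; rewrite mulrDl mul1r lerD //.
  rewrite /y natrM powRM ?ler0n // natrX -powR_mulrn ?ler0n // -powRrM.
  by rewrite ler_wpM2l ?powR_ge0.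
have mb' : m%:R <= A * q * x%:R `^ be.
  apply: le_trans mb _; rewrite -mulrA ler_wpM2l // -powRM ?invr_ge0 ?ler0n //.
  apply: ge0_ler_powR; rewrite ?nnegrE ?mulr_ge0 ?invr_ge0 ?ler0n ?(ltW be0) //.
  by rewrite ler_pdivlMl ?ltr0n // -natrM ler_nat mulnC.
rewrite natrD; apply: le_trans (lerD rb mb') _; rewrite -mulrDl.
suff -> : B0 + A * q = A by [].
have : 1 - q != 0 by rewrite lt0r_neq0 // subr_gt0.
move=> q0; have -> : B0 = A * (1 - q) by rewrite /A divfK.
by rewrite mulrBr mulr1 subrK.
Qed.

(** * Chain approximation *)

Section Subdivision.
Context (R : realFieldType) (n : nat).
Notation point := 'rV[R]_n.
Implicit Types (s t f : seq point) (x y : point) (e : R).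

Definition bary s : point := (size s)%:R^-1 *: \sum_(x <- s) x.

(** Barycentric subdivision; [k] is fuel, set to the size of the list in [sd]. The vertices of each
    small simplex follow a descending flag of faces. *)
Fixpoint sdk k s : seq (seq point) :=
  if k is k'.+1 then flatten [seq map (cons (bary s)) (sdk k' f) | f <- faces s]
  else [:: [::]].

Definition sd s := sdk (size s) s.

Fixpoint Sd N s := if N is N'.+1 then flatten (map (Sd N') (sd s)) else [:: s].

Lemma sdE x s : sd (x :: s) =
  flatten [seq map (cons (bary (x :: s))) (sd f) | f <- faces (x :: s)].
Proof.
transitivity (flatten [seq map (cons (bary (x :: s))) (sdk (size s) f) | f <- faces (x :: s)]).
  by [].
congr flatten; apply/eq_in_map => f /faces_size [h].
by rewrite /sd h.
Qed.

Lemma sd_ind (P : seq point -> seq point -> Prop) :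
  P [::] [::] ->
  (forall s f t, s != [::] -> f \in faces s -> t \in sd f -> P f t -> P s (bary s :: t)) ->
  forall s t, t \in sd s -> P s t.
Proof.
move=> P0 PS s; have [k] := ubnP (size s); elim: k s => // k IH [|x s] sk t.
  by rewrite inE => /eqP->.
rewrite sdE => /flatten_mapP[f fs /mapP[t' tf ->]].
apply: (PS _ f) => //; apply: IH => //.
by rewrite -ltnS (faces_size fs).
Qed.

Lemma sd_size s t : t \in sd s -> size t = size s.
Proof. by move: s t; apply: sd_ind => // s f t _ /faces_size <- _ /= ->. Qed.

Lemma Sd_size N s t : t \in Sd N s -> size t = size s.
Proof.
elim: N s => /= [|N IH] s; first by rewrite inE => /eqP->.
by case/flatten_mapP => s' /sd_size <- /IH.
Qed.

Section SumSd.
Context (V : zmodType) (ch2 : forall v : V, v + v = 0).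

(** Removing the apex [bary s] from a simplex of [sd s] gives the right-hand side. The faces that
    keep the apex amount, by induction, to a double sum over faces of faces, which vanishes. *)
Lemma sum_sd (g : seq point -> V) s :
  \sum_(t <- sd s) \sum_(u <- faces t) g u = \sum_(f <- faces s) \sum_(t <- sd f) g t.
Proof.
have [k] := ubnP (size s); elim: k s g => // k IH [|x s] g sk.
  by rewrite big_seq1 !big_nil.
rewrite sdE big_flatten big_map.
transitivity (\sum_(f <- faces (x :: s)) \sum_(t <- sd f)
   (g t + \sum_(u <- faces t) g (bary (x :: s) :: u))).
  apply: eq_bigr => f _; rewrite big_map; apply: eq_bigr => t _.
  by rewrite big_cons big_map.
under [LHS]eq_bigr => f _ do rewrite big_split.
rewrite [LHS]big_split -[RHS]addr0; congr (_ + _).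
rewrite -[RHS](big_faces_faces (fun f => \sum_(t <- sd f) g (bary (x :: s) :: t)) (x :: s) ch2).
apply: eq_big_seq => f fs; rewrite IH //.
by rewrite -ltnS (faces_size fs).
Qed.

Lemma sum_Sd N (g : seq point -> V) s :
  \sum_(t <- Sd N s) \sum_(u <- faces t) g u = \sum_(f <- faces s) \sum_(t <- Sd N f) g t.
Proof.
elim: N s => /= [|N IH] s.
  by rewrite big_seq1; apply: eq_bigr => f _; rewrite big_seq1.
rewrite big_flatten big_map; under eq_bigr => t _ do rewrite IH.
rewrite sum_sd; apply: eq_bigr => f _.
by rewrite big_flatten big_map.
Qed.

End SumSd.

Lemma sd_closed (P : pred point) s t :
  (forall u, u != [::] -> all P u -> P (bary u)) -> all P s -> t \in sd s -> all P t.
Proof.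
move=> hP + st; move: s t st.
apply: (@sd_ind (fun s t => all P s -> all P t)) => // s f t s0 fs _ IH sP /=.
rewrite hP //= IH //; apply/allP => x /(faces_sub fs); exact: (allP sP).
Qed.

Lemma Sd_closed N (P : pred point) s t :
  (forall u, u != [::] -> all P u -> P (bary u)) -> all P s -> t \in Sd N s -> all P t.
Proof.
move=> hP; elim: N s => /= [|N IH] s sP; first by rewrite inE => /eqP->.
by case/flatten_mapP => s' /(sd_closed hP sP); apply: IH.
Qed.

Definition coord_close e x y := [forall l, `|x 0 l - y 0 l| <= e].

Lemma coord_closeP e x y : reflect (forall l, `|x 0 l - y 0 l| <= e) (coord_close e x y).
Proof. exact: forallP. Qed.

Lemma baryE s l : bary s 0 l = (size s)%:R^-1 * \sum_(x <- s) x 0 l.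
Proof. by rewrite mxE summxE. Qed.

Lemma close_bary e x s : s != [::] -> all (coord_close e x) s -> coord_close e x (bary s).
Proof.
move=> s0 /allP h; apply/coord_closeP => l.
have sz : 0 < (size s)%:R :> R by rewrite ltr0n lt0n size_eq0.
have -> : x 0 l - bary s 0 l = (size s)%:R^-1 * \sum_(y <- s) (x 0 l - y 0 l).
  by rewrite baryE sumrB big_const_seq count_predT iter_addr_0 mulrBr
     -[x 0 l *+ _]mulr_natl mulKf ?gt_eqF.
rewrite normrM ger0_norm ?invr_ge0 ?(ltW sz) // ler_pdivrMl // mulr_natl.
apply: le_trans (ler_norm_sum _ _ _) _.
rewrite -[X in _ <= e *+ X]count_predT -iter_addr_0 -big_const_seq.
rewrite !big_seq; apply: ler_sum => y /h /coord_closeP; exact.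
Qed.

Definition diam e s := {in s &, forall x y, coord_close e x y}.

(** The point [x] contributes 0 to the average of the differences, so the factor is
    [(size s).-1 / size s], at most [m / m.+1]. *)
Lemma close_bary_mem m e x s : 0 <= e -> x \in s -> (size s <= m.+1)%N -> diam e s ->
  coord_close (m%:R / m.+1%:R * e) (bary s) x.
Proof.
move=> e0 xs sm ds; apply/coord_closeP => l.
have sz : 0 < (size s)%:R :> R by rewrite ltr0n; case: s xs {sm ds}.
have -> : bary s 0 l - x 0 l = (size s)%:R^-1 * \sum_(y <- s) (y 0 l - x 0 l).
  by rewrite baryE sumrB big_const_seq count_predT iter_addr_0 mulrBr
     -[x 0 l *+ _]mulr_natl mulKf ?gt_eqF.
rewrite normrM ger0_norm ?invr_ge0 ?(ltW sz) // ler_pdivrMl //.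
apply: le_trans (ler_norm_sum _ _ _) _.
apply: (@le_trans _ _ ((size s).-1%:R * e)); last first.
  have -> : (size s)%:R * (m%:R / m.+1%:R * e) = ((size s)%:R * m%:R / m.+1%:R) * e.
    by rewrite !mulrA.
  apply: ler_wpM2r => //; rewrite ler_pdivlMr ?ltr0n // -!natrM ler_nat.
  case: (size s) sm {ds sz xs} => //= k km; rewrite mulnS mulSn.
  by rewrite leq_add2r; move: km; rewrite ltnS.
have [i si] : exists i, size s = i.+1 by case: s xs {sm ds sz} => // a s _; exists (size s).
rewrite (perm_big _ (perm_to_rem xs)) big_cons /= subrr normr0 add0r /=.
have -> : (size s).-1 = size (rem x s) by rewrite size_rem.
rewrite mulr_natl -[X in _ <= e *+ X]count_predT -iter_addr_0 -big_const_seq.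
rewrite !big_seq; apply: ler_sum => y ys.
by move/coord_closeP: (ds _ _ (mem_rem ys) xs); apply.
Qed.

Lemma coord_close_sym e x y : coord_close e x y = coord_close e y x.
Proof. by apply: eq_forallb => l; rewrite distrC. Qed.

Lemma sd_diam m e s t : 0 <= e -> (size s <= m.+1)%N -> diam e s -> t \in sd s ->
  diam (m%:R / m.+1%:R * e) t.
Proof.
move=> e0 + + st; move: s t st.
apply: (@sd_ind (fun s t => (size s <= m.+1)%N -> diam e s -> diam (m%:R / m.+1%:R * e) t)).
  by move=> _ _ x y; rewrite in_nil.
move=> s f t s0 fs tf IH sm ds.
have fsub := faces_sub fs.
have ct : all (coord_close (m%:R / m.+1%:R * e) (bary s)) t.
  apply: (sd_closed (close_bary (x := bary s)) _ tf).
  by apply/allP => x /fsub xs; exact: close_bary_mem.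
have {}IH : diam (m%:R / m.+1%:R * e) t.
  apply: IH; first by apply: leq_trans sm; rewrite -(faces_size fs).
  by move=> x y /fsub xs /fsub ys; exact: ds.
have bb : coord_close (m%:R / m.+1%:R * e) (bary s) (bary s).
  by apply/coord_closeP => l; rewrite subrr normr0 mulr_ge0 // divr_ge0.
move=> x y; rewrite !inE => /orP[/eqP->|xt] /orP[/eqP->|yt] //.
- exact: (allP ct).
- by rewrite coord_close_sym; exact: (allP ct).
- exact: IH.
Qed.

Lemma Sd_diam N m e s t : 0 <= e -> (size s <= m.+1)%N -> diam e s -> t \in Sd N s ->
  diam ((m%:R / m.+1%:R) ^+ N * e) t.
Proof.
elim: N s e => /= [|N IH] s e e0 sm ds; first by rewrite inE mul1r => /eqP->.
case/flatten_mapP => s' ss'; rewrite exprSr -mulrA; apply: IH.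
- by rewrite mulr_ge0 // divr_ge0.
- by rewrite (sd_size ss').
- exact: sd_diam ss'.
Qed.

Lemma Sd_nil N : Sd N [::] = [:: [::]].
Proof. by elim: N => //= N ->. Qed.

Lemma Sd_singleton N x : Sd N [:: x] = [:: [:: x]].
Proof.
elim: N => //= N IH; rewrite /sd /= /bary /= big_seq1 invr1 scale1r IH //.
Qed.

End Subdivision.

Section IdHomotopy.
Context (F : fieldType) (ch2 : forall x : F, x + x = 0) (n : nat).
Notation chain := {ffun {set 'I_n} -> F}.
Context (Phi : seq 'I_n -> chain).
Context (bdPhi : forall s, bd (Phi s) = \sum_(f <- faces s) Phi f).
Context (Phi0 : Phi [::] = ind F set0).

(* Both the identity and Phi commute with the boundary, so they are homotopic on each
   simplex: cone the error from the first vertex, by induction on dimension. *)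
Fixpoint idhk k (s : seq 'I_n) : chain :=
  match k, s with
  | k'.+1, x :: _ => cone x (smp F s + Phi s + \sum_(f <- faces s) idhk k' f)
  | _, _ => 0
  end.

Definition idh s := idhk (size s) s.

Lemma idhE x s : idh (x :: s) =
  cone x (smp F (x :: s) + Phi (x :: s) + \sum_(f <- faces (x :: s)) idh f).
Proof.
rewrite {1}/idh [size _]/= [LHS]/=; congr (cone x (_ + _)).
by apply: eq_big_seq => f fs; have [h] := @faces_size _ (x :: s) f fs; rewrite /idh h.
Qed.

Lemma bd_idh s : bd (idh s) + \sum_(f <- faces s) idh f = smp F s + Phi s.
Proof.
have [k] := ubnP (size s); elim: k s => // k IH [|x s] sk.
  by rewrite big_nil bd0 Phi0 addr0 (chain_ch2 ch2).
have bc : bd (smp F (x :: s) + Phi (x :: s) + \sum_(f <- faces (x :: s)) idh f) = 0.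
  rewrite !bdD bd_smp // bdPhi bd_sum -!big_split.
  apply: etrans (big_faces_faces idh (x :: s) (@chain_ch2 _ ch2 n)).
  apply: eq_big_seq => f fs /=; rewrite -IH; last by rewrite -ltnS (faces_size fs).
  by rewrite addrAC (chain_ch2 ch2) add0r.
by rewrite idhE bd_cone // bc cone0 addr0 -addrA (chain_ch2 ch2) addr0.
Qed.

Lemma idh_inside (A : {set 'I_n}) s :
  (forall s, {subset s <= A} -> inside A (Phi s)) -> {subset s <= A} -> inside A (idh s).
Proof.
move=> hP; have [k] := ubnP (size s); elim: k s => // k IH [|x s] sk sA.
  by move=> B; rewrite ffunE eqxx.
rewrite idhE; apply: inside_cone; first by apply: sA; rewrite mem_head.
apply: insideD; first by apply: insideD; [exact: inside_smp | exact: hP].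
apply: inside_sumP => f fs; apply: IH; first by rewrite -ltnS (faces_size fs).
by move=> y /(faces_sub fs) /sA.
Qed.

End IdHomotopy.

(** * Points of the realization and their vertex labels *)

Section Realization.
Context (R : realFieldType) (n : nat).
Notation point := 'rV[R]_n.
Implicit Types (s t : seq point) (x y : point) (A B : {set 'I_n}).

Definition simplex A x :=
  [&& [forall l, 0 <= x 0 l], \sum_l x 0 l == 1 & [forall l, (x 0 l != 0) ==> (l \in A)]].

Definition vsupp x : {set 'I_n} := [set l | x 0 l != 0].

Lemma simplexP A x : reflect
  [/\ forall l, 0 <= x 0 l, \sum_l x 0 l = 1 & vsupp x \subset A] (simplex A x).
Proof.
apply: (iffP and3P) => -[h1 h2 h3]; split.
- exact/forallP.
- exact/eqP.
- by apply/subsetP => l; rewrite inE; exact/implyP/(forallP h3).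
- exact/forallP.
- exact/eqP.
- by apply/forallP => l; apply/implyP => xl; apply: (subsetP h3); rewrite inE.
Qed.

Lemma simplex_support A x : simplex A x -> simplex (vsupp x) x.
Proof. by case/simplexP => h1 h2 _; apply/simplexP. Qed.

Definition vertex (l : 'I_n) : point := delta_mx 0 l.

Lemma simplex_vertex A l : l \in A -> simplex A (vertex l).
Proof.
move=> lA; apply/simplexP; split => [k||].
- by rewrite mxE eqxx /= ler0n.
- rewrite (bigD1 l) //= mxE !eqxx big1 ?addr0 // => k kl.
  by rewrite mxE eqxx (negPf kl).
- apply/subsetP => k; rewrite inE mxE eqxx /=.
  by case: (k =P l) => [->//|]; rewrite eqxx.
Qed.

Lemma simplex_bary A s : s != [::] -> all (simplex A) s -> simplex A (bary s).
Proof.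
move=> s0 /allP h.
have sz : (size s)%:R != 0 :> R by rewrite pnatr_eq0 size_eq0.
apply/simplexP; split => [l||].
- rewrite baryE mulr_ge0 ?invr_ge0 // big_seq sumr_ge0 // => x /h /simplexP[]//.
- under eq_bigr => l _ do rewrite baryE.
  rewrite -mulr_sumr exchange_big big_seq (eq_bigr (fun=> 1)) /=; last by move=> x /h /simplexP[].
  by rewrite -big_seq big_const_seq count_predT iter_addr_0 mulVf.
- apply/subsetP => l; rewrite inE baryE; apply: contraNT => lA.
  rewrite big_seq big1 ?mulr0 // => x /h /simplexP[_ _ /subsetP xA].
  by apply/eqP; apply: contraNT lA => xl; apply: xA; rewrite inE.
Qed.

Lemma simplex_le1 A x l : simplex A x -> x 0 l <= 1.
Proof.
case/simplexP => x0 <- _; rewrite (bigD1 l) //= lerDl sumr_ge0 // => k _; exact: x0.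
Qed.

Lemma simplex_close1 A x y : simplex A x -> simplex A y -> coord_close 1 x y.
Proof.
move=> xA yA; apply/coord_closeP => l; rewrite ler_norml.
have := simplex_le1 l xA; have := simplex_le1 l yA.
case/simplexP: xA => /(_ l) ? _ _; case/simplexP: yA => /(_ l) ? _ _.
by move=> ? ?; apply/andP; split; lra.
Qed.

Context (l0 : 'I_n).

Definition label x : 'I_n := [arg max_(l > l0) x 0 l]%O.

Lemma label_ge A x : simplex A x -> n%:R^-1 <= x 0 (label x).
Proof.
case/simplexP => _ x1 _; rewrite /label.
have n0 : 0 < n%:R :> R by rewrite ltr0n; case: (n) l0 => // -[].
case: arg_maxP => // i _ h.
rewrite -div1r ler_pdivrMr // -[leLHS]x1 mulr_natr -[X in _ *+ X]card_ord -sumr_const.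
by apply: ler_sum => l _; exact: h.
Qed.

(** The largest of [n] coordinates with sum 1 is at least [1 / n], so it cannot vanish at a point
    closer than that. Hence the labels of points this close to one [y] all lie in the support of
    [y], and so span a face. *)
Lemma label_support A x y : simplex A x -> simplex A y ->
  (forall l, `|x 0 l - y 0 l| < n%:R^-1) -> label x \in vsupp y.
Proof.
move=> xA yA xy; rewrite inE; apply/eqP => e; have := xy (label x).
by rewrite e subr0 ltNge (le_trans (label_ge xA)) // ler_norm.
Qed.

End Realization.

Lemma exists_mesh (R : archiRealFieldType) (n : nat) (delta : R) : 0 < delta ->
  exists N, (n%:R / n.+1%:R) ^+ N <= delta.
Proof.
move=> d0; set r := _ / _.
have r0 : 0 <= r by rewrite divr_ge0.
have r1 : r < 1 by rewrite ltr_pdivrMr ?ltr0n // mul1r ltr_nat.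
(* Bernoulli's inequality for [r^-1], multiplied by [r ^+ N]. *)
have bern N : (1 + N%:R * (r^-1 - 1)) * r ^+ N <= 1.
  have [->|rN0] := eqVneq r 0.
    rewrite invr0; case: N => [|N]; first by rewrite mul0r addr0 mul1r expr0.
    by rewrite expr0n /= mulr0.
  have rp : 0 < r by rewrite lt_neqAle eq_sym rN0.
  elim: N => [|N IH]; first by rewrite mul0r addr0 mul1r expr0.
  apply: le_trans IH; rewrite exprS mulrA ler_wpM2r ?exprn_ge0 // -natr1.
  have g0 : 0 <= r^-1 - 1 by rewrite subr_ge0 invf_ge1 // ltW.
  have rg : r * (r^-1 - 1) = 1 - r by rewrite mulrBr mulfV // mulr1.
  have u0 : 0 <= N%:R * (r^-1 - 1) by rewrite mulr_ge0.
  have : r * (N%:R * (r^-1 - 1)) <= N%:R * (r^-1 - 1) by rewrite ler_piMl // ltW.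
  by move: rg; set g := r^-1 - 1; set k := N%:R; lra.
have [->|rN0] := eqVneq r 0; first by exists 1%N; rewrite expr1 ltW.
have rp : 0 < r by rewrite lt_neqAle eq_sym rN0.
have g0 : 0 < r^-1 - 1 by rewrite subr_gt0 invf_gt1.
pose N := Num.truncn (delta^-1 / (r^-1 - 1)).
exists N.+1.
have := bern N.+1; set q := r ^+ _ => bq.
have q0 : 0 <= q by rewrite exprn_ge0.
have : delta^-1 <= N.+1%:R * (r^-1 - 1).
  by rewrite -ler_pdivrMr // ltW // real_truncnS_gt // num_real.
move=> hd; have : delta^-1 * q <= 1.
  by apply: le_trans bq; apply: ler_wpM2r => //; apply: le_trans hd _; rewrite lerDr.
by rewrite ler_pdivrMl // mulr1.
Qed.

(** * From homotopies of spaces to homotopies of chains *)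

Section Approximation.
Context (F : fieldType) (ch2 : forall x : F, x + x = 0).
Context (R : archiRealFieldType) (n : nat) (l0 : 'I_n).
Notation point := 'rV[R]_n.
Notation chain := {ffun {set 'I_n} -> F}.
Context (L : {set {set 'I_n}}) (downL : downset L).

Definition realized (x : point) := vsupp x \in L /\ simplex (vsupp x) x.

Lemma realized_simplex A x : A \in L -> simplex A x -> realized x.
Proof.
move=> AL xA; split; last exact: simplex_support xA.
by apply: downL AL _; case/simplexP: xA.
Qed.

Context (M : nat) (h : nat -> point -> point) (delta : R) (delta0 : 0 < delta).
Context (h0 : forall x, realized x -> h 0%N x = x).
Context (hL : forall i x, (i <= M)%N -> realized x -> realized (h i x)).
Context (hclose : forall i j x y, (i <= M)%N -> (j <= M)%N -> (j = i \/ j = i.+1) ->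
  realized x -> realized y -> coord_close delta x y ->
  forall l, `|h i x 0 l - h j y 0 l| < n%:R^-1).

Notation lab i := (fun x => label l0 (h i x)).
Notation verts A := (map (@vertex R n) (enum A)).

(* [sub A] is a fine subdivision of A; the labels of its points under h 0 = id, h 1, ...,
   h M give simplicial maps, consecutive ones being joined by prisms. *)
Lemma chain_approximation : exists (sub : {set 'I_n} -> seq (seq point)) (S : {set 'I_n} -> chain),
  [/\ forall A t, t \in sub A -> [/\ size t = #|A|, all (simplex A) t & diam delta t],
      sub set0 = [:: [::]], forall v, exists x, sub [set v] = [:: [:: x]] &
      forall A, A \in L -> (forall B, S A B != 0 -> B \in L) /\
        bd (S A) + \sum_(v in A) S (A :\ v) =
        ind F A + \sum_(t <- sub A) smp F (map (lab M) t)].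
Proof.
have [N meshN] := @exists_mesh R n delta delta0.
pose sb (s : seq 'I_n) := Sd N (map (@vertex R n) s).
pose Phi i (s : seq 'I_n) : chain := \sum_(t <- sb s) smp F (map (lab i) t).
have cch2 := @chain_ch2 _ ch2 n.
have bdPhi i s : bd (Phi i s) = \sum_(f <- faces s) Phi i f.
  rewrite bd_sum.
  under eq_bigr => t _ do rewrite bd_smp // faces_map big_map.
  by rewrite sum_Sd // faces_map big_map.
have Phi0 i : Phi i [::] = ind F set0 by rewrite /Phi /sb /= Sd_nil big_seq1.
have sbA s t (A : {set 'I_n}) : {subset s <= A} -> t \in sb s -> all (simplex A) t.
  move=> sA; apply: Sd_closed (@simplex_bary R n A) _.
  by apply/allP => _ /mapP[l /sA lA ->]; exact: simplex_vertex.
have sbP s t (A : {set 'I_n}) : {subset s <= A} -> (size s <= n.+1)%N -> t \in sb s ->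
    [/\ size t = size s, all (simplex A) t & diam delta t].
  move=> sA sn tP.
  have vA : all (simplex A) (map (@vertex R n) s).
    by apply/allP => _ /mapP[l /sA lA ->]; exact: simplex_vertex.
  split; first by rewrite (Sd_size tP) size_map.
    exact: Sd_closed (@simplex_bary R n A) vA tP.
  have d1 : diam 1 (map (@vertex R n) s).
    by move=> x y /(allP vA) xA /(allP vA) yA; exact: simplex_close1 yA.
  move=> x y xt yt; apply/coord_closeP => l; apply: le_trans meshN.
  have sm : (size (map (@vertex R n) s) <= n.+1)%N by rewrite size_map.
  by have /coord_closeP := Sd_diam ler01 sm d1 tP xt yt; rewrite mulr1; apply.
(* [T] joins the identity to the subdivision labelled through [h 0]; [Pr] telescopes from [h 0] to
   [h M]. *)
pose T := idh (Phi 0%N).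
pose Pr s : chain := \sum_(i < M) \sum_(t <- sb s) prism F (lab i) (lab i.+1) t.
have bdPr s : bd (Pr s) + \sum_(f <- faces s) Pr f = Phi 0%N s + Phi M s.
  rewrite bd_sum exchange_big -big_split /=.
  have E (i : 'I_M) : bd (\sum_(t <- sb s) prism F (lab i) (lab i.+1) t) +
      \sum_(f <- faces s) \sum_(t <- sb f) prism F (lab i) (lab i.+1) t =
      Phi i s + Phi i.+1 s.
    transitivity (\sum_(t <- sb s) (bd (prism F (lab i) (lab i.+1) t) +
       \sum_(u <- faces t) prism F (lab i) (lab i.+1) u)).
      rewrite big_split /= sum_Sd // faces_map big_map bd_sum //.
    rewrite -big_split; apply: eq_bigr => t _; exact: bd_prism.
  rewrite (eq_bigr _ (fun i _ => E i)).
  elim: (M) => [|k IH]; first by rewrite big_ord0 cch2.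
  by rewrite big_ord_recr /= IH addrA -[X in X + _]addrA cch2 addr0.
exists (fun A : {set 'I_n} => sb (enum A)), (fun A : {set 'I_n} => T (enum A) + Pr (enum A)).
have enN (A : {set 'I_n}) : (size (enum A) <= n.+1)%N.
  by rewrite -cardE (leq_trans (max_card _)) // card_ord.
split.
- move=> A t tA; rewrite cardE; apply: sbP tA => // l; by rewrite mem_enum.
- by rewrite enum_set0 /sb /= Sd_nil.
- by move=> v; exists (vertex R v); rewrite enum_set1 /sb /= Sd_singleton.
move=> A AL; split.
  move=> B; have inA s t : {subset s <= A} -> (size s <= n.+1)%N -> t \in sb s ->
      {in t, forall x, realized x} /\ diam delta t.
    move=> sA sn /(sbP _ _ _ sA sn)[_ tA dt]; split => // x xt.
    exact: realized_simplex AL (allP tA x xt).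
  (* On the part [T] the labels are vertices of [A] itself, because [h 0] fixes its points. *)
  have [E|TB] := eqVneq (T (enum A) B) 0; last first.
    move=> _; apply: (downL AL); move: TB; apply: (idh_inside (A := A)); last first.
      by move=> l; rewrite mem_enum.
    move=> s sA; apply: inside_sumP => t tP; apply: inside_smp => l /mapP[x xt ->].
    have xA := allP (sbA _ _ _ sA tP) x xt; rewrite h0; last exact: (realized_simplex AL xA).
    case/simplexP: (xA) => _ _ /subsetP; apply.
    by apply: (label_support l0 xA xA) => l'; rewrite subrr normr0 invr_gt0 ltr0n;
      case: (n) l0 => // -[].
  rewrite ffunE E add0r sum_ffunE => /eqP PB.
  have [i] : exists i : 'I_M, (\sum_(t <- sb (enum A)) prism F (lab i) (lab i.+1) t) B != 0.
    apply/existsP; apply: contraT; rewrite negb_exists => /forallP h1; case: PB.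
    by apply: big1 => i _; have := h1 i; rewrite negbK => /eqP.
  rewrite sum_ffunE => /eqP PB'.
  have [t tP] : exists2 t, t \in sb (enum A) & prism F (lab i) (lab i.+1) t B != 0.
    apply/hasP; apply: contraT => /hasPn h1; case: PB'.
    by rewrite big_seq big1 // => t /h1; rewrite negbK => /eqP.
  have sA : {subset enum A <= A} by move=> l; rewrite mem_enum.
  have [tr dt] := inA _ _ sA (enN A) tP.
  case: t => [|x t] in tP tr dt *; first by rewrite ffunE eqxx.
  have xr := tr x (mem_head _ _).
  have iM : (i <= M)%N by rewrite ltnW.
  (* All labels of the prism, at both levels, lie in the support of [h i x] for the first point [x],
     which is a face of [L]. *)
  have [hsL hss] := hL iM xr.
  move=> tB; apply: downL hsL _; move: tB; apply: inside_prism => y yt.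
  have yr := tr y yt.
  have [_ hy] := hL iM yr; have [_ hy'] := hL (ltn_ord i) yr.
  have cl := dt _ _ (mem_head x t) yt.
  split.
    apply: (@label_support _ _ _ setT).
    - by case/simplexP: hy => ? ? _; apply/simplexP; split => //; exact: subsetT.
    - by case/simplexP: hss => ? ? _; apply/simplexP; split => //; exact: subsetT.
    - apply: (hclose iM iM (or_introl erefl) yr xr); by rewrite coord_close_sym.
  apply: (@label_support _ _ _ setT).
  - by case/simplexP: hy' => ? ? _; apply/simplexP; split => //; exact: subsetT.
  - by case/simplexP: hss => ? ? _; apply/simplexP; split => //; exact: subsetT.
  - by move=> l; rewrite distrC; exact: (hclose iM (ltn_ord i) (or_intror erefl) xr yr cl).
have [en] : uniq (enum A) by exact: enum_uniq.
have facesE (G : seq 'I_n -> chain) :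
    \sum_(f <- faces (enum A)) G f = \sum_(v in A) G (enum (A :\ v)).
  rewrite big_faces_rem // big_enum /=; apply: eq_bigr => v vA; congr G.
  rewrite rem_filter // /enum_mem -filter_predI; apply: eq_filter => l.
  by rewrite /= !inE.
rewrite bdD big_split /= -!facesE addrACA bd_idh // bdPr addrA -[X in X + _]addrA cch2 addr0.
by rewrite smp_enum.
Qed.

(** All labels through [h M] are one vertex [q], so only sizes 0 and 1 survive, as the empty face
    and as [[set q]]. Adding [[set q]] to the homotopy at the empty face cancels both. *)
Lemma contracts_null_homotopic p : realized p -> (forall x, realized x -> h M x = p) ->
  contracts F L.
Proof.
move=> pr hp; have [sub [S [subP sub0 sub1 SP]]] := chain_approximation.
pose q := label l0 p.
have qL : [set q] \in L.
  case: (pr) => pL ps; apply: downL pL _; rewrite sub1set.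
  apply: (label_support l0 ps ps) => l; rewrite subrr normr0 invr_gt0 ltr0n.
  by case: (n) l0 => // -[].
have smp1 : smp F [:: q] = ind F [set q].
  by rewrite smp_uniq; congr ind; apply/setP=> l; rewrite !inE.
have const A t : A \in L -> t \in sub A -> map (lab M) t = nseq #|A| q.
  move=> AL /subP[<- tA _].
  elim: t tA => //= x t IH /andP[xA /IH->]; rewrite hp //.
  exact: realized_simplex xA.
exists (fun A => S A + (if A == set0 then ind F [set q] else 0)) => A AL.
have [SAL SAE] := SP A AL; split.
  move=> B; rewrite ffunE; have [E|/SAL//] := eqVneq (S A B) 0; rewrite E add0r.
  case: ifP => _; last by rewrite ffunE eqxx.
  by rewrite ffunE; case: (B =P [set q]) => [->|]; rewrite ?eqxx.
have smp_big k : smp F (nseq k.+2 q) = 0 by rewrite smp_uniq /= mem_head.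
rewrite bdD big_split /= addrACA SAE.
have [A0|A0] := eqVneq A set0.
  rewrite A0 sub0 big_seq1 /= big_set0 addr0 bd_indE // big_set1.
  have -> : [set q] :\ q = set0 by apply/setP=> l; rewrite !inE andNb.
  by rewrite -addrA (chain_ch2 ch2) addr0.
rewrite bd0 add0r; have [A1|A1] := eqVneq #|A| 1%N.
  have /eqP/cards1P [v Av] := A1; have [x sx] := sub1 v.
  rewrite Av sx big_seq1 big_set1.
  have -> : [set v] :\ v = set0 by apply/setP=> l; rewrite !inE andNb.
  have := const A [:: x] AL; rewrite Av sx inE eqxx cards1 => /(_ isT) ->.
  by rewrite eqxx -[nseq 1 q]/[:: q] smp1 -addrA (chain_ch2 ch2) addr0.
have A2 : exists k, #|A| = k.+2.
  move: A1; rewrite -cards_eq0 in A0; case: #|A| A0 => [|[|k]] // _ _.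
  by exists k.
rewrite big_seq big1 => [|t tA]; last first.
  by rewrite (const A t) //; case: A2 => k ->; exact: smp_big.
rewrite addr0 big1 ?addr0 // => v vA.
case: ifP => // /eqP Av; case: A2 => k; rewrite (cardsD1 v A) vA Av cards0.
by [].
Qed.

End Approximation.

(** * Topology of realizations *)

(* Imported only here, as mathcomp-classical shadows names of finset and fintype. *)
From HB Require Import structures.
From mathcomp Require Import all_classical all_reals all_analysis.
Import Order.TTheory GRing.Theory Num.Theory.
Import numFieldNormedType.Exports.
Local Open Scope ring_scope.

Section Continuity.
Context (R : realType).

Definition cont_on (T U : topologicalType) (A : set T) (f : T -> U) :=
  forall x, A x -> (f @ within A (nbhs x) --> f x)%classic.

Lemma cvg_rV (T : Type) (D : set_system T) (m : nat) (f : T -> 'rV[R]_m) (y : 'rV[R]_m) :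
  Filter D -> (forall j, (fun x => f x 0 j) @ D --> y 0 j)%classic -> (f @ D --> y)%classic.
Proof.
move=> FD h B [P Py PB]; rewrite /nbhs /=.
have : \forall x \near D, forall j, P 0 j (f x 0 j).
  by apply: filter_forall => j; apply: h; exact: Py.
apply: filterS => x Px; apply: PB => i j; rewrite ord1; exact: Px.
Qed.

Section OnSet.
Context (T : topologicalType) (A : set T).

Lemma cont_rV (m : nat) (f : T -> 'rV[R]_m) :
  (forall j, cont_on A (fun x => f x 0 j : R)) -> cont_on A f.
Proof. by move=> h x Ax; apply: cvg_rV => j; exact: h. Qed.

Lemma cont_coord (m : nat) (f : T -> 'rV[R]_m) j :
  cont_on A f -> cont_on A (fun x => f x 0 j : R).
Proof.
move=> h x Ax; apply: (@cvg_comp _ _ _ f (fun v : 'rV[R]_m => v 0 j) _ (nbhs (f x))).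
  exact: h.
exact: coord_continuous.
Qed.

Lemma cont_cst (U : topologicalType) (c : U) : cont_on A (fun=> c).
Proof. by move=> x _; exact: cvg_cst. Qed.

Lemma contD (u v : T -> R) : cont_on A u -> cont_on A v -> cont_on A (fun x => u x + v x).
Proof. by move=> hu hv x Ax; apply: cvgD; [exact: hu|exact: hv]. Qed.

Lemma contN (u : T -> R) : cont_on A u -> cont_on A (fun x => - u x).
Proof. by move=> hu x Ax; apply: cvgN; exact: hu. Qed.

Lemma contB (u v : T -> R) : cont_on A u -> cont_on A v -> cont_on A (fun x => u x - v x).
Proof. by move=> hu hv; apply: contD => //; exact: contN. Qed.

Lemma contM (u v : T -> R) : cont_on A u -> cont_on A v -> cont_on A (fun x => u x * v x).
Proof. by move=> hu hv x Ax; apply: cvgM; [exact: hu|exact: hv]. Qed.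

Lemma contV (u : T -> R) : (forall x, A x -> u x != 0) -> cont_on A u ->
  cont_on A (fun x => (u x)^-1).
Proof. by move=> u0 hu x Ax; apply: cvgV; [exact: u0|exact: hu]. Qed.

Lemma cont_norm (u : T -> R) : cont_on A u -> cont_on A (fun x => `|u x|).
Proof. by move=> hu x Ax; apply: cvg_norm; exact: hu. Qed.

Lemma cont_sqrt (u : T -> R) : cont_on A u -> cont_on A (fun x => Num.sqrt (u x)).
Proof.
move=> hu x Ax; apply: (@cvg_comp _ _ _ u Num.sqrt _ (nbhs (u x))); first exact: hu.
exact: sqrt_continuous.
Qed.

Lemma cont_min (u v : T -> R) : cont_on A u -> cont_on A v ->
  cont_on A (fun x => Num.min (u x) (v x)).
Proof.
move=> hu hv.
have -> : (fun x => Num.min (u x) (v x)) = (fun x => (u x + v x - `|u x - v x|) * 2^-1).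
  by apply/funext => x; rewrite minr_absE.
apply: contM; last exact: cont_cst.
by apply: contB; [exact: contD | apply: cont_norm; exact: contB].
Qed.

Lemma cont_max (u v : T -> R) : cont_on A u -> cont_on A v ->
  cont_on A (fun x => Num.max (u x) (v x)).
Proof.
move=> hu hv.
have -> : (fun x => Num.max (u x) (v x)) = (fun x => (u x + v x + `|u x - v x|) * 2^-1).
  by apply/funext => x; rewrite maxr_absE.
apply: contM; last exact: cont_cst.
by apply: contD; [exact: contD | apply: cont_norm; exact: contB].
Qed.

Lemma cont_sum (I : Type) (r : seq I) (u : I -> T -> R) :
  (forall i, cont_on A (u i)) -> cont_on A (fun x => \sum_(i <- r) u i x).
Proof.
move=> h; elim: r => [|i r IH].
  rewrite (_ : (fun x => _) = fun=> 0); first exact: cont_cst.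
  by apply/funext => x; rewrite big_nil.
rewrite (_ : (fun x => _) = fun x => u i x + \sum_(i <- r) u i x).
  exact: contD.
by apply/funext => x; rewrite big_cons.
Qed.

End OnSet.

Lemma cont_comp (T U V : topologicalType) (A : set T) (B : set U) (f : T -> U) (g : U -> V) :
  (forall x, A x -> B (f x)) -> cont_on A f -> cont_on B g -> cont_on A (g \o f).
Proof.
move=> AB hf hg x Ax; apply: (@cvg_comp _ _ _ f g _ (within B (nbhs (f x)))); last first.
  exact: hg (AB x Ax).
move=> P; rewrite /within /= => hP.
have := hf x Ax _ hP; rewrite /nbhs /= /within /=.
by apply: filterS => y h Ay; apply: h => //; exact: AB.
Qed.

Lemma cont_id (T : topologicalType) (A : set T) : cont_on A id.
Proof. by move=> x _; exact: cvg_within. Qed.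

Lemma cont_proj (m : nat) (A : set 'rV[R]_m) j : cont_on A (fun x => x 0 j : R).
Proof. by apply: (cont_coord (f := id)); exact: cont_id. Qed.

Lemma cont_within (T U : topologicalType) (A : set T) (f : T -> U) :
  {within A, continuous f}%classic -> cont_on A f.
Proof. by move/subspace_continuousP. Qed.

(** Heine-Cantor for coordinatewise distances, from the near-covering form of compactness. *)
Lemma uniformly_cont_on (n m : nat) (A : set 'rV[R]_n) (f : 'rV[R]_n -> 'rV[R]_m) :
  compact A -> cont_on A f -> forall e, 0 < e ->
  exists2 d, 0 < d & forall x y, A x -> A y -> coord_close d x y ->
    forall l, `|f x 0 l - f y 0 l| < e.
Proof.
move=> /compact_near_coveringP cA fA e e0.
pose P (d : R) (x : 'rV[R]_n) := forall y, A x -> A y -> coord_close d x y ->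
    forall l, `|f x 0 l - f y 0 l| < e.
have e20 : 0 < e / 2 by rewrite divr_gt0.
have near0 : (\forall d \near (0:R)^'+, A `<=` P d)%classic.
  apply: cA => x Ax.
  have : (\forall y \near x, A y -> forall l, `|f x 0 l - f y 0 l| < e / 2)%classic.
    have := fA x Ax; move=> /(_ [set z | forall l, `|f x 0 l - z 0 l| < e / 2]%classic).
    rewrite /within /= /nbhs /=; apply.
    exists (fun _ l => [set r | `|f x 0 l - r| < e / 2]%classic).
      by move=> i l; rewrite ord1; exact: (nbhsx_ballx (f x 0 l) _ e20).
    by move=> z /= h l; exact: h.
  move/nbhs_ballP => [r /= r0 hr].
  have r20 : 0 < r / 2 by rewrite divr_gt0.
  exists ((ball x (r / 2)), [set d | 0 < d < r / 2])%classic.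
    split => /=; first exact: nbhsx_ballx.
    near=> d; apply/andP; split; near: d; [exact: nbhs_right_gt | exact: nbhs_right_lt].
  move=> [x' d] /= [bx /andP[d0 dr]] y Ax' Ay xy l.
  have h1 : `|f x 0 l - f x' 0 l| < e / 2.
    by apply: hr => //; apply: le_ball bx; rewrite ler_pdivrMr // ler_peMr ?ler1n // ltW.
  have h2 : `|f x 0 l - f y 0 l| < e / 2.
    apply: hr => //; rewrite [r]splitr; apply: ball_triangle bx _.
    split => // i k; rewrite ord1; apply: le_lt_trans dr.
    exact: (coord_closeP _ _ _ xy).
  have E : f x' 0 l - f y 0 l = (f x 0 l - f y 0 l) - (f x 0 l - f x' 0 l) by lra.
  rewrite (splitr e) E; by apply: le_lt_trans (ler_normB _ _) _; apply: ltrD.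
have [d [d0 Pd]] : exists d : R, 0 < d /\ (A `<=` P d)%classic.
  have : (\forall d \near (0:R)^'+, 0 < d /\ A `<=` P d)%classic.
    by near=> d; split; near: d => //; exact: nbhs_right_gt.
  by move/filter_ex => [d]; exists d.
by exists d => // x y Ax Ay; exact: Pd.
Unshelve. all: by end_near. Qed.

Lemma closed_cont_le (n : nat) (u v : 'rV[R]_n -> R) :
  continuous u -> continuous v -> closed [set x | u x <= v x]%classic.
Proof.
move=> cu cv; rewrite (_ : mkset _ = (fun x => v x - u x) @^-1` [set r | 0 <= r])%classic.
  apply: closed_comp; last exact: closed_ge.
  by move=> x _; apply: (@continuousB _ _ _ v u x); [exact: cv|exact: cu].
by apply/seteqP; split => x /=; rewrite subr_ge0.
Qed.

Lemma continuous_big_sum (T : topologicalType) (I : Type) (r : seq I) (u : I -> T -> R) :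
  (forall i, continuous (u i)) -> continuous (fun x => \sum_(i <- r) u i x).
Proof.
move=> h; elim: r => [|i r IH].
  have -> : (fun x => \sum_(i <- [::]) u i x) = cst 0 by apply/funext => x; rewrite big_nil.
  exact: cst_continuous.
have -> : (fun x => \sum_(i <- i :: r) u i x) = (u i \+ fun x => \sum_(i <- r) u i x).
  by apply/funext => x; rewrite big_cons.
by move=> x; apply: continuousD; [exact: h | exact: IH].
Qed.

Lemma closed_realized (m n : nat) (L : {set {set 'I_n}}) (downL : downset L)
    (phi : 'rV[R]_m -> 'rV[R]_n) : continuous phi ->
  closed [set w | realized L (phi w)]%classic.
Proof.
move=> cphi.
have cc l : continuous (fun w => phi w 0 l : R).
  move=> w; apply: (@continuous_comp _ _ _ phi (fun v : 'rV[R]_n => v 0 l) w) => //.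
    exact: cphi.
  exact: coord_continuous.
have cs : continuous (fun w => \sum_l phi w 0 l : R).
  exact: continuous_big_sum.
have c0 (c : R) : continuous (fun _ : 'rV[R]_m => c) by exact: cst_continuous.
have -> : [set w | realized L (phi w)]%classic =
    (\bigcup_(A in [set A : {set 'I_n} | A \in L]) [set w | simplex A (phi w)])%classic.
  apply/seteqP; split => w /=; first by case=> xL xs; exists (vsupp (phi w)).
  by case=> A /= AL xA; exact: realized_simplex xA.
apply: closed_bigcup => [|A AL]; first exact: finite_finset.
have -> : [set w | simplex A (phi w)]%classic =
   ((\bigcap_(l in [set: 'I_n]) [set w | 0 <= phi w 0 l]) `&`
   [set w | \sum_l phi w 0 l <= 1] `&` [set w | 1 <= \sum_l phi w 0 l] `&`
   (\bigcap_(l in [set l | l \notin A]) [set w | phi w 0 l <= 0]))%classic.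
  apply/seteqP; split => w /=.
    case/simplexP => h1 h2 /fintype.subsetP h3; split; last first.
      move=> l /=; apply: contraNT => h; apply: h3; rewrite inE.
      by apply: contraNneq h => ->.
    by split; [split => [l _|] | ]; rewrite /= ?h2.
  case=> -[[h1 h2] h3] h4; apply/simplexP; split.
  - by move=> l; exact: h1.
  - by apply/eqP; rewrite eq_le h2.
  - apply/fintype.subsetP => l; rewrite inE; apply: contraNT => lA.
    by rewrite eq_le h1 // andbT; exact: h4.
apply: closedI; last by apply: closed_bigI => l _; exact: closed_cont_le.
apply: closedI; last exact: closed_cont_le.
apply: closedI; last exact: closed_cont_le.
by apply: closed_bigI => l _; exact: closed_cont_le.
Qed.

Lemma compact_box (m : nat) (A : set 'rV[R]_m) : closed A ->
  (forall w, A w -> forall l, 0 <= w 0 l <= 1) -> compact A.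
Proof.
move=> cA h.
have := @rV_compact R m (fun=> `[0, 1]%classic) (fun=> @segment_compact R 0 1).
move/(subclosed_compact cA); apply => w /h hw l /=.
by rewrite in_itv /= hw.
Qed.

Lemma realized_box n (L : {set {set 'I_n}}) (x : 'rV[R]_n) l : realized L x -> 0 <= x 0 l <= 1.
Proof.
by case=> _ xs; rewrite (simplex_le1 l xs) andbT; case/simplexP: xs.
Qed.

Lemma compact_realized n (L : {set {set 'I_n}}) : downset L ->
  compact [set x : 'rV[R]_n | realized L x]%classic.
Proof.
move=> dL; apply: compact_box => [|x /= xL l]; last exact: realized_box xL.
apply: (@closed_realized n n L dL id) => w; exact: cvg_id.
Qed.

(** Coordinate 0 is the time of a homotopy, so one modulus of continuity controls time and space
    together. *)
Lemma compact_cylinder n (L : {set {set 'I_n}}) : downset L ->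
  compact [set w : 'rV[R]_(1 + n) | 0 <= w 0 0 <= 1 /\ realized L (rsubmx w)]%classic.
Proof.
move=> dL; apply: compact_box.
  have -> : [set w : 'rV[R]_(1 + n) | 0 <= w 0 0 <= 1 /\ realized L (rsubmx w)]%classic =
    ([set w : 'rV[R]_(1 + n) | 0 <= w 0 0] `&` [set w : 'rV[R]_(1 + n) | w 0 0 <= 1] `&`
      [set w : 'rV[R]_(1 + n) | realized L (rsubmx w)])%classic.
    apply/seteqP; split => w /=; first by case=> /andP[].
    by case=> -[-> ->].
  apply: closedI; last first.
    apply: closed_realized => // w; apply: (cvg_rV (nbhs_filter w)) => j.
    rewrite (_ : (fun x => rsubmx x 0 j) = fun x => x 0 (rshift 1 j)); last first.
      by apply/funext => v; rewrite mxE.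
    by rewrite mxE; exact: coord_continuous.
  by apply: closedI; apply: closed_cont_le;
    [exact: cst_continuous|exact: coord_continuous|exact: coord_continuous|exact: cst_continuous].
move=> w /= [w0 wL] l; have [l'|l'] := split_ordP l => ->.
  by rewrite (_ : lshift n l' = 0) //; apply: val_inj; rewrite /= ord1.
by have := realized_box l' wL; rewrite mxE.
Qed.

End Continuity.

(** * Contracting a punctured sphere and retracting onto a deletion *)

Section Sphere.
Context (R : realType) (d : nat).
Notation point := 'rV[R]_d.+1.
Implicit Types (u v p q : point).

Definition sqnorm v := \sum_j v 0 j ^+ 2.

Lemma sqnormZ (a : R) v : sqnorm (a *: v) = a ^+ 2 * sqnorm v.
Proof. by rewrite /sqnorm mulr_sumr; apply: eq_bigr => j _; rewrite mxE exprMn. Qed.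

Lemma sqnorm_ge0 v : 0 <= sqnorm v.
Proof. by apply: sumr_ge0 => j _; exact: sqr_ge0. Qed.

Lemma sqnorm_eq0 v : sqnorm v = 0 -> v = 0.
Proof.
move/eqP; rewrite psumr_eq0 => [/allP h|j _]; last exact: sqr_ge0.
apply/rowP => j; have := h j (mem_index_enum _).
by rewrite sqrf_eq0 mxE => /eqP.
Qed.

Definition normalize v := (Num.sqrt (sqnorm v))^-1 *: v.

Lemma normalize_sphere v : v != 0 -> sqnorm (normalize v) = 1.
Proof.
move=> v0; have s0 : sqnorm v != 0 by apply: contra_neq v0 => /sqnorm_eq0.
by rewrite sqnormZ exprVn sqr_sqrtr ?sqnorm_ge0 // mulVf.
Qed.

Lemma normalize_id v : sqnorm v = 1 -> normalize v = v.
Proof. by rewrite /normalize => ->; rewrite sqrtr1 invr1 scale1r. Qed.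

(* The segment from u to -p, which meets the ray of p only if u = p. *)
Definition push (t : R) u p := (1 - t) *: u - t *: p.

(** If [(1 - t) u = t p], comparing norms gives [1 - t = t], which is nonzero, and then [u = p]. *)
Lemma push_neq0 t u p : sqnorm u = 1 -> sqnorm p = 1 -> u != p -> 0 <= t <= 1 ->
  push t u p != 0.
Proof.
move=> u1 p1 up /andP[t0 t1]; apply: contra up; rewrite subr_eq0 => /eqP e.
have := congr1 sqnorm e; rewrite !sqnormZ u1 p1 !mulr1 => e2.
have e3 : 1 - t = t.
  by apply/eqP; rewrite -(@eqrXn2 _ 2) //; [apply/eqP | rewrite subr_ge0].
have tN0 : t != 0 by apply: contra_eq_neq e3 => ->; rewrite subr0 oner_eq0.
by apply/eqP; apply: (scalerI tN0); rewrite -[in LHS]e3 e.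
Qed.

(** If the push is a positive multiple [s p], then [(1 - t) u = (t + s) p], and comparing norms
    gives [u = p]. *)
Lemma normalize_push_neq t u p : sqnorm u = 1 -> sqnorm p = 1 -> u != p -> 0 <= t <= 1 ->
  normalize (push t u p) != p.
Proof.
move=> u1 p1 up t01; have := push_neq0 u1 p1 up t01.
case/andP: t01 => t0 t1 v0; apply: contra up => /eqP e.
set v := push t u p in v0 e.
have s0 : 0 < Num.sqrt (sqnorm v).
  by rewrite sqrtr_gt0 lt_neqAle sqnorm_ge0 andbT eq_sym; apply: contra_neq v0 => /sqnorm_eq0.
set s := Num.sqrt _ in s0.
have e1 : v = s *: p by rewrite -e /normalize scalerA -/s mulfV ?scale1r // gt_eqF.
have e2 : (1 - t) *: u = (t + s) *: p.
  by rewrite [RHS]scalerDl -e1 /v /push [RHS]addrC subrK.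
have := congr1 sqnorm e2; rewrite !sqnormZ u1 p1 !mulr1 => e3.
have e4 : 1 - t = t + s.
  by apply/eqP; rewrite -(@eqrXn2 _ 2) //; [apply/eqP | rewrite subr_ge0 | rewrite addr_ge0 // ltW].
have tN0 : t + s != 0 by rewrite gt_eqF // ltr_wpDl.
by apply/eqP; apply: (scalerI tN0); rewrite -[in LHS]e4 e2.
Qed.

Lemma cont_normalize (T : topologicalType) (A : set T) (f : T -> point) :
  (forall x, A x -> f x != 0) -> cont_on A f -> cont_on A (normalize \o f).
Proof.
move=> f0 cf; apply: cont_rV => j.
have -> : (fun x => (normalize \o f) x 0 j) =
    (fun x => (Num.sqrt (\sum_k f x 0 k ^+ 2))^-1 * f x 0 j).
  by apply/funext => x; rewrite /= mxE.
apply: contM; last exact: cont_coord.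
apply: contV => [x Ax|].
  rewrite gt_eqF // sqrtr_gt0 lt_neqAle sqnorm_ge0 andbT eq_sym.
  by apply: contra_neq (f0 x Ax) => /sqnorm_eq0.
apply: cont_sqrt; apply: cont_sum => k.
have -> : (fun x => f x 0 k ^+ 2) = (fun x => f x 0 k * f x 0 k).
  by apply/funext => x; rewrite expr2.
by apply: contM; exact: cont_coord.
Qed.

End Sphere.

Section Retraction.
Context (R : realType) (n : nat) (K : {set {set 'I_n}}) (downK : downset K).
Context (G : {set 'I_n}) (G0 : G != finset.set0).
Notation point := 'rV[R]_n.
Implicit Types (x y : point).

Definition barycenter : point := \row_l ((l \in G)%:R / #|G|%:R).

(** The default 1 never interferes on a nonempty [s], since the coordinates of realized points are
    at most 1. *)
Definition mincoord (s : seq 'I_n) y : R := \big[Num.min/1]_(l <- s) y 0 l.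

Lemma mincoord_le s y l : l \in s -> mincoord s y <= y 0 l.
Proof.
rewrite /mincoord; elim: s => //= k s IH; rewrite inE big_cons ge_min => /orP[/eqP->|/IH->].
  by rewrite lexx.
by rewrite orbT.
Qed.

Lemma mincoord_attained s y : (forall l, y 0 l <= 1) -> s != [::] ->
  exists2 l, l \in s & y 0 l = mincoord s y.
Proof.
move=> y1; rewrite /mincoord; elim: s => //= k s IH _; rewrite big_cons.
have [->|/IH[l ls yl]] := eqVneq s [::].
  by exists k; rewrite ?mem_head // big_nil min_l.
case: (leP (y 0 k) (\big[Num.min/1]_(l <- s) y 0 l)) => h.
  by exists k; rewrite ?mem_head.
by exists l; rewrite // inE ls orbT.
Qed.

Lemma cont_mincoord (A : set point) s : cont_on A (mincoord s).
Proof.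
elim: s => [|l s IH].
  rewrite (_ : mincoord [::] = fun=> 1); first exact: cont_cst.
  by apply/funext => y; rewrite /mincoord big_nil.
rewrite (_ : mincoord (l :: s) = fun y => Num.min (y 0 l) (mincoord s y)).
  by apply: cont_min => //; exact: cont_proj.
by apply/funext => y; rewrite /mincoord big_cons.
Qed.

Notation mu := (mincoord (enum G)).

(* Remove from y the largest multiple of the indicator of G that leaves nonnegative
   coordinates, and renormalize. *)
Definition retract y : point := \row_l ((y 0 l - mu y * (l \in G)%:R) / (1 - #|G|%:R * mu y)).

Lemma sum_indicator (c : R) : \sum_l c * (l \in G)%:R = #|G|%:R * c.
Proof.
rewrite -mulr_sumr mulrC; congr (_ * _).
rewrite (eq_bigr (fun l => if l \in G then 1 else 0)); last by move=> l _; case: (l \in G).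
by rewrite -big_mkcond sumr_const.
Qed.

Lemma cardG_gt0 : 0 < #|G|%:R :> R.
Proof. by rewrite ltr0n card_gt0. Qed.

(** [#|G| * mu y] is at most the coordinate sum 1, with equality only when [y] is constant on [G]
    and 0 off [G]. *)
Lemma retract_denom y : realized K y -> y != barycenter -> 0 < 1 - #|G|%:R * mu y.
Proof.
case=> _ /simplexP[y0 y1 _] yb; rewrite subr_gt0 lt_neqAle; apply/andP; split.
  apply: contra yb => /eqP e.
  have z l : y 0 l - mu y * (l \in G)%:R = 0.
    have : \sum_k (y 0 k - mu y * (k \in G)%:R) = 0.
      by rewrite sumrB sum_indicator y1 e subrr.
    move/eqP; rewrite psumr_eq0 => [/allP/(_ l (mem_index_enum _))/eqP//|k _].
    case kG: (k \in G); last by rewrite mulr0 subr0.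
    by rewrite mulr1 subr_ge0 mincoord_le // mem_enum.
  apply/eqP/rowP => l; rewrite mxE; have /eqP := z l; rewrite subr_eq0 => /eqP ->.
  rewrite mulrC; congr (_ * _); apply/eqP.
  by rewrite -(inj_eq (mulfI (lt0r_neq0 cardG_gt0))) e mulfV // lt0r_neq0 // cardG_gt0.
rewrite -sum_indicator -[leRHS]y1; apply: ler_sum => l _.
case lG: (l \in G); last by rewrite mulr0.
by rewrite mulr1 mincoord_le // mem_enum.
Qed.

Lemma mincoord_ge0 y : realized K y -> 0 <= mu y.
Proof.
case=> _ ys; have [y0 y1 _] := simplexP _ _ ys.
have [|l _ <-] := @mincoord_attained (enum G) y (fun l => simplex_le1 l ys); last exact: y0.
by rewrite -size_eq0 -cardE cards_eq0.
Qed.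

Lemma retract_realized y : realized K y -> y != barycenter ->
  realized (deletion K G) (retract y).
Proof.
move=> yK yb; have c0 := retract_denom yK yb.
have [yL ys] := yK; have [y0 y1 _] := simplexP _ _ ys.
have [|l0 l0G yl0] := @mincoord_attained (enum G) y (fun l => simplex_le1 l ys).
  by rewrite -size_eq0 -cardE cards_eq0.
rewrite mem_enum in l0G.
have sub : vsupp (retract y) \subset vsupp y.
  apply/fintype.subsetP => l; rewrite !inE mxE; apply: contraNneq => yl.
  have m0 : mu y * (l \in G)%:R = 0.
    case lG: (l \in G); last by rewrite mulr0.
    have : mu y <= 0 by rewrite -yl mincoord_le // mem_enum.
    by rewrite mulr1 => h; apply/eqP; rewrite eq_le h mincoord_ge0.
  by rewrite yl m0 subrr mul0r.
have l0N : l0 \notin vsupp (retract y).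
  by rewrite inE negbK mxE l0G yl0 mulr1 subrr mul0r.
split.
  rewrite !inE (downK yL sub) /=; apply: contra l0N => /fintype.subsetP; exact.
apply/simplexP; split => //.
- move=> l; rewrite mxE divr_ge0 ?(ltW c0) //.
  case lG: (l \in G); last by rewrite mulr0 subr0.
  by rewrite mulr1 subr_ge0 mincoord_le // mem_enum.
- under eq_bigr => l _ do rewrite mxE.
  by rewrite -mulr_suml sumrB sum_indicator y1 divff // gt_eqF.
Qed.

Lemma retract_id y : realized (deletion K G) y -> retract y = y.
Proof.
case=> yL ys; move: yL; rewrite !inE => /andP[yK /fintype.subsetPn[l lG]].
rewrite inE negbK => /eqP yl.
have m0 : mu y = 0.
  apply/eqP; rewrite eq_le mincoord_ge0 // andbT -yl mincoord_le // mem_enum //.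
by apply/rowP => k; rewrite mxE m0 mul0r mulr0 !subr0 divr1.
Qed.

Lemma barycenter_realized : G \in K -> realized K barycenter.
Proof.
move=> GK; apply: (realized_simplex downK GK); apply/simplexP; split.
- by move=> l; rewrite mxE divr_ge0.
- under eq_bigr => l _ do rewrite mxE mulrC.
  by rewrite sum_indicator mulfV // lt0r_neq0 // cardG_gt0.
- apply/fintype.subsetP => l; rewrite inE mxE.
  by case: (l \in G) => //; rewrite mul0r eqxx.
Qed.

Lemma deletion_neq_barycenter y : realized (deletion K G) y -> y != barycenter.
Proof.
case=> + _; rewrite inE => /andP[_ h]; apply: contraNneq h => ->.
apply/fintype.subsetP => l lG; rewrite inE mxE lG mul1r invr_eq0.
by rewrite lt0r_neq0 // cardG_gt0.
Qed.

Lemma realized_deletion y : realized (deletion K G) y -> realized K y.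
Proof. by case; rewrite inE => /andP[]. Qed.

Lemma cont_retract :
  cont_on [set y : point | realized K y /\ y != barycenter]%classic retract.
Proof.
apply: cont_rV => l.
set A := mkset _.
have -> : (fun y => retract y 0 l) =
    (fun y => (y 0 l - mu y * (l \in G)%:R) * (1 - #|G|%:R * mu y)^-1).
  by apply/funext => y; rewrite mxE.
apply: contM.
  apply: contB; first exact: cont_proj.
  by apply: contM; [exact: cont_mincoord | exact: cont_cst].
apply: contV => [y [yK yb]|]; first by rewrite gt_eqF // retract_denom.
apply: contB; first exact: cont_cst.
by apply: contM; [exact: cont_cst | exact: cont_mincoord].
Qed.

End Retraction.

Section SphereDeletion.
Context (F : fieldType) (ch2 : forall x : F, x + x = 0).
Context (R : realType) (d n : nat) (K : {set {set 'I_n}}) (downK : downset K).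
Context (f : 'rV[R]_n -> 'rV[R]_d.+1) (g : 'rV[R]_d.+1 -> 'rV[R]_n).
Context (fS : forall x, realized K x -> sqnorm (f x) = 1).
Context (gK : forall y, sqnorm y = 1 -> realized K (g y)).
Context (gf : forall x, realized K x -> g (f x) = x).
Context (fg : forall y, sqnorm y = 1 -> f (g y) = y).
Context (cf : cont_on [set x | realized K x]%classic f).
Context (cg : cont_on [set y | sqnorm y = 1]%classic g).

(** The puncture is [p = f b], with [b] the barycenter of [G]. Pushing towards [- p] avoids [p], so
    its transport to [K] avoids [b], and [retract] brings it back to the deletion: a homotopy from
    the identity to a constant. *)
Lemma deletion_contracts G : G \in K -> G != finset.set0 -> contracts F (deletion K G).
Proof.
move=> GK G0; set L := deletion K G; set b : 'rV[R]_n := barycenter R G.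
have bK : realized K b by exact: barycenter_realized.
have [l0 l0G] : exists l, l \in G by apply/set0Pn.
have downL : downset L by exact: deletion_down.
pose p := f b; have p1 : sqnorm p = 1 by exact: fS.
pose C := [set w : 'rV[R]_(1 + n) | 0 <= w 0 0 <= 1 /\ realized L (rsubmx w)]%classic.
pose N (w : 'rV[R]_(1 + n)) := normalize (push (w 0 0) (f (rsubmx w)) p).
pose H w := retract G (g (N w)).
have LK (x : 'rV[R]_n) : realized L x -> realized K x by exact: realized_deletion.
have fN (x : 'rV[R]_n) : realized L x -> f x != p.
  move=> xL; apply: contraNneq (deletion_neq_barycenter G0 xL) => e.
  by rewrite -(gf (LK _ xL)) e gf.
have push0 w : C w -> push (w 0 0) (f (rsubmx w)) p != 0.
  by case=> t01 xL; apply: push_neq0 => //; [exact/fS/LK | exact: fN].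
have N1 w : C w -> sqnorm (N w) = 1.
  by move=> Cw; apply: normalize_sphere; exact: push0.
have gN w : C w -> realized K (g (N w)) /\ g (N w) != b.
  move=> Cw; split; first exact/gK/N1.
  case: (Cw) => t01 xL.
  have := normalize_push_neq (fS (LK _ xL)) p1 (fN _ xL) t01.
  by apply: contra_neq => e; rewrite -[LHS](fg (N1 _ Cw)) e.
have HL w : C w -> realized L (H w) by case/gN => *; exact: retract_realized.
have cH : cont_on C H.
  rewrite (_ : H = retract G \o (g \o N)) //.
  apply: (@cont_comp _ _ _ C [set y : 'rV[R]_n | realized K y /\ y != b]%classic
    (g \o N) (retract G)); [exact: gN | | exact: cont_retract].
  apply: (@cont_comp _ _ _ C [set y : 'rV[R]_d.+1 | sqnorm y = 1]%classic N g) => //.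
  rewrite (_ : N = @normalize R d \o (fun w : 'rV[R]_(1 + n) => push (w 0 0) (f (rsubmx w)) p)) //.
  apply: cont_normalize; first exact: push0.
  apply: cont_rV => j.
  have -> : (fun w : 'rV[R]_(1 + n) => push (w 0 0) (f (rsubmx w)) p 0 j) =
     (fun w => (1 - w 0 0) * f (rsubmx w) 0 j - w 0 0 * p 0 j).
    by apply/funext => w; rewrite !mxE.
  apply: contB; apply: contM.
  - by apply: contB; [exact: cont_cst | exact: cont_proj].
  - apply: cont_coord; rewrite (_ : (fun w : 'rV[R]_(1 + n) => f (rsubmx w)) = f \o rsubmx) //.
    apply: (@cont_comp _ _ _ C [set x | realized K x]%classic rsubmx f) => //;
      first by move=> w [_ /LK].
    apply: cont_rV => k.
    rewrite (_ : (fun x => rsubmx x 0 k) = fun x => x 0 (rshift 1 k)); first exact: cont_proj.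
    by apply/funext => v; rewrite mxE.
  - exact: cont_proj.
  - exact: cont_cst.
have n0 : 0 < n%:R^-1 :> R by rewrite invr_gt0 ltr0n; case: (n) l0 {l0G} => // -[].
have [delta delta0 unif] := uniformly_cont_on (compact_cylinder downL) cH n0.
(* Time is cut into [M] steps of length at most [delta], so that consecutive stages are close. *)
pose M := (Num.truncn delta^-1).+1.
have M0 : 0 < M%:R :> R by rewrite ltr0n.
have Md : M%:R^-1 <= delta.
  rewrite invf_ple ?posrE //; apply: ltW; apply: real_truncnS_gt; exact: num_real.
pose row i (x : 'rV[R]_n) : 'rV[R]_(1 + n) := row_mx (const_mx (i%:R / M%:R)) x.
have row0 i (x : 'rV[R]_n) : row i x 0 0 = i%:R / M%:R.
  have -> : (0 : 'I_(1 + n)) = lshift n 0 by apply: val_inj.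
  by rewrite row_mxEl mxE.
have rowC i (x : 'rV[R]_n) : (i <= M)%N -> realized L x -> C (row i x).
  move=> iM xL; split; last by rewrite row_mxKr.
  by rewrite row0 divr_ge0 //= ler_pdivrMr // mul1r ler_nat.
apply: (@contracts_null_homotopic F ch2 R n l0 L downL M
   (fun i x => H (row i x)) delta delta0 _ _ _ (retract G (g (normalize (- p))))).
- move=> x xL; rewrite /H /N row0 row_mxKr mul0r /push subr0 scale1r scale0r subr0.
  rewrite normalize_id; last exact/fS/LK.
  by rewrite gf; [apply: (retract_id (K := K)) | exact: LK].
- by move=> i x iM xL; exact/HL/rowC.
- move=> i j x y iM jM ij xL yL /coord_closeP xy l; apply: unif; try exact: rowC.
  apply/coord_closeP => k; have [k'|k'] := split_ordP k => ->.
    rewrite !row_mxEl !mxE -mulrBl; apply: le_trans Md.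
    rewrite normrM [`|_^-1|]ger0_norm ?invr_ge0 // ler_piMl ?invr_ge0 //.
    case: ij => ->; first by rewrite subrr normr0.
    by rewrite -natr1 opprD addrA subrr sub0r normrN normr1.
  by rewrite !row_mxEr.
(* The deletion has a realized point: the retraction of the point antipodal to [p], as [- p] differs
   from [p]. *)
- suff : exists x : 'rV[R]_n, realized L x.
    case=> x xL; have := HL _ (rowC M x (leqnn _) xL).
    rewrite /H /N row0 row_mxKr divff; last by rewrite gt_eqF.
    by rewrite /push subrr scale0r scale1r sub0r; apply.
  exists (retract G (g (- p))); apply: retract_realized => //.
    by apply: gK; rewrite -scaleN1r sqnormZ sqrrN expr1n mul1r.
  apply/eqP => e; have : f (g (- p)) = f b by rewrite e.
  rewrite fg -/p; last by rewrite -scaleN1r sqnormZ sqrrN expr1n mul1r.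
  move=> pp; have p0 : p = 0.
    by apply/rowP => j; have := congr1 (fun v : 'rV[R]_d.+1 => v 0 j) pp; rewrite /= !mxE; lra.
  move: p1; rewrite p0 /sqnorm big1 => [/eqP|j _]; first by rewrite eq_sym oner_eq0.
  by rewrite mxE expr0n.
- move=> x xL; rewrite /H /N row0 row_mxKr divff ?gt_eqF //.
  by rewrite /push subrr scale0r scale1r sub0r.
Qed.

End SphereDeletion.

(** * Covering dimension *)

Section Rounding.
Context (R : realType) (n : nat) (N : nat) (N0 : (0 < N)%N).
Notation point := 'rV[R]_n.
Implicit Types (x y : point) (u : R) (i : nat).

Definition psum y i : R := N%:R * \sum_(l < n | (l < i)%N) y 0 l.

Definition rnd u y i : int := Num.floor (psum y i + u).

(* Rounding partial sums keeps the total equal to 1, and u shifts the breakpoints of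
   the rounding. *)
Definition round u y : point := \row_l ((rnd u y l.+1 - rnd u y l)%:~R / N%:R).

Lemma psum0 y : psum y 0 = 0.
Proof. by rewrite /psum big1 ?mulr0 // => l; rewrite ltn0. Qed.

Lemma psum_n y A : simplex A y -> psum y n = N%:R.
Proof.
case/simplexP => _ y1 _; rewrite /psum -[RHS]mulr1 -y1; congr (_ * _).
by apply: eq_bigl => l; rewrite ltn_ord.
Qed.

Lemma psumS y (l : 'I_n) : psum y l.+1 = psum y l + N%:R * y 0 l.
Proof.
rewrite /psum -mulrDr (bigD1 l) //= addrC; congr (_ * (_ + _)).
by apply: eq_bigl => k; rewrite ltnS [RHS]ltn_neqAle andbC -val_eqE.
Qed.

Let Npos : 0 < N%:R :> R. Proof. by rewrite ltr0n. Qed.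

(** The rounded partial sums run from [floor u = 0] to [floor (N + u) = N], so the total is exact. A
    zero coordinate repeats a partial sum and stays 0. *)
Lemma round_simplex u y A : 0 < u < 1 -> simplex A y -> simplex A (round u y).
Proof.
move=> /andP[u0 u1] yA; have [y0 y1 ys] := simplexP _ _ yA; apply/simplexP; split.
- move=> l; rewrite mxE divr_ge0 // ler0z subr_ge0 le_floor // lerD2r psumS lerDl.
  by rewrite mulr_ge0.
- under eq_bigr => l _ do rewrite mxE.
  have tel : \sum_(l < n) (rnd u y l.+1 - rnd u y l) = rnd u y n - rnd u y 0.
    by rewrite -(big_mkord xpredT (fun l => rnd u y l.+1 - rnd u y l)) telescope_sumr.
  rewrite -mulr_suml -raddf_sum /= tel /rnd psum0 (psum_n yA) add0r.
  have -> : Num.floor u = 0 by apply: floor_def; rewrite add0r u1 ltW.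
  have -> : Num.floor (N%:R + u) = N%:Z.
    by apply: floor_def; rewrite intrD lerDl ltrD2l u1 ltW.
  by rewrite subr0 divff // gt_eqF.
- apply: fintype.subset_trans ys; apply/fintype.subsetP => l; rewrite !inE mxE.
  apply: contraNneq => yl.
  by rewrite /rnd psumS yl mulr0 addr0 subrr mul0r.
Qed.

Lemma floorB_lt (a b : R) : `|(Num.floor b - Num.floor a)%:~R - (b - a)| < 1.
Proof.
have /andP[a1 a2] := floor_itv a; have /andP[b1 b2] := floor_itv b.
move: a2 b2; rewrite !intrD => a2 b2; rewrite mulrNz ltr_norml.
set fa := (Num.floor a)%:~R in a1 a2 *; set fb := (Num.floor b)%:~R in b1 b2 *.
by apply/andP; split; lra.
Qed.

Lemma round_close u y l : `|round u y 0 l - y 0 l| < N%:R^-1.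
Proof.
have := floorB_lt (psum y l + u) (psum y l.+1 + u).
rewrite -/(rnd u y l.+1) -/(rnd u y l) mxE psumS => h.
rewrite -(ltr_pM2l Npos) divff ?gt_eqF //.
rewrite -[X in X * `|_|](gtr0_norm Npos) -normrM mulrBr mulrCA divff ?gt_eqF // mulr1.
by apply: le_lt_trans h; rewrite le_eqVlt; apply/orP; left; apply/eqP; congr `|_|; lra.
Qed.

Lemma floor_near (a b eta : R) : `|a - b| < eta -> (forall m : int, eta <= `|b - m%:~R|) ->
  Num.floor a = Num.floor b.
Proof.
move=> ab hb; apply: floor_def; have /andP[b1 b2] := floor_itv b.
have h1 := hb (Num.floor b); have h2 := hb (Num.floor b + 1).
move: h2 b2; rewrite !intrD; set fb := (Num.floor b)%:~R in b1 h1 * => h2 b2.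
move: ab h1 h2; rewrite (ger0_norm (x := b - fb)) ?subr_ge0 //.
rewrite (ltr0_norm (x := b - _)) ?subr_lt0 // ltr_norml => /andP[ab1 ab2] h1 h2.
by apply/andP; split; lra.
Qed.

Context (e : nat) (e0 : (0 < e)%N).

(* A point with support of size at most e has at most e - 1 distinct nonintegral partial
   sums, each close to a breakpoint for at most one of the e shifts [cand j]: some shift is
   good, meaning that the rounding is locally constant. *)
Definition cand (j : 'I_e) : R := j.+1%:R / e.+1%:R.

(** Half the spacing [1 / e.+1] of 0 and the points [cand j] on the circle of reals modulo 1. *)
Definition eta : R := (2 * e.+1%:R)^-1.

Definition good j y := forall i (m : int), (i <= n)%N -> eta <= `|psum y i + cand j - m%:~R|.

Lemma cand_itv j : 0 < cand j < 1.
Proof.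
rewrite /cand divr_gt0 ?ltr0n //= ltr_pdivrMr ?ltr0n // mul1r ltr_nat.
by rewrite ltnS.
Qed.

Lemma eta_gt0 : 0 < eta. Proof. by rewrite invr_gt0 mulr_gt0 ?ltr0n. Qed.

Lemma cand_gap j k (m : int) : j != k -> 2 * eta <= `|cand j - cand k - m%:~R|.
Proof.
move=> jk; have E : 0 < e.+1%:R :> R by rewrite ltr0n.
have -> : 2 * eta = e.+1%:R^-1 by rewrite /eta invfM mulrA divff ?mul1r // pnatr_eq0.
rewrite -(ler_pM2r E) mulVf ?gt_eqF // -[X in _ * X](gtr0_norm E) -normrM.
have -> : (cand j - cand k - m%:~R) * e.+1%:R = (j.+1%:Z - k.+1%:Z - m * e.+1%:Z)%:~R.
  rewrite !intrD !mulrNz intrM !mulrBl /cand !divfK ?gt_eqF //.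
rewrite -intr_norm ler1z -gtz0_ge1 normr_gt0; apply/eqP => h.
have jE := ltn_ord j; have kE := ltn_ord k.
have : (j.+1 = k.+1 %[mod e.+1])%Z.
  apply/eqP; rewrite eqz_mod_dvd; apply/dvdzP; exists m; apply/eqP; rewrite -subr_eq0; apply/eqP.
  exact: h.
rewrite !modz_small ?ltz_nat ?ltnS ?andbT // => -[] /val_inj jk'.
by rewrite jk' eqxx in jk.
Qed.

Lemma exists_good y A : simplex A y -> (#|A| <= e)%N -> exists j, good j y.
Proof.
move=> yA Ae; apply: contrapT => none.
have bad j : exists i, (i <= n)%N /\ exists m : int, `|psum y i + cand j - m%:~R| < eta.
  apply: contrapT => h; apply: none; exists j => i m iN; rewrite leNgt; apply/negP => hm.
  by apply: h; exists i; split => //; exists m.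
have /choice [i0 i0P] := bad.
(* A partial sum depends only on how many elements of [A] precede the index. *)
pose rank i := #|[set l in A | (l < i)%N]|.
have rank_psum i i' : rank i = rank i' -> psum y i = psum y i'.
  wlog ii' : i i' / (i <= i')%N.
    by move=> H; case/orP: (leq_total i i') => h e1; [exact: H | apply/esym/H].
  move=> e1; rewrite /psum; congr (_ * _).
  have sub : [set l in A | (l < i)%N] \subset [set l in A | (l < i')%N].
    apply/fintype.subsetP => l; rewrite !inE => /andP[->] h; exact: leq_trans h ii'.
  have eqs : [set l in A | (l < i)%N] = [set l in A | (l < i')%N].
    by apply/eqP; rewrite eqEcard sub -[X in (X <= _)%N]/(rank i') -e1 leqnn.
  case/simplexP: yA => _ _ /fintype.subsetP yA.
  rewrite (bigID (mem A)) [RHS](bigID (mem A)) /=; congr (_ + _).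
    apply: eq_bigl => l; have := congr1 (fun X : {set 'I_n} => l \in X) eqs.
    by rewrite !inE andbC => ->; rewrite andbC.
  have z l : l \notin A -> y 0 l = 0.
    by move=> lA; apply/eqP; apply: contraNT lA => yl; apply: yA; rewrite inE.
  by rewrite !big1 // => l /andP[_ /z].
(* At ranks 0 and [#|A|] the partial sum is an integer, 0 or [N], and every shift is at least
   [2 * eta] away from the integers. *)
have rank_in j : (0 < rank (i0 j) < #|A|)%N.
  have [iN [m hm]] := i0P j.
  have nint (k : int) : psum y (i0 j) != k%:~R.
    apply/eqP => pk; move: hm; rewrite pk => hm.
    have /andP[c0 c1] := cand_itv j.
    have := eta_gt0; have jE := ltn_ord j.
    have l1 : e.+1%:R^-1 <= cand j by rewrite /cand ler_peMl ?invr_ge0 // ler1n.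
    have l2 : cand j <= 1 - e.+1%:R^-1.
      rewrite lerBrDr /cand -[X in _ + X]mul1r -mulrDl ler_pdivrMr ?ltr0n //.
      by rewrite mul1r natr1 ler_nat.
    have E2 : e.+1%:R^-1 = 2 * eta by rewrite /eta invfM mulrA divff ?mul1r // pnatr_eq0.
    rewrite E2 in l1 l2; move=> h0.
    have : `|(k - m)%:~R + cand j| < eta.
      by apply: le_lt_trans hm; rewrite intrD mulrNz addrAC.
    set q := k - m; have [q0|[q0|q0]] : q = 0 \/ 1 <= q \/ q <= -1.
        by case: (ltrgtP q 0) => h; [right; right|right; left|left]; lia.
    + by rewrite q0 add0r ltr_norml => /andP[]; lra.
    + have : 1 <= q%:~R :> R by rewrite ler1z.
      by rewrite ltr_norml => ? /andP[]; lra.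
    + have : q%:~R <= -1 :> R by rewrite -[-1](mulrN1z 1) -(mulrNz 1 1) ler_int.
      by rewrite ltr_norml => ? /andP[]; lra.
  have r0 : rank 0 = 0%N.
    by apply/eqP; rewrite cards_eq0; apply/eqP/setP => l; rewrite !inE ltn0 andbF.
  have rn : rank n = #|A| by apply: eq_card => l; rewrite !inE ltn_ord andbT.
  rewrite lt0n ltn_neqAle; apply/and3P; split.
  - by apply/eqP => h; have := nint 0; rewrite (rank_psum _ 0%N) ?psum0 ?eqxx // h r0.
  - by apply/eqP => h; have := nint N%:Z; rewrite (rank_psum _ n) ?(psum_n yA) ?eqxx // h rn.
  - by apply: subset_leq_card; apply/fintype.subsetP => l; rewrite inE => /andP[].
(* Two bad shifts at the same partial sum would be closer than [2 * eta] modulo 1. So [e] distinct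
   ranks would lie among the [e.-1] values from 1 to [e.-1]. *)
have inj : injective (fun j => rank (i0 j)).
  move=> j k /rank_psum ejk; apply/eqP; apply: contraT => jk.
  have [_ [m hm]] := i0P j; have [_ [m' hm']] := i0P k.
  have := cand_gap (m - m') jk; rewrite leNgt => /negP[].
  rewrite intrD mulrNz (_ : _ - _ =
    (psum y (i0 j) + cand j - m%:~R) - (psum y (i0 k) + cand k - m'%:~R)).
    by apply: le_lt_trans (ler_normB _ _) _; move: hm hm'; lra.
  by rewrite ejk; lra.
have /uniq_leq_size : uniq [seq rank (i0 j) | j <- enum 'I_e] by rewrite map_inj_uniq ?enum_uniq.
move/(_ (iota 1 e.-1)); rewrite size_map -cardE card_ord size_iota => H.
suff : (e <= e.-1)%N by rewrite leqNgt prednK // leqnn.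
apply: H => _ /mapP[j _ ->]; rewrite mem_iota add1n prednK //.
have /andP[-> h] := rank_in j; exact: leq_trans h Ae.
Qed.

Lemma good_round j x y : good j y ->
  (forall i, (i <= n)%N -> `|psum x i - psum y i| < eta) ->
  round (cand j) x = round (cand j) y.
Proof.
move=> gy xy; apply/rowP => l; rewrite !mxE; congr (_ / _); congr (_%:~R).
have E i : (i <= n)%N -> rnd (cand j) x i = rnd (cand j) y i.
  move=> iN; apply: (@floor_near _ _ eta).
    by rewrite opprD addrACA subrr addr0; exact: xy.
  by move=> m; exact: gy.
by rewrite !E // ltnW.
Qed.

Lemma psum_close delta x y i : coord_close delta x y -> 0 <= delta ->
  `|psum x i - psum y i| <= N%:R * (n%:R * delta).
Proof.
move=> /coord_closeP xy d0; rewrite /psum -mulrBr normrM ger0_norm // ler_wpM2l //.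
rewrite -sumrB; apply: le_trans (ler_norm_sum _ _ _) _.
apply: (@le_trans _ _ (\sum_(l < n | (l < i)%N) delta)); first by apply: ler_sum.
rewrite sumr_const -[leLHS]mulr_natl ler_wpM2r // ler_nat.
by rewrite (leq_trans (max_card _)) ?card_ord.
Qed.

End Rounding.

(** * Invariance of dimension for top cycles *)

Section Dimension.
Context (F : fieldType) (ch2 : forall x : F, x + x = 0) (R : realType) (n m e : nat).
Notation chain := {ffun {set 'I_n} -> F}.
Context (K : {set {set 'I_n}}) (downK : downset K) (L : {set {set 'I_m}}) (downL : downset L).
Context (f : 'rV[R]_n -> 'rV[R]_m) (g : 'rV[R]_m -> 'rV[R]_n).
Context (fL : forall x, realized K x -> realized L (f x)).
Context (gK : forall y, realized L y -> realized K (g y)).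
Context (gf : forall x, realized K x -> g (f x) = x).
Context (cf : cont_on [set x | realized K x]%classic f).
Context (cg : cont_on [set y | realized L y]%classic g).
Context (e0 : (0 < e)%N) (Le : forall A, A \in L -> (#|A| <= e)%N).

(* f followed by a rounding in |L| takes at most e values on any small set, so an
   approximation of the identity of |K| factors through labels that degenerate on
   simplices with more than e vertices. *)
Lemma cycle_vanishes (c : chain) k (A : {set 'I_n}) :
  (forall B, c B != 0 -> B \in K /\ #|B| = k) -> bd c = 0 -> (e < k)%N ->
  (forall v, v \notin A -> v |: A \notin K) -> c A = 0.
Proof.
move=> cK bc ek maxA; apply/eqP/negPn/negP => cA.
have [AK Ak] := cK A cA.
have [l0 l0A] : exists l, l \in A by apply/card_gt0P; rewrite Ak (leq_trans _ ek).
have n0 : 0 < n%:R^-1 :> R by rewrite invr_gt0 ltr0n; case: (n) l0 {l0A} => // -[].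
(* Comparing [h 1 x] with [h 1 y] involves three errors: two from rounding and one from the distance
   between [x] and [y]. *)
pose eps : R := n%:R^-1 / 3; have eps0 : 0 < eps by rewrite divr_gt0.
have [dg dg0 ug] := uniformly_cont_on (compact_realized downL) cg eps0.
pose N := (Num.truncn dg^-1).+1.
have N0 : (0 < N)%N by [].
have NR : 0 < N%:R :> R by rewrite ltr0n.
have Nd : N%:R^-1 <= dg.
  rewrite invf_ple ?posrE //; apply: ltW; apply: real_truncnS_gt; exact: num_real.
(* Chosen so that [N * m * th < eta]: changing each coordinate by at most [th] moves every partial
   sum by less than [eta]. *)
pose th : R := eta R e / (N%:R * m.+1%:R).
have th0 : 0 < th by rewrite divr_gt0 ?eta_gt0 // mulr_gt0 ?ltr0n.
have [df df0 uf] := uniformly_cont_on (compact_realized downK) cf th0.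
pose delta := Num.min df eps.
have delta0 : 0 < delta by rewrite lt_min df0.
have j0 : 'I_e by exact: Ordinal e0.
have /choice [J JP] : forall y : 'rV[R]_m, exists j : 'I_e, realized L y -> good N j y.
  move=> y; have [yL|?] := pselect (realized L y); last by exists j0.
  have [yL' ys] := yL; have [j gj] := exists_good N0 e0 ys (Le yL').
  by exists j.
pose nu y := round N (cand R (J y)) y.
have nuL y : realized L y -> realized L (nu y).
  move=> [yL ys]; apply: (realized_simplex downL yL).
  by apply: round_simplex => //; exact: cand_itv.
have nu_close y : realized L y -> forall l, `|g (nu y) 0 l - g y 0 l| < eps.
  move=> yL; apply: ug => //; first exact: nuL.
  by apply/coord_closeP => l; apply: le_trans Nd; apply: ltW; exact: round_close.
(* Near [x] the rounding with the shift of [x] is constant. So for all [x] close to one [x'], the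
   values [nu (f x)] are among the [e] roundings of the single point [f x']. *)
have nu_fin x x' : realized K x -> realized K x' -> coord_close delta x x' ->
    nu (f x) = round N (cand R (J (f x))) (f x').
  move=> xK xK' xx'; apply/esym; apply: good_round; first exact/JP/fL.
  move=> i iN; apply: le_lt_trans (psum_close N i (delta := th) _ (ltW th0)) _.
    apply/coord_closeP => l; rewrite ltW // distrC; apply: uf => //.
    by apply/coord_closeP => l'; apply: le_trans (coord_closeP _ _ _ xx' l') _; rewrite ge_min lexx.
  rewrite mulrA /th mulrC -mulrA gtr_pMr ?eta_gt0 // mulrC.
  by rewrite ltr_pdivrMr ?mulr_gt0 ?ltr0n // mul1r ltr_pM2l // ltr_nat.
(* The map [h 1] may jump with the choice of shift; the approximation asks only for closeness, not
   for continuity. *)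
pose h i x := if i is 0%N then x else g (nu (f x)).
have hK i x : (i <= 1)%N -> realized K x -> realized K (h i x).
  by case: i => [|i] //= _ xK; apply/gK/nuL/fL.
have h1 x l : realized K x -> `|h 1%N x 0 l - x 0 l| < eps.
  by move=> xK; have := nu_close (f x) (fL xK) l; rewrite gf.
have E3 : n%:R^-1 = eps + eps + eps by rewrite /eps; lra.
have hc i j x y : (i <= 1)%N -> (j <= 1)%N -> (j = i \/ j = i.+1) ->
  realized K x -> realized K y -> coord_close delta x y ->
  forall l, `|h i x 0 l - h j y 0 l| < n%:R^-1.
  move=> i1 j1 ij xK yK /coord_closeP xy l.
  have xyl : `|x 0 l - y 0 l| <= eps by apply: le_trans (xy l) _; rewrite ge_min lexx orbT.
  have := h1 x l xK; have := h1 y l yK; rewrite E3; move: xyl.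
  rewrite ler_norml !ltr_norml => /andP[? ?] /andP[? ?] /andP[? ?].
  case: i i1 ij => [|[|//]] _; case: j j1 => [|[|//]] _ // ij; try (by case: ij).
  - by rewrite [h 0%N x]/= [h 0%N y]/=; apply/andP; split; lra.
  - by rewrite [h 0%N x]/=; apply/andP; split; lra.
  - by apply/andP; split; lra.
have [sub [S [subP _ _ SP]]] := chain_approximation ch2 l0 downK
  delta0 (h := h) (M := 1) (fun x _ => erefl) hK hc.
have degen B t : B \in K -> (e < #|B|)%N -> t \in sub B ->
    smp F [seq label l0 (h 1%N x) | x <- t] = 0.
  move=> BK eB /subP[tB tsimp dt]; rewrite smp_uniq; case: ifP => // u.
  case: t tB tsimp dt u => [|x0 t] tB tsimp dt u; first by rewrite -tB in eB.
  have xK x : x \in x0 :: t -> realized K x.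
    by move=> xt; exact: (realized_simplex downK BK (allP tsimp x xt)).
  pose val (j : 'I_e) := label l0 (g (round N (cand R j) (f x0))).
  have /uniq_leq_size := u; move=> /(_ (codom val)).
  rewrite size_codom card_ord size_map tB leqNgt eB => H; exfalso.
  suff : false by [].
  apply: H => _ /mapP[x xt ->]; apply/codomP.
  exists (J (f x)).
  rewrite /val /h (nu_fin x x0) //; [exact: xK|exact/xK/mem_head|].
  by apply: dt => //; exact: mem_head.
(* The labelled subdivision kills [c], so [c] is the boundary of [ext S c]; a maximal face has
   coefficient 0 in such a boundary. *)
have Ec : ext (fun B => bd (S B) + \sum_(v in B) S (B :\ v)) c = c.
  rewrite -[RHS]ext_ind; apply: eq_ext => B /cK[BK Bk].
  have [_ ->] := SP B BK; rewrite big_seq big1 ?addr0 // => t tB.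
  by apply: degen tB => //; rewrite Bk.
move: cA; rewrite -Ec extDl -ext_bd -bd_ext bc => /eqP; apply.
rewrite ffunE [X in _ + X](_ : _ = 0) ?addr0; last first.
  by rewrite extE big1 // => B _; rewrite ffunE mul0r.
rewrite ffunE big1 // => v vA; rewrite extE big1 // => B _.
have [->|/cK[BK _]] := eqVneq (c B) 0; first by rewrite mul0r.
have [SBK _] := SP B BK.
have [->|/SBK] := eqVneq (S B (v |: A)) 0; first by rewrite mulr0.
by rewrite (negPf (maxA v vA)).
Qed.

End Dimension.

(** * The cross-polytope as a model of the sphere *)

Section CrossPolytope.
Context (F : fieldType) (ch2 : forall x : F, x + x = 0) (R : realType) (d : nat).
Notation D := d.+1.
Implicit Types (A : {set 'I_(D + D)}) (i : 'I_D).

(* The vertices lshift D i and rshift D i are the opposite points e_i and - e_i. *)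
Definition crosspolytope : {set {set 'I_(D + D)}} :=
  [set A : {set 'I_(D + D)} | [forall i : 'I_D, ~~ ((lshift D i \in A) && (rshift D i \in A))]].

Lemma crosspolytopeP A :
  reflect (forall i, ~ (lshift D i \in A /\ rshift D i \in A)) (A \in crosspolytope).
Proof.
rewrite inE; apply: (iffP forallP) => h i.
  by have := h i => /negP h' [a b]; apply: h'; rewrite a b.
by apply/negP => /andP[a b]; apply: (h i).
Qed.

Lemma crosspolytope_down : downset crosspolytope.
Proof.
move=> A B /crosspolytopeP AK /fintype.subsetP BA; apply/crosspolytopeP => i [a b].
by apply: (AK i); split; exact: BA.
Qed.

Definition axis (k : 'I_(D + D)) : 'I_D :=
  match fintype.split k with inl i => i | inr i => i end.

Lemma axis_l i : axis (lshift D i) = i.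
Proof. by rewrite /axis (unsplitK (inl _ i)). Qed.

Lemma axis_r i : axis (rshift D i) = i.
Proof. by rewrite /axis (unsplitK (inr _ i)). Qed.

Lemma card_crosspolytope A : A \in crosspolytope -> (#|A| <= D)%N.
Proof.
move/crosspolytopeP => h; rewrite -[X in (_ <= X)%N]card_ord.
rewrite -(@card_in_imset _ _ axis (mem A)); first exact: max_card.
move=> k k' kA k'A; have [i|i] := split_ordP k => ek; have [j|j] := split_ordP k' => ek';
  rewrite ek ek' ?axis_l ?axis_r => ij; rewrite ?ij //.
  by case: (h i); rewrite {2}ij -ek -ek'.
by case: (h j); rewrite -{2}ij -ek -ek'.
Qed.

(** The iterated join of the 0-cycles formed by [e_i] and [- e_i]: for all [i], the fundamental
    cycle of the cross-polytope. *)
Fixpoint cross_cycle (s : seq 'I_D) : {ffun {set 'I_(D + D)} -> F} :=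
  if s is i :: s' then cone (lshift D i) (cross_cycle s') + cone (rshift D i) (cross_cycle s')
  else ind F finset.set0.

Lemma bd_cross_cycle s : bd (cross_cycle s) = 0.
Proof.
elim: s => [|i s IH] /=; first exact: bd_ind0.
by rewrite bdD !bd_cone // IH !cone0 !addr0 (chain_ch2 ch2).
Qed.

Lemma cross_cycle_supp s A : uniq s -> cross_cycle s A != 0 ->
  [/\ A \in crosspolytope, #|A| = size s & forall k, k \in A -> axis k \in s].
Proof.
elim: s A => [|i s IH] A /=.
  rewrite ffunE; case: (A =P finset.set0) => [-> _ _|]; last by rewrite eqxx.
  by split; [apply/crosspolytopeP => i []; rewrite inE|rewrite cards0|move=> k; rewrite inE].
case/andP=> iN us h.
have [k [ki kA ck]] : exists k, [/\ axis k = i, k \in A & cross_cycle s (A :\ k) != 0].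
  move: h; rewrite !ffunE; case: ifP => lA; case: ifP => rA; rewrite ?addr0 ?add0r ?eqxx // => h.
  - have [e|h'] := eqVneq (cross_cycle s (A :\ lshift D i)) 0.
      by exists (rshift D i); rewrite axis_r; split => //; move: h; rewrite e add0r.
    by exists (lshift D i); rewrite axis_l.
  - by exists (lshift D i); rewrite axis_l.
  - by exists (rshift D i); rewrite axis_r.
have [/crosspolytopeP AK As Ax] := IH _ us ck.
have notk k' : k' \in A -> k' != k -> axis k' \in s.
  by move=> k'A k'k; apply: Ax; rewrite !inE k'k.
split; last first.
- move=> k' k'A; rewrite inE; have [->|/(notk _ k'A)->] := eqVneq k' k; last by rewrite orbT.
  by rewrite ki eqxx.
- by rewrite (cardsD1 k) kA As.
apply/crosspolytopeP => j [jl jr]; have [ji|ji] := eqVneq j i.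
  have [kl|kl] := eqVneq (lshift D j) k.
    have := notk _ jr; rewrite -kl axis_r ji (negPf iN) => H.
    by have := H (negbT (eq_rlshift _ _)).
  by have := notk _ jl kl; rewrite axis_l ji (negPf iN).
apply: (AK j); rewrite !inE jl jr.
by split; rewrite andbT; apply: contra ji => /eqP e; rewrite -ki -e ?axis_l ?axis_r.
Qed.

Lemma cross_cycle_neq0 s : uniq s -> cross_cycle s [set lshift D i | i in s] = 1.
Proof.
elim: s => [|i s IH] /=.
  move=> _; rewrite ffunE.
  have -> : [set lshift D i | i in ([::] : seq 'I_D)] = finset.set0; last by rewrite eqxx.
  by apply/finset.setP => k; rewrite inE; apply/imsetP => -[j].
case/andP=> iN us; set A := imset _ _.
have lA : lshift D i \in A by apply: imset_f; exact: mem_head.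
have rA : rshift D i \in A = false by apply/imsetP => -[j _ /eqP]; rewrite eq_rlshift.
rewrite ffunE [X in X + _]ffunE [X in _ + X]ffunE lA rA addr0.
rewrite -[RHS](IH us); congr (cross_cycle s _); apply/setP => k; rewrite !inE.
apply/andP/imsetP => [[ki /imsetP[j]]|[j js ->]].
  rewrite inE => /orP[/eqP->|js ek]; last by exists j.
  by move=> e; rewrite e eqxx in ki.
split; last by apply: imset_f; rewrite inE js orbT.
by apply: contraNneq iN => /lshift_inj <-.
Qed.

Definition to_sphere (x : 'rV[R]_(D + D)) : 'rV[R]_D :=
  normalize (\row_i (x 0 (lshift D i) - x 0 (rshift D i))).

Definition norm1 (y : 'rV[R]_D) : R := \sum_i `|y 0 i|.

(** Radial projection to the unit sphere of the 1-norm, whose positive and negative parts are the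
    barycentric coordinates. *)
Definition from_sphere (y : 'rV[R]_D) : 'rV[R]_(D + D) :=
  (norm1 y)^-1 *: row_mx (\row_i Num.max (y 0 i) 0) (\row_i Num.max (- y 0 i) 0).

Lemma from_sphere_l y i : from_sphere y 0 (lshift D i) = (norm1 y)^-1 * Num.max (y 0 i) 0.
Proof. by rewrite mxE row_mxEl mxE. Qed.

Lemma from_sphere_r y i : from_sphere y 0 (rshift D i) = (norm1 y)^-1 * Num.max (- y 0 i) 0.
Proof. by rewrite mxE row_mxEr mxE. Qed.

Lemma from_sphereZ (a : R) y : 0 < a -> from_sphere (a *: y) = from_sphere y.
Proof.
move=> a0; rewrite /from_sphere.
have N : norm1 (a *: y) = a * norm1 y.
  by rewrite /norm1 mulr_sumr; apply: eq_bigr => i _; rewrite mxE normrM gtr0_norm.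
have E (b : R) : Num.max (a * b) 0 = a * Num.max b 0.
  by rewrite -[X in Num.max _ X](mulr0 a) maxr_pMr // ltW.
have [aN0 c] : a != 0 /\ forall z, (a * norm1 y)^-1 * (a * z) = (norm1 y)^-1 * z.
  by split=> [|z]; rewrite ?gt_eqF // invfM mulrACA mulVf ?mul1r // gt_eqF.
apply/rowP => k; have [i|i] := split_ordP k => ->.
  by rewrite !from_sphere_l N mxE E c.
by rewrite !from_sphere_r N mxE -mulrN E c.
Qed.

Let diff (x : 'rV[R]_(D + D)) : 'rV[R]_D := \row_i (x 0 (lshift D i) - x 0 (rshift D i)).

Lemma cross_disjoint (x : 'rV[R]_(D + D)) i : realized crosspolytope x ->
  x 0 (lshift D i) = 0 \/ x 0 (rshift D i) = 0.
Proof.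
case=> /crosspolytopeP /(_ i) h _.
have [->|l0] := eqVneq (x 0 (lshift D i)) 0; first by left.
have [->|r0] := eqVneq (x 0 (rshift D i)) 0; first by right.
by case: h; rewrite !inE.
Qed.

Lemma norm1_diff (x : 'rV[R]_(D + D)) : realized crosspolytope x -> norm1 (diff x) = 1.
Proof.
move=> xL; have [_ /simplexP[x0 x1 _]] := xL.
rewrite -[RHS]x1 [RHS]big_split_ord /= -big_split; apply: eq_bigr => i _ /=; rewrite mxE.
have [->|->] := cross_disjoint i xL; first by rewrite sub0r normrN add0r ger0_norm.
by rewrite subr0 addr0 ger0_norm.
Qed.

Lemma from_diff (x : 'rV[R]_(D + D)) : realized crosspolytope x -> from_sphere (diff x) = x.
Proof.
move=> xL; have [_ /simplexP[x0 x1 _]] := xL.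
apply/rowP => k; have [i|i] := split_ordP k => ->.
  rewrite from_sphere_l norm1_diff // invr1 mul1r mxE; have [->|->] := cross_disjoint i xL.
    by rewrite sub0r max_r // oppr_le0.
  by rewrite subr0 max_l.
rewrite from_sphere_r norm1_diff // invr1 mul1r mxE; have [->|->] := cross_disjoint i xL.
  by rewrite sub0r opprK max_l.
by rewrite subr0 max_r // oppr_le0.
Qed.

Lemma diff_neq0 (x : 'rV[R]_(D + D)) : realized crosspolytope x -> diff x != 0.
Proof.
move=> /norm1_diff n1; apply/eqP => e; move: n1; rewrite e /norm1 big1.
  by move/eqP; rewrite eq_sym oner_eq0.
by move=> i _; rewrite mxE normr0.
Qed.

Lemma sqnorm_gt0 (v : 'rV[R]_D) : v != 0 -> 0 < sqnorm v.
Proof.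
move=> v0; rewrite lt_neqAle sqnorm_ge0 andbT eq_sym.
by apply: contra_neq v0 => /sqnorm_eq0.
Qed.

Lemma to_sphereP (x : 'rV[R]_(D + D)) : realized crosspolytope x -> sqnorm (to_sphere x) = 1.
Proof. by move=> /diff_neq0 h; exact: normalize_sphere. Qed.

Lemma to_sphereK (x : 'rV[R]_(D + D)) : realized crosspolytope x -> from_sphere (to_sphere x) = x.
Proof.
move=> xL; rewrite /to_sphere -/(diff x) /normalize from_sphereZ; first exact: from_diff.
by rewrite invr_gt0 sqrtr_gt0 sqnorm_gt0 // diff_neq0.
Qed.

Lemma norm1_gt0 (y : 'rV[R]_D) : sqnorm y = 1 -> 0 < norm1 y.
Proof.
move=> y1; rewrite lt_neqAle; apply/andP; split; last by apply: sumr_ge0.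
apply/eqP => /esym /eqP; rewrite psumr_eq0 // => /allP h.
have : sqnorm y = 0.
  rewrite /sqnorm big1 // => i _; have := h i (mem_index_enum _).
  by rewrite normr_eq0 => /eqP->; rewrite expr0n.
by rewrite y1 => /eqP; rewrite oner_eq0.
Qed.

Lemma max0_sub (a : R) : Num.max a 0 - Num.max (- a) 0 = a.
Proof.
have [h|] := boolP (0 <= a); first by rewrite max_l // max_r ?oppr_le0 // subr0.
by rewrite -ltNge => h; rewrite max_r ?(ltW h) // max_l ?oppr_ge0 ?(ltW h) // sub0r opprK.
Qed.

Lemma max0_add (a : R) : Num.max a 0 + Num.max (- a) 0 = `|a|.
Proof.
have [h|] := boolP (0 <= a).
  by rewrite max_l // max_r ?oppr_le0 // addr0 ger0_norm.
by rewrite -ltNge => h; rewrite max_r ?(ltW h) // max_l ?oppr_ge0 ?(ltW h) // add0r ltr0_norm.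
Qed.

Lemma from_sphereP y : sqnorm y = 1 -> realized crosspolytope (from_sphere y).
Proof.
move=> y1; have n0 := norm1_gt0 y1.
have yK : vsupp (from_sphere y) \in crosspolytope.
  apply/crosspolytopeP => i [] /[!inE]; rewrite from_sphere_l from_sphere_r.
  rewrite !mulf_eq0 !negb_or => /andP[_ h1] /andP[_ h2].
  have [h|] := boolP (0 <= y 0 i); first by rewrite max_r ?oppr_le0 ?eqxx in h2.
  by rewrite -ltNge => h; rewrite max_r ?(ltW h) ?eqxx in h1.
split => //; apply/simplexP; split => //.
  move=> k; have [i|i] := split_ordP k => ->; rewrite ?from_sphere_l ?from_sphere_r;
    by rewrite mulr_ge0 ?invr_ge0 ?(ltW n0) // le_max lexx orbT.
rewrite big_split_ord /= -big_split /=.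
rewrite (eq_bigr (fun i => (norm1 y)^-1 * `|y 0 i|)) => [|i _].
  by rewrite -mulr_sumr mulVf // gt_eqF.
by rewrite from_sphere_l from_sphere_r -mulrDr max0_add.
Qed.

Lemma from_sphereK y : sqnorm y = 1 -> to_sphere (from_sphere y) = y.
Proof.
move=> y1; have n0 := norm1_gt0 y1; rewrite /to_sphere.
have -> : (\row_i (from_sphere y 0 (lshift D i) - from_sphere y 0 (rshift D i))) =
  (norm1 y)^-1 *: y.
  by apply/rowP => i; rewrite mxE from_sphere_l from_sphere_r -mulrBr max0_sub mxE.
rewrite /normalize sqnormZ y1 mulr1 sqrtr_sqr gtr0_norm ?invr_gt0 // invrK scalerA.
by rewrite divff ?scale1r // gt_eqF.
Qed.

Lemma cont_to_sphere : cont_on [set x | realized crosspolytope x]%classic to_sphere.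
Proof.
rewrite (_ : to_sphere = @normalize R d \o diff) //.
apply: cont_normalize => [x|]; first exact: diff_neq0.
apply: cont_rV => i.
have -> : (fun x => diff x 0 i) = (fun x => x 0 (lshift D i) - x 0 (rshift D i)).
  by apply/funext => x; rewrite mxE.
by apply: contB; exact: cont_proj.
Qed.

Lemma cont_from_sphere : cont_on [set y | sqnorm y = 1]%classic from_sphere.
Proof.
apply: cont_rV => k.
set E := mkset _.
have cn : cont_on E (fun y => (norm1 y)^-1).
  apply: contV => [y /norm1_gt0|]; first by move=> h; rewrite gt_eqF.
  by apply: cont_sum => i; apply: cont_norm; exact: cont_proj.
have [i|i] := split_ordP k => ->.
  have -> : (fun y => from_sphere y 0 (lshift D i)) = (fun y => (norm1 y)^-1 * Num.max (y 0 i) 0).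
    by apply/funext => y; exact: from_sphere_l.
  by apply: contM => //; apply: cont_max; [exact: cont_proj | exact: cont_cst].
have -> : (fun y => from_sphere y 0 (rshift D i)) = (fun y => (norm1 y)^-1 * Num.max (- y 0 i) 0).
  by apply/funext => y; exact: from_sphere_r.
by apply: contM => //; apply: cont_max; [apply: contN; exact: cont_proj | exact: cont_cst].
Qed.

End CrossPolytope.

(** * Application to simplicial spheres *)

Lemma char2_field_large (n : nat) :
  exists2 F : finFieldType, (forall x : F, x + x = 0) & exists t : 'I_n -> F, injective t.
Proof.
have [F ch2 cF] := @pPrimePowerField 2 n.+1 isT isT.
exists F => [x|]; first exact: addrr_pchar2.
have nF : (n <= #|F|)%N by rewrite cF; apply: ltnW; apply: ltn_trans (ltnSn n) (ltn_expl n.+1 _).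
by exists (fun i => enum_val (widen_ord nF i)) => i j /enum_val_inj /(congr1 val) /= /val_inj.
Qed.

Lemma bin_le_exp (m b : nat) : ('C(m, b) <= m ^ b)%N.
Proof.
elim: b m => [|b IH] m; first by rewrite bin0.
case: m => [|m]; first by rewrite bin0n.
apply: leq_trans (leq_pmull _ (ltn0Sn b)) _.
rewrite -mul_bin_diag expnS leq_mul2l /=; apply: leq_trans (IH m) _.
by case: b {IH} => // b; rewrite leq_exp2r.
Qed.

(** It holds for [m >= N] too, as [find] never exceeds the length; so a coloring with more than [n]
    colors needs no separate treatment. *)
Lemma find_iota_le (P : pred nat) (N m : nat) : P m -> (find P (iota 0 N) <= m)%N.
Proof.
move=> Pm; rewrite leqNgt; apply/negP => h; have := before_find 0%N h.
by rewrite nth_iota ?Pm // (leq_trans h) // -[X in (_ <= X)%N](size_iota 0 N) find_size.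
Qed.

Section SimplicialSphere.
Context (F : fieldType) (ch2 : forall x : F, x + x = 0) (R : realType) (d n : nat).
Context (K0 : {set {set 'I_n}}) (n0 : (0 < n)%N) (sphK : simplicial_sphere R d K0).

Let K := finset.set0 |: K0.

Lemma sphere_down : downset K.
Proof.
case: sphK => -[h1 [h2 h3]] _ A B; rewrite !inE => /orP[/eqP->|AK] BA.
  by rewrite -finset.subset0 BA.
by case: eqVneq => //= B0; exact: h2 BA B0.
Qed.

Lemma sphere_vertex v : [set v]%SET \in K.
Proof. by case: sphK => -[_ [_ h]] _; rewrite inE h orbT. Qed.

(** The added empty face realizes no point, because the coordinates sum to 1. *)
Lemma realizedE (x : 'rV[R]_n) : realized K x <-> geom_realization R K0 x.
Proof.
split.
  case=> xK /simplexP[x0 x1 _]; split => //; split => //.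
  exists (vsupp x) => [|l xl]; last by rewrite inE.
  move: xK; rewrite inE => /orP[|//]; rewrite inE => /eqP xs.
  move: x1; rewrite big1 => [/eqP|l _]; first by rewrite eq_sym oner_eq0.
  apply/eqP/negPn/negP => xl.
  by have : l \in vsupp x by [rewrite inE]; rewrite xs inE.
case=> x0 [x1 [A AK xA]]; apply: (realized_simplex sphere_down (A := A)).
  by rewrite inE AK orbT.
apply/simplexP; split => //; apply/fintype.subsetP => l; rewrite inE; exact: xA.
Qed.

Lemma sphere_maps : exists (f : 'rV[R]_n -> 'rV[R]_d.+1) (g : 'rV[R]_d.+1 -> 'rV[R]_n),
  [/\ forall x, realized K x -> sqnorm (f x) = 1,
      forall y, sqnorm y = 1 -> realized K (g y),
      forall x, realized K x -> g (f x) = x,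
      forall y, sqnorm y = 1 -> f (g y) = y &
      cont_on [set x | realized K x]%classic f /\ cont_on [set y | sqnorm y = 1]%classic g].
Proof.
have [_ [f [g [[fS gK gf fg] [cf cg]]]]] := sphK.
have E : [set x | realized K x]%classic = geom_realization R K0.
  by apply/seteqP; split => x /=; rewrite realizedE.
exists f, g; split; last (split; [rewrite E|]; exact: cont_within).
- by move=> x /realizedE /fS.
- by move=> y /gK /realizedE.
- by move=> x /realizedE /gf.
- by move=> y /fg.
Qed.

Lemma sphere_contracts G : G \in K -> G != finset.set0 -> contracts F (deletion K G).
Proof.
have [f [g [fS gK gf fg [cf cg]]]] := sphere_maps.
exact: (deletion_contracts ch2 sphere_down fS gK gf fg cf cg).
Qed.

Lemma maxface_neq0 A : maxface K A -> A != finset.set0.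
Proof.
move=> mA; apply/eqP => A0; have := maxfaceP mA (sphere_vertex (Ordinal n0)).
rewrite A0 => /(_ (finset.sub0set _)) /eqP; rewrite -cards_eq0 cards1 //.
Qed.

(** The comparison with the cross-polytope is used in both directions: if [#|s| > d.+1], the
    fundamental cycle of [K] would vanish at [s]; if [#|s| < d.+1], the explicit cycle of the
    cross-polytope would vanish at one of its facets. *)
Lemma sphere_pure A : maxface K A -> #|A| = d.+1.
Proof.
have [s _ ms] := exists_maxface (sphere_vertex (Ordinal n0)).
have pure B : maxface K B -> #|B| = #|s|.
  move=> mB; exact: (maxface_pure ch2 sphere_down sphere_contracts mB ms
    (maxface_neq0 mB) (maxface_neq0 ms)).
move=> /pure ->.
have s0 : (0 < #|s|)%N by rewrite card_gt0 maxface_neq0.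
have K0' : finset.set0 \in K by rewrite !inE eqxx.
have faceK := card_face pure.
have [f [g [fS gK gf fg [cf cg]]]] := sphere_maps.
pose f' := from_sphere (d := d) \o f; pose g' := g \o to_sphere (d := d).
have f'L x : realized K x -> realized (crosspolytope d) (f' x) by move=> /fS /from_sphereP.
have g'K y : realized (crosspolytope d) y -> realized K (g' y) by move=> /to_sphereP /gK.
have g'f' x : realized K x -> g' (f' x) = x.
  by move=> xK; rewrite /g' /f' /= from_sphereK ?gf //; exact: fS.
have f'g' y : realized (crosspolytope d) y -> f' (g' y) = y.
  by move=> yL; rewrite /g' /f' /= fg ?to_sphereK //; exact: to_sphereP.
have cf' : cont_on [set x | realized K x]%classic f'.
  exact: (@cont_comp _ _ _ [set x | realized K x] [set y | sqnorm y = 1]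
    f (from_sphere (d := d)) fS cf (cont_from_sphere (d := d)))%classic.
have cg' : cont_on [set x | realized (crosspolytope d) x]%classic g'.
  exact: (@cont_comp _ _ _ [set x | realized (crosspolytope d) x] [set y | sqnorm y = 1]
    (to_sphere (d := d)) g (@to_sphereP R d) (cont_to_sphere (d := d)) cg)%classic.
apply/eqP; rewrite eqn_leq leqNgt [X in _ && X]leqNgt; apply/andP; split; apply/negP => lt.
  have [z [zK bz zN0]] := fundamental_cycle ch2 sphere_down sphere_contracts s0 pure K0'.
  have sK : s \in K by case/andP: ms.
  have := zN0 s sK erefl; rewrite (cycle_vanishes ch2 sphere_down (crosspolytope_down (d := d))
     f'L g'K g'f' cf' cg' (ltn0Sn d) (@card_crosspolytope d) zK bz lt) ?eqxx //.
  move=> v vs; apply/negP => /(maxfaceP ms) /(_ (finset.subsetUr _ _)) e.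
  by rewrite -e finset.setU11 in vs.
have u := enum_uniq 'I_d.+1.
have := cross_cycle_neq0 F u.
set A' := imset _ _ => cA.
have supp B : cross_cycle F (enum 'I_d.+1) B != 0 -> B \in crosspolytope d /\ #|B| = d.+1.
  by move=> /(cross_cycle_supp u)[BL ->]; rewrite size_enum_ord.
have A'N : cross_cycle F (enum 'I_d.+1) A' != 0 by rewrite cA oner_eq0.
have [_ A'd] := supp _ A'N.
move: A'N; rewrite (cycle_vanishes ch2 (crosspolytope_down (d := d)) sphere_down
  g'K f'L f'g' cg' cf' s0 faceK supp (bd_cross_cycle ch2 _) lt) ?eqxx //.
move=> v vA; apply/negP => /card_crosspolytope.
by rewrite cardsU1 vA A'd ltnn.
Qed.

End SimplicialSphere.

Theorem theorem6 (R : realType) (d : nat) (hd : (0 < d)%N) :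
  exists C : R, forall (n : nat) (K : {set {set 'I_n}}),
    (1 <= n)%N -> simplicial_sphere R d K ->
    (facet_chi K)%:R <= C * (n%:R `^ (((uphalf d)%:R - 1) / d%:R)).
Proof.
have k0 : (0 < uphalf d)%N by case: d hd.
have kd : (uphalf d <= d)%N by rewrite leq_uphalf_double -addnn leq_addr.
(* The constant [1 + d ^ i] collects both terms of [card_facets_in], since
   ['C(|W|, b) <= |W| ^ b <= |W| ^ i]. *)
have [B HB] := hereditary_colorable R (1 + d ^ uphalf d)%N hd k0.
exists B => n K n0 sK.
have [F ch2 [t tinj]] := char2_field_large n.
pose K' := finset.set0 |: K; pose E := [set A in K' | #|A| == d.+1].
have Ed : {in E, forall A : {set 'I_n}, #|A| = d.+1} by move=> A; rewrite inE => /andP[_ /eqP].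
have bi : (d - uphalf d + uphalf d)%N = d by rewrite subnK.
have her W : (#|edges_in E W| <= (1 + d ^ uphalf d) * #|W| ^ uphalf d)%N.
  (* An empty [W] must span no edge, whereas the general count leaves ['C(0, 0) = 1] when
     [b = 0]. *)
  have [W0|W0] := eqVneq W finset.set0.
    rewrite (_ : edges_in E W = finset.set0) ?cards0 //; apply/finset.setP => A.
    rewrite inE W0 finset.subset0 finset.in_set0; case: eqVneq => [->|_]; last by rewrite andbF.
    by rewrite inE cards0 andbF.
  have := card_facets_in ch2 tinj (sphere_down sK) (finset.setU11 _ _)
    (sphere_contracts ch2 sK) (sphere_pure ch2 n0 sK) bi W.
  have -> : edges_in E W = [set A in K' | (#|A| == d.+1) && (A \subset W)].
    by apply/finset.setP => A; rewrite !inE andbA.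
  move/leq_trans; apply; rewrite mulnDl mul1n leq_add2l mulnC leq_mul2l; apply/orP; right.
  apply: leq_trans (bin_le_exp _ _) _; rewrite leq_pexp2l ?card_gt0 //.
  by rewrite leq_subLR addnn -leq_uphalf_double.
have [|m [c [cm cE]] mB] := HB _ E Ed her [set: 'I_n]; first by rewrite cardsT card_ord.
rewrite cardsT card_ord in mB; apply: le_trans mB; rewrite ler_nat.
apply: find_iota_le; apply/existsP.
have cm' v : (c v < m)%N by apply: cm; rewrite inE.
exists [ffun v => Ordinal (cm' v)]; apply/forallP => A; apply/implyP => /andP[AK /forall_inP Amax].
have mA : maxface K' A.
  rewrite /maxface inE AK orbT; apply/forall_inP => A1 A1K; apply/implyP => AA1.
  move: A1K; rewrite inE => /orP[|/Amax/implyP/(_ AA1)//].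
  by rewrite inE => /eqP A10; rewrite finset.eqEsubset AA1 A10 finset.sub0set.
have AE : A \in E by rewrite !inE AK orbT (sphere_pure ch2 n0 sK mA) eqxx.
apply/existsP => -[j /fintype.subsetP Aj].
have := cE A AE (finset.subsetT _); case/negP; apply/forall_inP => x xA; apply/forall_inP => y yA.
have := Aj x xA; have := Aj y yA; rewrite !inE /= !ffunE => /eqP <- /eqP e.
by have /= -> := congr1 val e.
Qed.
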